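(* Let $(M,\omega)$ be an $n$-dimensional compact Hermitian manifold, let $k\in\{1,\ldots,n\}$, let $(E,h)$ be a Hermitian holomorphic vector bundle over $M$ which is uniformly RC $k$-positive over $(M,\omega)$, and let $F$ be any holomorphic vector bundle over $M$. Then there exist positive constants $C_1=C_1(h,\omega)$ (depending only on $h$ and $\omega$) and $C_2=C_2(F,h,\omega)$ (depending on $F$, $h$ and $\omega$) such that $$H^0\big(M,E^{\otimes p}\otimes (E^{\ast})^{\otimes q}\otimes F^{\otimes m}\big)=0$$ for all $p,q,m\in\mathbb{Z}_{\geq 0}$ with $q> C_1\cdot p+C_2\cdot m$.
   Context: $H^0(M,\cdot)$ denotes the space of global holomorphic sections. $T_xM$ denotes the $(1,0)$-type (holomorphic) tangent space at $x$. Chern curvature: for a Hermitian holomorphic vector bundle $(E,h)$ over a complex manifold $M$ with Chern connection $\nabla$, the Chern curvature tensor is $R^{(E,h)}=\nabla^2\in\Gamma(\Lambda^{1,1}M\otimes E^\ast\otimes E)$. For $X,Y\in T_xM$ and $u,v\in E_x$, $R_{X\overline{Y}}(u)\in E_x$ is obtained by evaluating the curvature $(1,1)$-form on $(X,\overline{Y})$ and applying it to $u$, and $R^{(E,h)}(X,\overline{Y},u,\overline{v}):=h\big(R_{X\overline{Y}}(u),v\big)$. Uniform RC $k$-positivity: a Hermitian holomorphic vector bundle $(E,h)$ over an $n$-dimensional Hermitian manifold $(M,\omega)$ is called uniformly RC $k$-positive ($1\leq k\leq n$) if for every $x\in M$ there exists a $k$-dimensional complex subspace $\Sigma\subset T_xM$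 such that for every nonzero $u\in E_x$, $$R^{(E,h)}(\Sigma;u,\overline{u}):=\sum_{i=1}^kR^{(E,h)}(E_i,\overline{E_i},u,\overline{u})>0,$$ where $\{E_1,\ldots,E_k\}$ is a unitary basis of $\Sigma$ with respect to $\omega$. *)

(* Defs.v *)
From HB Require Import structures.
From mathcomp Require Import all_boot all_order all_algebra.
From mathcomp Require Import complex mxtens ring.
From mathcomp Require Import all_classical all_reals all_analysis.

Set Implicit Arguments.
Unset Strict Implicit.
Unset Printing Implicit Defensive.

Import Order.TTheory GRing.Theory Num.Theory.
Import numFieldNormedType.Exports.

Local Open Scope classical_set_scope.
Local Open Scope ring_scope.

(* R[i] packaged as a [numClosedFieldType], so that the generic topology of a
   [numFieldType] applies to it; the order is the one in which 0 < z means
   that z is real and positive. *)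
Definition Cplx (R : realType) : numClosedFieldType := complex R.

Definition RtoC (R : realType) (t : R) : Cplx R := real_complex R t.

Definition conj_tr (R : realType) (m p : nat) (A : 'M[Cplx R]_(m, p)) :
  'M[Cplx R]_(p, m) := map_mx Num.conj A^T.

Section Calculus.
Variables (R : realType) (n : nat).
Local Notation C := (Cplx R).
Implicit Types (f g : 'rV[C]_n -> C) (z v : 'rV[C]_n) (U V : set 'rV[C]_n).

Definition re_line f z v (t : R) : R := complex.Re (f (z + RtoC t *: v)).
Definition im_line f z v (t : R) : R := complex.Im (f (z + RtoC t *: v)).

Definition rderivable f z v : Prop :=
  derivable (re_line f z v) 0 1 /\ derivable (im_line f z v) 0 1.

(* Real directional derivative at z along v. *)
Definition rderive v f z : C :=
  Complex ('D_1 (re_line f z v) 0) ('D_1 (im_line f z v) 0).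

Definition basis_vec (j : 'I_n) : 'rV[C]_n := delta_mx 0 j.

(* Real C^k functions on an open set: the directions basis_vec j and
   'i *: basis_vec j are the 2n real coordinate directions of C^n. *)
Fixpoint Ck U (k : nat) f : Prop :=
  (forall z, U z -> {for z, continuous f}) /\
  if k is k'.+1 then
    forall (j : 'I_n) (c : C), c = 1 \/ c = 'i ->
      (forall z, U z -> rderivable f z (c *: basis_vec j)) /\
      Ck U k' (rderive (c *: basis_vec j) f)
  else True.

Definition smooth_on U f : Prop := forall k, Ck U k f.

(* Wirtinger derivatives d/dz_j and d/d(conj z_j). *)
Definition dz (j : 'I_n) f z : C :=
  2^-1 * (rderive (basis_vec j) f z - 'i * rderive ('i *: basis_vec j) f z).
Definition dzbar (j : 'I_n) f z : C :=
  2^-1 * (rderive (basis_vec j) f z + 'i * rderive ('i *: basis_vec j) f z).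

(* Griffiths-Harris' definition of a holomorphic function of n variables:
   smooth, and satisfying the Cauchy-Riemann equations. *)
Definition holomorphic_on U f : Prop :=
  smooth_on U f /\ forall z, U z -> forall j, dzbar j f z = 0.

Definition dz_mx (m p : nat) (j : 'I_n) (A : 'rV[C]_n -> 'M[C]_(m, p)) z :
  'M[C]_(m, p) := \matrix_(a, b) dz j (fun w => A w a b) z.
Definition dzbar_mx (m p : nat) (j : 'I_n) (A : 'rV[C]_n -> 'M[C]_(m, p)) z :
  'M[C]_(m, p) := \matrix_(a, b) dzbar j (fun w => A w a b) z.

End Calculus.

Section ReIm.
Variable R : realType.
Implicit Types x y : Cplx R.

Lemma ReD x y : complex.Re (x + y) = complex.Re x + complex.Re y.
Proof. by case: x => a b; case: y. Qed.

Lemma ImD x y : complex.Im (x + y) = complex.Im x + complex.Im y.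
Proof. by case: x => a b; case: y. Qed.

Lemma ReM x y : complex.Re (x * y) =
  complex.Re x * complex.Re y - complex.Im x * complex.Im y.
Proof. by case: x => a b; case: y. Qed.

Lemma ImM x y : complex.Im (x * y) =
  complex.Re x * complex.Im y + complex.Im x * complex.Re y.
Proof. by case: x => a b; case: y. Qed.

Lemma eq_ReIm x y : complex.Re x = complex.Re y ->
  complex.Im x = complex.Im y -> x = y.
Proof. by case: x => a b; case: y => c d /= -> ->. Qed.

End ReIm.

Section CalculusLemmas.
Variables (R : realType) (n : nat).
Local Notation C := (Cplx R).
Implicit Types (f g : 'rV[C]_n -> C) (z v : 'rV[C]_n) (U V : set 'rV[C]_n).

Lemma Ck_continuous U k f z : Ck U k f -> U z -> {for z, continuous f}.
Proof. by case: k => [|k] [fc _]; exact: fc. Qed.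

Lemma Ck_sub U V k f : V `<=` U -> Ck U k f -> Ck V k f.
Proof.
move=> VU; elim: k f => [|k IH] f [fc H]; split => //.
- by move=> z /VU; exact: fc.
- by move=> z /VU; exact: fc.
- move=> j c hc; have [H1 H2] := H j c hc; split; last exact: IH.
  by move=> z /VU; exact: H1.
Qed.

Lemma Ck_pred U k f : Ck U k.+1 f -> Ck U k f.
Proof.
elim: k f => [|k IH] f [fc H]; split => //.
move=> j c hc; have [H1 H2] := H j c hc; split => //; exact: IH.
Qed.

Lemma line_continuous z v : continuous (fun t : R => z + RtoC t *: v).
Proof.
move=> t; apply: cvgD; first exact: cvg_cst.
apply: cvgZr_tmp.
apply/cvgrPdist_lt => e e0.
case: e e0 => er ei; rewrite ltcE /= => /andP[/eqP -> er0].
near=> s.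
have -> : `|RtoC t - RtoC s| = RtoC `|t - s|.
  by rewrite /RtoC -rmorphB /= normc_def /= expr0n /= addr0 sqrtr_sqr.
rewrite /RtoC ltcE /= eqxx /=.
by near: s; apply: (@cvgr_dist_lt R R) => //; exact: cvg_id.
Unshelve. all: by end_near. Qed.

Lemma near_line U z v : open U -> U z ->
  \forall t \near (0 : R), U (z + RtoC t *: v).
Proof.
move=> Uo Uz.
have z0 : z + RtoC 0 *: v = z by rewrite (_ : RtoC 0 = 0)// scale0r addr0.
by apply: (@line_continuous z v 0); rewrite z0; exact: open_nbhs_nbhs.
Qed.

Lemma near_lines f g U z v : open U -> (forall z, U z -> f z = g z) -> U z ->
  (\forall t \near (0 : R), re_line f z v t = re_line g z v t) /\
  (\forall t \near (0 : R), im_line f z v t = im_line g z v t).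
Proof.
move=> Uo fg Uz; have Ul := near_line v Uo Uz.
by split; apply: filterS Ul => t Ut; rewrite /re_line /im_line fg.
Qed.

Lemma rderivable_ext f g U z v : open U -> (forall z, U z -> f z = g z) ->
  U z -> rderivable f z v -> rderivable g z v.
Proof.
move=> Uo fg Uz [H1 H2]; have [e1 e2] := near_lines v Uo fg Uz.
by split; [apply: near_eq_derivable e1 H1 | apply: near_eq_derivable e2 H2].
Qed.

Lemma rderive_ext f g U z v : open U -> (forall z, U z -> f z = g z) ->
  U z -> rderive v f z = rderive v g z.
Proof.
move=> Uo fg Uz; have [e1 e2] := near_lines v Uo fg Uz.
by congr Complex; exact: near_eq_derive.
Qed.

Lemma continuous_ext_open f g U z : open U -> (forall z, U z -> f z = g z) ->
  U z -> {for z, continuous f} -> {for z, continuous g}.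
Proof.
move=> Uo fg Uz fc.
have e : \forall w \near z, f w = g w.
  by apply: filterS (open_nbhs_nbhs (conj Uo Uz)) => w Uw; exact: fg.
have fz : f z = g z by exact: fg.
move: fc; rewrite /prop_for /continuous_at fz => fc.
exact: cvg_trans (near_eq_cvg e) fc.
Qed.

Lemma Ck_ext U k f g : open U -> (forall z, U z -> f z = g z) ->
  Ck U k f -> Ck U k g.
Proof.
move=> Uo; elim: k f g => [|k IH] f g fg [fc H]; (split;
  first by move=> z Uz; apply: (continuous_ext_open Uo fg Uz (fc z Uz))).
  exact: I.
move=> j c hc; have [H1 H2] := H j c hc; split.
  by move=> z Uz; exact: (rderivable_ext Uo fg Uz (H1 z Uz)).
by apply: IH H2 => z Uz; exact: (rderive_ext _ Uo fg Uz).
Qed.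

Lemma re_line_add f g z v :
  re_line (fun w => f w + g w) z v = re_line f z v + re_line g z v.
Proof. by apply/funext => t; exact: ReD. Qed.

Lemma im_line_add f g z v :
  im_line (fun w => f w + g w) z v = im_line f z v + im_line g z v.
Proof. by apply/funext => t; exact: ImD. Qed.

Lemma re_line_mul f g z v : re_line (fun w => f w * g w) z v =
  re_line f z v * re_line g z v - im_line f z v * im_line g z v.
Proof. by apply/funext => t; exact: ReM. Qed.

Lemma im_line_mul f g z v : im_line (fun w => f w * g w) z v =
  re_line f z v * im_line g z v + im_line f z v * re_line g z v.
Proof. by apply/funext => t; exact: ImM. Qed.

Lemma rderivable_add f g z v : rderivable f z v -> rderivable g z v ->
  rderivable (fun w => f w + g w) z v.
Proof.
move=> [f1 f2] [g1 g2].
by split; rewrite (re_line_add, im_line_add); exact: derivableD.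
Qed.

Lemma rderive_add f g z v : rderivable f z v -> rderivable g z v ->
  rderive v (fun w => f w + g w) z = rderive v f z + rderive v g z.
Proof.
move=> [f1 f2] [g1 g2].
by rewrite /rderive re_line_add im_line_add !deriveD.
Qed.

Lemma rderivable_mul f g z v : rderivable f z v -> rderivable g z v ->
  rderivable (fun w => f w * g w) z v.
Proof.
move=> [f1 f2] [g1 g2]; split.
  by rewrite re_line_mul; exact: derivableB (derivableM f1 g1) (derivableM f2 g2).
by rewrite im_line_mul; exact: derivableD (derivableM f1 g2) (derivableM f2 g1).
Qed.

Lemma re_line0 f z v : re_line f z v 0 = complex.Re (f z).
Proof. by rewrite /re_line (_ : RtoC 0 = 0)// scale0r addr0. Qed.

Lemma im_line0 f z v : im_line f z v 0 = complex.Im (f z).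
Proof. by rewrite /im_line (_ : RtoC 0 = 0)// scale0r addr0. Qed.

Lemma rderive_mul f g z v : rderivable f z v -> rderivable g z v ->
  rderive v (fun w => f w * g w) z = f z * rderive v g z + rderive v f z * g z.
Proof.
move=> [f1 f2] [g1 g2].
rewrite /rderive re_line_mul im_line_mul.
rewrite (deriveB (derivableM f1 g1) (derivableM f2 g2)).
rewrite (deriveD (derivableM f1 g2) (derivableM f2 g1)).
have -> := deriveM f1 g1; have -> := deriveM f2 g2.
have -> := deriveM f1 g2; have -> := deriveM f2 g1.
rewrite !re_line0 !im_line0.
set a := derive (re_line f z v) _ _; set b := derive (im_line f z v) _ _.
set c := derive (re_line g z v) _ _; set d := derive (im_line g z v) _ _.
move: a b c d (f z) (g z) => a b c d [x1 x2] [y1 y2].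
by apply: eq_ReIm; rewrite (ReD, ImD) !(ReM, ImM) /= /GRing.scale /=; ring.
Qed.

Lemma rderivable_cst (c : C) z v : rderivable (fun=> c) z v.
Proof. by split; exact: derivable_cst. Qed.

Lemma rderive_cst (c : C) v : rderive v (fun=> c) = fun=> 0.
Proof.
apply/funext => z; rewrite /rderive /re_line /im_line !derive_cst.
exact: eq_ReIm.
Qed.

Lemma Ck_cst U k (c : C) : Ck U k (fun=> c).
Proof.
elim: k c => [|k IH] c; (split; first by move=> z _; exact: cst_continuous).
  exact: I.
move=> j d _; split; first by move=> z _; exact: rderivable_cst.
by rewrite rderive_cst; exact: IH.
Qed.

Lemma Ck_add U k f g : open U -> Ck U k f -> Ck U k g ->
  Ck U k (fun w => f w + g w).
Proof.
move=> Uo; elim: k f g => [|k IH] f g [fc Hf] [gc Hg];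
  (split; first by move=> z Uz; exact: (continuousD (fc z Uz) (gc z Uz))).
  exact: I.
move=> j c hc; have [f1 f2] := Hf j c hc; have [g1 g2] := Hg j c hc; split.
  by move=> z Uz; apply: rderivable_add; [exact: f1|exact: g1].
apply: (Ck_ext Uo _ (IH _ _ f2 g2)) => z Uz.
by rewrite rderive_add//; [exact: f1|exact: g1].
Qed.

Lemma Ck_mul U k f g : open U -> Ck U k f -> Ck U k g ->
  Ck U k (fun w => f w * g w).
Proof.
move=> Uo; elim: k f g => [|k IH] f g Hf Hg; (split; first by
  move=> z Uz;
     exact: (continuousM (Ck_continuous Hf Uz) (Ck_continuous Hg Uz))).
  exact: I.
move=> j c hc.
have [f1 f2] := Hf.2 j c hc; have [g1 g2] := Hg.2 j c hc; split.
  by move=> z Uz; apply: rderivable_mul; [exact: f1|exact: g1].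
have Hfg : Ck U k (fun z => f z * rderive (c *: basis_vec R j) g z +
                            rderive (c *: basis_vec R j) f z * g z).
  by apply: Ck_add => //; apply: IH => //; exact: Ck_pred.
apply: (Ck_ext Uo _ Hfg) => z Uz.
by rewrite rderive_mul//; [exact: f1|exact: g1].
Qed.

Lemma holomorphic_sub U V f : V `<=` U -> holomorphic_on U f ->
  holomorphic_on V f.
Proof.
by move=> VU [fs fh]; split=> [k|z /VU]; [exact: Ck_sub (fs k)|exact: fh].
Qed.

Lemma holomorphic_cst U (c : C) : holomorphic_on U (fun=> c).
Proof.
split=> [k|z Uz j]; first exact: Ck_cst.
by rewrite /dzbar !rderive_cst mulr0 addr0 mulr0.
Qed.

Lemma holomorphic_mul U f g : open U -> holomorphic_on U f ->
  holomorphic_on U g -> holomorphic_on U (fun z => f z * g z).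
Proof.
move=> Uo [fs fh] [gs gh]; split=> [k|z Uz j]; first exact: Ck_mul.
have [_ /(_ j) Hf] := fs 1%N; have [_ /(_ j) Hg] := gs 1%N.
have l1 : (1 : C) = 1 \/ (1 : C) = 'i by left.
have li : ('i : C) = 1 \/ ('i : C) = 'i by right.
have [/(_ z Uz) f1 _] := Hf _ l1; have [/(_ z Uz) g1 _] := Hg _ l1.
have [/(_ z Uz) fi _] := Hf _ li; have [/(_ z Uz) gi _] := Hg _ li.
rewrite scale1r in f1 g1.
have := gh z Uz j; have := fh z Uz j; rewrite /dzbar !rderive_mul//.
set a := rderive _ _ _; set b := rderive _ _ _.
set c := rderive _ _ _; set d := rderive _ _ _ => e1 e2.
transitivity (f z * (2^-1 * (c + 'i * d)) + (2^-1 * (a + 'i * b)) * g z).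
  by ring.
by rewrite e1 e2 mulr0 mul0r addr0.
Qed.

End CalculusLemmas.

Record chart (R : realType) (n : nat) (T : topologicalType) := Chart {
  source : set T;
  target : set 'rV[Cplx R]_n;
  coord : T -> 'rV[Cplx R]_n;
  param : 'rV[Cplx R]_n -> T;
  source_open : open source;
  target_open : open target;
  coord_target : forall x, source x -> target (coord x);
  param_source : forall z, target z -> source (param z);
  coordK : forall x, source x -> param (coord x) = x;
  paramK : forall z, target z -> coord (param z) = z;
  coord_continuous : forall x, source x -> {for x, continuous coord};
  param_continuous : forall z, target z -> {for z, continuous param} }.

Record complex_manifold (R : realType) (n : nat) := ComplexManifold {
  carrier :> topologicalType;
  carrier_hausdorff : hausdorff_space carrier;
  carrier_countable : @second_countable carrier;
  chart_ix : Type;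
  chart_at : chart_ix -> chart R n carrier;
  chart_cover : forall x : carrier, exists a, source (chart_at a) x;
  chart_compat : forall (a b : chart_ix) (l : 'I_n),
    holomorphic_on
      [set z | target (chart_at a) z /\ source (chart_at b) (param (chart_at a) z)]
      (fun z => coord (chart_at b) (param (chart_at a) z) 0 l) }.

Section Manifold.
Variables (R : realType) (n : nat) (M : complex_manifold R n).
Local Notation C := (Cplx R).

Definition in_chart (a : chart_ix M) (W : set M) : set 'rV[C]_n :=
  [set z | target (chart_at a) z /\ W (param (chart_at a) z)].

Definition smooth_fun (W : set M) (f : M -> C) : Prop :=
  forall a, smooth_on (in_chart a W) (f \o param (chart_at a)).

Definition holomorphic_fun (W : set M) (f : M -> C) : Prop :=
  forall a, holomorphic_on (in_chart a W) (f \o param (chart_at a)).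

(* Row j is the image of the j-th coordinate field of chart a, written in
   chart b: a tangent vector with coordinates v in a has coordinates
   v *m jacobian_mx a b x in b. *)
Definition jacobian_mx (a b : chart_ix M) (x : M) : 'M[C]_n :=
  \matrix_(j, l) dz j (fun z => coord (chart_at b) (param (chart_at a) z) 0 l)
                    (coord (chart_at a) x).

Lemma in_chart_open a W : open W -> open (in_chart a W).
Proof.
move=> Wo; rewrite openE => z [tz Wz]; rewrite /interior.
apply: filterI; first by apply: open_nbhs_nbhs; split => //; exact: target_open.
by apply: (param_continuous tz); exact: open_nbhs_nbhs.
Qed.

Lemma holomorphic_fun_sub (V W : set M) f : V `<=` W ->
  holomorphic_fun W f -> holomorphic_fun V f.
Proof.
by move=> VW fh a; apply: holomorphic_sub (fh a) => z [tz /VW].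
Qed.

Lemma holomorphic_fun_cst W (c : C) : holomorphic_fun W (fun=> c).
Proof. by move=> a; exact: holomorphic_cst. Qed.

Lemma holomorphic_fun_mul W f g : open W -> holomorphic_fun W f ->
  holomorphic_fun W g -> holomorphic_fun W (fun x => f x * g x).
Proof.
move=> Wo fh gh a.
by apply: holomorphic_mul (fh a) (gh a); exact: in_chart_open.
Qed.

End Manifold.

(* A holomorphic vector bundle, given by its transition matrices: on trivial i
   there is a holomorphic frame e_i, and e_i = transition i j *m e_j (frames
   being columns of sections) on the overlaps. *)
Record hol_bundle (R : realType) (n : nat) (M : complex_manifold R n) :=
  HolBundle {
  rank : nat;
  triv_ix : Type;
  trivial : triv_ix -> set M;
  transition : triv_ix -> triv_ix -> M -> 'M[Cplx R]_rank;
  trivial_open : forall i, open (trivial i);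
  trivial_cover : forall x, exists i, trivial i x;
  transition_id : forall i x, trivial i x -> transition i i x = 1%:M;
  transition_comp : forall i j l x, trivial i x -> trivial j x -> trivial l x ->
    transition i j x *m transition j l x = transition i l x;
  transition_hol : forall i j a b,
    holomorphic_fun (trivial i `&` trivial j) (fun x => transition i j x a b) }.

Section Bundles.
Variables (R : realType) (n : nat) (M : complex_manifold R n).
Local Notation C := (Cplx R).

(* s i x is the row of components of the section in the frame e_i. *)
Definition hol_section (E : hol_bundle M)
    (s : triv_ix E -> M -> 'rV[C]_(rank E)) : Prop :=
  (forall i j x, trivial i x -> trivial j x ->
     s j x = s i x *m transition i j x) /\
  (forall i a, holomorphic_fun (trivial i) (fun x => s i x 0 a)).

(* H^0(M, E) = 0. The components of a section in the frame e_i are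
   meaningless outside of trivial i. *)
Definition H0_eq0 (E : hol_bundle M) : Prop :=
  forall s : triv_ix E -> M -> 'rV[C]_(rank E), hol_section s ->
  forall i x, trivial i x -> s i x = 0.

Section Dual.
Variable E : hol_bundle M.

Let dtr (i j : triv_ix E) (x : M) : 'M[C]_(rank E) := (transition j i x)^T.

Let dtr_id i x : trivial i x -> dtr i i x = 1%:M.
Proof. by move=> ix; rewrite /dtr transition_id// trmx1. Qed.

Let dtr_comp i j l x : trivial i x -> trivial j x -> trivial l x ->
  dtr i j x *m dtr j l x = dtr i l x.
Proof. by move=> ix jx lx; rewrite /dtr -trmx_mul transition_comp. Qed.

Let dtr_hol i j a b :
  holomorphic_fun (trivial i `&` trivial j) (fun x => dtr i j x a b).
Proof.
rewrite (_ : (fun x => dtr i j x a b) = fun x => transition j i x b a).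
  by rewrite setIC; exact: transition_hol.
by apply/funext => x; rewrite /dtr mxE.
Qed.

(* The frame of the dual bundle over trivial i is the dual frame of e_i. *)
Definition dual_bundle : hol_bundle M :=
  HolBundle (@trivial_open _ _ _ E) (@trivial_cover _ _ _ E)
            dtr_id dtr_comp dtr_hol.
End Dual.

Section Tensor.
Variables E F : hol_bundle M.

Let tdom (i : triv_ix E * triv_ix F) : set M := trivial i.1 `&` trivial i.2.
Let ttr (i j : triv_ix E * triv_ix F) (x : M) : 'M[C]_(rank E * rank F) :=
  tensmx (transition i.1 j.1 x) (transition i.2 j.2 x).

Let tdom_open i : open (tdom i).
Proof. by apply: openI; exact: trivial_open. Qed.

Let tdom_cover x : exists i, tdom i x.
Proof.
have [i ix] := trivial_cover E x; have [j jx] := trivial_cover F x.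
by exists (i, j).
Qed.

Let ttr_id i x : tdom i x -> ttr i i x = 1%:M.
Proof.
case=> h1 h2; rewrite /ttr !transition_id//.
by apply/matrixP => a b; case: (mxtens_indexP a) => a1 a2;
   case: (mxtens_indexP b) => b1 b2; rewrite tensmxE !mxE -natrM mulnb
   (can_eq (@mxtens_indexK _ _)).
Qed.

Let ttr_comp i j l x : tdom i x -> tdom j x -> tdom l x ->
  ttr i j x *m ttr j l x = ttr i l x.
Proof.
by move=> [i1 i2] [j1 j2] [l1 l2]; rewrite /ttr tensmx_mul !transition_comp.
Qed.

Let ttr_hol i j a b :
  holomorphic_fun (tdom i `&` tdom j) (fun x => ttr i j x a b).
Proof.
case: (mxtens_indexP a) => a1 a2; case: (mxtens_indexP b) => b1 b2.
rewrite (_ : (fun x => _) = fun x => transition i.1 j.1 x a1 b1 *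
                                     transition i.2 j.2 x a2 b2).
  apply: holomorphic_fun_mul; first by apply: openI; exact: tdom_open.
    by apply: holomorphic_fun_sub (@transition_hol _ _ _ E i.1 j.1 a1 b1)
      => x [[? _] [? _]].
  by apply: holomorphic_fun_sub (@transition_hol _ _ _ F i.2 j.2 a2 b2)
    => x [[_ ?] [_ ?]].
by apply/funext => x; rewrite /ttr tensmxE.
Qed.

Definition tensor_bundle : hol_bundle M :=
  HolBundle tdom_open tdom_cover ttr_id ttr_comp ttr_hol.
End Tensor.

Section Trivial.
Let udom (_ : unit) : set M := setT.
Let utr (_ _ : unit) (_ : M) : 'M[C]_1 := 1%:M.

Let udom_open i : open (udom i). Proof. exact: openT. Qed.
Let udom_cover x : exists i, udom i x. Proof. by exists tt. Qed.
Let utr_id i x : udom i x -> utr i i x = 1%:M. Proof. by []. Qed.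
Let utr_comp i j l x : udom i x -> udom j x -> udom l x ->
  utr i j x *m utr j l x = utr i l x.
Proof. by rewrite /utr mul1mx. Qed.
Let utr_hol i j a b :
  holomorphic_fun (udom i `&` udom j) (fun x => utr i j x a b).
Proof. exact: holomorphic_fun_cst. Qed.

Definition trivial_line_bundle : hol_bundle M :=
  HolBundle udom_open udom_cover utr_id utr_comp utr_hol.
End Trivial.

Fixpoint tensor_power (E : hol_bundle M) (p : nat) : hol_bundle M :=
  if p is p'.+1 then tensor_bundle E (tensor_power E p')
  else trivial_line_bundle.

End Bundles.

Section Hermitian.
Variable R : realType.
Local Notation C := (Cplx R).

(* Pairing of two rows of components in a frame with Gram matrix A; linear in
   u and antilinear in v. *)
Definition herm_pair (r : nat) (A : 'M[C]_r) (u v : 'rV[C]_r) : C :=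
  (u *m A *m conj_tr v) 0 0.

Variables (n : nat) (M : complex_manifold R n).

(* Hermitian metrics on the bundle with transition matrices g, a metric being
   the family h of its Gram matrices in the local frames. *)
Record hermitian_metric (I : Type) (D : I -> set M) (r : nat)
    (g : I -> I -> M -> 'M[C]_r) (h : I -> M -> 'M[C]_r) : Prop :=
  HermitianMetric {
  metric_smooth : forall i a b, smooth_fun (D i) (fun x => h i x a b);
  metric_herm : forall i x, D i x -> conj_tr (h i x) = h i x;
  metric_pos : forall i x u, D i x -> u != 0 -> 0 < herm_pair (h i x) u u;
  metric_compat : forall i j x, D i x -> D j x ->
    h i x = g i j x *m h j x *m conj_tr (g i j x) }.

(* w a is the Gram matrix of the coordinate fields d/dz_1, ..., d/dz_n of the
   chart a. *)
Definition manifold_metric (w : chart_ix M -> M -> 'M[C]_n) : Prop :=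
  hermitian_metric (fun a => source (chart_at a)) (@jacobian_mx R n M) w.

Definition bundle_metric (E : hol_bundle M)
    (h : triv_ix E -> M -> 'M[C]_(rank E)) : Prop :=
  hermitian_metric (@trivial R n M E) (@transition R n M E) h.

End Hermitian.

Section Curvature.
Variables (R : realType) (n : nat).
Local Notation C := (Cplx R).

Section Local.
(* Gram matrix of the metric in a holomorphic frame, in coordinates z; the
   sections s are given by their components in that frame. *)
Variables (r : nat) (H : 'rV[C]_n -> 'M[C]_r).
Implicit Types s : 'rV[C]_n -> 'rV[C]_r.

(* Chern connection: its (0,1) part is dbar, so compatibility with the metric
   applied to the frame reads dH = theta H, i.e. theta = (dH) H^-1. *)
Definition chern10 (j : 'I_n) s : 'rV[C]_n -> 'rV[C]_r := fun z =>
  dz_mx j s z + s z *m (dz_mx j H z *m invmx (H z)).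
Definition chern01 (j : 'I_n) s : 'rV[C]_n -> 'rV[C]_r := dzbar_mx j s.

(* The curvature nabla^2 evaluated on (d/dz_j, d/d(conj z_l)); these two vector
   fields commute. *)
Definition curvature_op (j l : 'I_n) s : 'rV[C]_n -> 'rV[C]_r := fun z =>
  chern10 j (chern01 l s) z - chern01 l (chern10 j s) z.

(* R_{X conj Y}(u); as the curvature is a tensor, u may be extended by a
   section with constant components. *)
Definition chern_curvature (z X Y : 'rV[C]_n) (u : 'rV[C]_r) : 'rV[C]_r :=
  \sum_j \sum_l (X 0 j * (Y 0 l)^*) *: curvature_op j l (fun=> u) z.
End Local.

Variables (M : complex_manifold R n) (E : hol_bundle M).
Variable h : triv_ix E -> M -> 'M[C]_(rank E).

(* R^(E,h)(X, conj Y, u, conj v), with X, Y : T_x M read in the chart a and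
   u, v : E_x in the frame e_i. *)
Definition curvature_form (a : chart_ix M) (i : triv_ix E) (x : M)
    (X Y : 'rV[C]_n) (u v : 'rV[C]_(rank E)) : C :=
  herm_pair (h i x)
    (chern_curvature (h i \o param (chart_at a)) (coord (chart_at a) x) X Y u) v.

Definition unitary_basis (A : 'M[C]_n) (k : nat) (S : {vspace 'rV[C]_n})
    (e : k.-tuple 'rV[C]_n) : Prop :=
  basis_of S e /\
  forall i j : 'I_k, herm_pair A (tnth e i) (tnth e j) = (i == j)%:R.

(* T_x M and E_x are read in a chart and a frame around x; by tensoriality the
   condition does not depend on which ones, nor on the unitary basis. *)
Definition uniformly_RC_positive (w : chart_ix M -> M -> 'M[C]_n) (k : nat) :
  Prop :=
  forall x : M, exists (a : chart_ix M) (i : triv_ix E),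
  [/\ source (chart_at a) x, trivial i x &
  exists (S : {vspace 'rV[C]_n}) (e : k.-tuple 'rV[C]_n),
  [/\ \dim S = k, unitary_basis (w a x) S e &
  forall u : 'rV[C]_(rank E), u != 0 ->
    0 < \sum_(t < k) curvature_form a i x (tnth e t) (tnth e t) u u]].

End Curvature.

(* Main.v *)
Require Import Defs.
From HB Require Import structures.
From mathcomp Require Import all_boot all_order all_algebra.
From mathcomp Require Import complex mxtens ring lra.
From mathcomp Require Import all_classical all_reals all_analysis.

Set Implicit Arguments.
Unset Strict Implicit.
Unset Printing Implicit Defensive.

Import Order.TTheory GRing.Theory Num.Theory.
Import numFieldNormedType.Exports.

Local Open Scope classical_set_scope.
Local Open Scope ring_scope.

(** Fix a section s of E^p (x) E*^q (x) F^m and measure it by the spectral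
    norm in the dual slots: contract s with vectors u_1, ..., u_q of E and
    maximize |s(u_1, ..., u_q)|^2 / prod |u_k|_h^2.  The slots of E^p and F^m
    need no curvature information, hence no metric: they are read in finitely
    many local frames with positive weights 1 + |z - c|^2 / rho^2 (to a large
    power), chosen so that at a boundary point of one frame domain another
    frame, for which the point is interior, does at least as well.  A maximum
    is thus attained at an interior point x.  Near x, extend each u_k to a
    holomorphic section whose covariant derivative vanishes at x; then
    d dbar log |u_k|^2 = - R(., ., u_k, u_k) / |u_k|^2 at x, log |s(u)|^2 is
    pluriharmonic, and the second derivative test in the directions e_1, ...,
    e_k provided by RC-positivity gives q lam <= p c1 + m c2, where lam > 0
    bounds sum_t R(e_t, e_t, u, u) / |u|^2 from below and c1, c2 bound the
    d dbar log of the weights from above. *)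

(** * Real calculus in one and two variables *)

(** No metric is given on F, and one on E^p (x) E*^q (x) F^m would bring in the curvature of a
    tensor product. Contracting with decomposable tensors leaves scalar holomorphic functions, and h
    is differentiated one slot at a time. The spectral norm itself is not smooth in x, but it never
    has to be differentiated: with the maximizing u_k fixed and extended, the smooth product of the
    |u_k|^2 and the weights dominates |s(u)|^2, with equality at x. The bounds are linear in p and m
    because everything is multiplicative: a change of frame on E^p costs at most the p-th power of
    its cost on E, which the p-th power of the weight of E absorbs. The plane of directions is not
    followed smoothly: e_1, ..., e_k stay constant in a chart, and positivity persists nearby since
    the unit vectors of E form a compact set. Finally lam and c1 come from the cover built for E,
    before F is given; only c2 involves both covers. *)

Section RealCalculus.
Variable R : realType.
Implicit Types (f g df : R -> R) (a b c e s t : R).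

(** Either sign of t, and t = 0, lead to one conclusion, so the two-variable estimates below need no
    case distinction. *)
Lemma MVT_sym f df e t : `|t| < e ->
  (forall s, `|s| < e -> is_derive s 1 f (df s)) ->
  exists2 c, `|c| <= `|t| & f t - f 0 = df c * t.
Proof.
move=> te hd.
have hcont a b : `|a| < e -> `|b| < e -> {within `[a, b], continuous f}.
  move=> ae be; apply: derivable_within_continuous => x.
  rewrite in_itv/= => /andP[ax xb].
  apply: (@ex_derive _ _ _ _ _ _ _ (hd x _)).
  by move: ae be; rewrite !ltr_norml => /andP[? ?] /andP[? ?]; apply/andP; split; lra.
have e0 : `|0 : R| < e by rewrite normr0 (le_lt_trans _ te).
have [t0|t0|->] := ltgtP t 0; last by exists 0; rewrite ?normr0 ?subrr ?mulr0.
- have [|c cI E] := @MVT R f df t 0 t0 _ (hcont _ _ te e0).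
    move=> x; rewrite in_itv/= => /andP[tx x0]; apply: hd.
    by move: te; rewrite !ltr0_norm//; lra.
  move: cI; rewrite in_itv/= => /andP[tc c0].
  by exists c; [rewrite !ltr0_norm//; lra|rewrite -[LHS]opprB E; ring].
- have [|c cI E] := @MVT R f df 0 t t0 _ (hcont _ _ e0 te).
    move=> x; rewrite in_itv/= => /andP[tx x0]; apply: hd.
    by move: te; rewrite !gtr0_norm//; lra.
  move: cI; rewrite in_itv/= => /andP[tc c0].
  by exists c; [rewrite !gtr0_norm//; lra|rewrite E; ring].
Qed.

(** The division-free remainder estimate includes t = 0 and combines by the triangle inequality. *)
Lemma is_deriveP f a d : is_derive a 1 f d <->
  forall e : R, 0 < e -> exists2 del : R, 0 < del &
    forall t, `|t| < del -> `|f (a + t) - f a - d * t| <= e * `|t|.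
Proof.
split=> [[fd fE] e e0|H].
  have /cvgrPdist_lt/(_ e e0) : h^-1 *: (f (h + a) - f a) @[h --> 0^'] --> d.
    move: fd fE; rewrite /derivable /derive => fd fE.
    rewrite -fE; have : (fun h : R => h^-1 *: ((f \o shift a) (h *: 1) - f a)) =
       (fun h => h^-1 *: (f (h + a) - f a)).
      by apply/funext => h /=; rewrite /GRing.scale/= mulr1.
    by move=> <-.
  rewrite near_withinE => /nbhs_ballP[del/= del0 Hd].
  exists del => // t tdel.
  have [->|t0] := eqVneq t 0; first by rewrite addr0 mulr0 !subr0 subrr !normr0 mulr0.
  have /(_ _ t0) := Hd t _; rewrite /ball/= sub0r normrN => /(_ tdel) /ltW h.
  have -> : f (a + t) - f a - d * t = - (d - t^-1 *: (f (t + a) - f a)) * t.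
    by rewrite /GRing.scale/= (addrC t a); field.
  by rewrite normrM normrN ler_wpM2r.
have cv : (fun h : R => h^-1 *: ((f \o shift a) (h *: 1) - f a)) @ 0^' --> d.
  apply/cvgrPdist_le => e e0.
  have [del del0 Hd] := H e e0.
  rewrite near_withinE; apply/nbhs_ballP; exists del => //= t.
  rewrite /ball/= sub0r normrN => tdel t0.
  rewrite /GRing.scale/= mulr1.
  have -> : d - t^-1 * (f (t + a) - f a) = - (f (a + t) - f a - d * t) * t^-1.
    by rewrite (addrC t a); field.
  by rewrite normrM normrN normfV ler_pdivrMr ?normr_gt0// Hd.
split; first by apply/cvg_ex; exists d.
exact/cvg_lim.
Qed.

(** Cut F t t - F 0 0 at the corner (t, 0): the first piece is a derivative along the axis, the
    second is t times F2 at an intermediate point, by the mean value theorem. It serves to add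
    directions of differentiation. *)
Lemma is_derive_diag (F F2 : R -> R -> R) (e d : R) :
  0 < e ->
  (forall s t, `|s| < e -> `|t| < e -> is_derive t 1 (F s) (F2 s t)) ->
  (forall eps : R, 0 < eps -> exists2 del : R, 0 < del &
    forall s t, `|s| < del -> `|t| < del -> `|F2 s t - F2 0 0| <= eps) ->
  is_derive (0 : R) 1 (F ^~ 0) d ->
  is_derive (0 : R) 1 (fun t => F t t) (d + F2 0 0).
Proof.
move=> e0 hd hc /is_deriveP h1; apply/is_deriveP => eps eps0.
have e20 : 0 < eps / 2 by rewrite divr_gt0.
have e0n : `|0 : R| < e by rewrite normr0.
have [d1 d10 H1] := h1 _ e20; have [d2 d20 H2] := hc _ e20.
exists (Num.min e (Num.min d1 d2)); first by rewrite !lt_min e0 d10 d20.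
move=> t; rewrite !lt_min => /and3P[te td1 td2].
rewrite add0r.
have [c ct Ec] := MVT_sym te (fun s => @hd t s te).
have -> : F t t - F 0 0 - (d + F2 0 0) * t =
  (F (0 + t) 0 - F 0 0 - d * t) + (F t t - F t 0 - F2 0 0 * t).
  by rewrite add0r; ring.
rewrite Ec -mulrBl (le_trans (ler_normD _ _))//.
rewrite [leRHS](_ : _ = eps / 2 * `|t| + eps / 2 * `|t|); last by field.
rewrite lerD ?H1//.
by rewrite normrM ler_wpM2r// H2// (le_lt_trans ct).
Qed.

(** The double difference of F over a square of side t is t^2 times a value of F12 and also t^2
    times a value of F21, by two mean value steps in either order; continuity at the origin
    concludes. *)
Lemma schwarz2 (F F1 F2 F12 F21 : R -> R -> R) (e : R) :
  0 < e ->
  (forall s t, `|s| < e -> `|t| < e -> is_derive s 1 (F ^~ t) (F1 s t)) ->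
  (forall s t, `|s| < e -> `|t| < e -> is_derive t 1 (F1 s) (F12 s t)) ->
  (forall s t, `|s| < e -> `|t| < e -> is_derive t 1 (F s) (F2 s t)) ->
  (forall s t, `|s| < e -> `|t| < e -> is_derive s 1 (F2 ^~ t) (F21 s t)) ->
  (forall eps : R, 0 < eps -> exists2 del : R, 0 < del &
    forall s t, `|s| < del -> `|t| < del -> `|F12 s t - F12 0 0| <= eps) ->
  (forall eps : R, 0 < eps -> exists2 del : R, 0 < del &
    forall s t, `|s| < del -> `|t| < del -> `|F21 s t - F21 0 0| <= eps) ->
  F12 0 0 = F21 0 0.
Proof.
move=> e0 h1 h12 h2 h21 c12 c21.
apply/eqP; rewrite -subr_eq0 -normr_le0; apply/ler_addgt0Pl => eps eps0.
rewrite addr0.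
have e20 : 0 < eps / 2 by rewrite divr_gt0.
have e0n : `|0 : R| < e by rewrite normr0.
have [d1 d10 H1] := c12 _ e20; have [d2 d20 H2] := c21 _ e20.
pose m := Num.min e (Num.min d1 d2).
have m0 : 0 < m by rewrite !lt_min e0 d10 d20.
pose t := m / 2.
have t0 : 0 < t by rewrite divr_gt0.
have : t < m by rewrite /t; lra.
rewrite /m !lt_min -[X in [&& X < _, _ & _]]gtr0_norm// => /and3P[te td1 td2].
have tt : `|t| = t by rewrite gtr0_norm.
have [c ct Ec] := @MVT_sym (fun s => F s t - F s 0) (fun s => F1 s t - F1 s 0) e t te
  (fun s se => is_deriveB (h1 s t se te) (h1 s 0 se e0n)).
have ce := le_lt_trans ct te.
have [c' ct' Ec'] := MVT_sym te (fun s => @h12 c s ce).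
have [k kt Ek] := @MVT_sym (fun s => F t s - F 0 s) (fun s => F2 t s - F2 0 s) e t te
  (fun s se => is_deriveB (h2 t s te se) (h2 0 s e0n se)).
have ke := le_lt_trans kt te.
have [k' kt' Ek'] := MVT_sym te (fun s se => @h21 s k se ke).
have E : F12 c c' = F21 k' k.
  have tn0 : t * t != 0 by rewrite mulf_neq0// gt_eqF.
  apply: (mulIf tn0).
  transitivity (F t t - F t 0 - (F 0 t - F 0 0)); first by rewrite Ec Ec' mulrA.
  transitivity (F t t - F 0 t - (F t 0 - F 0 0)); first by ring.
  by rewrite Ek Ek' -mulrA.
have -> : F12 0 0 - F21 0 0 = - (F12 c c' - F12 0 0) + (F21 k' k - F21 0 0).
  by rewrite E; ring.
rewrite (le_trans (ler_normD _ _))// [leRHS]splitr lerD// ?normrN.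
  by rewrite H1// (le_lt_trans (y := `|t|))// tt.
by rewrite H2// (le_lt_trans (y := `|t|))// tt.
Qed.

(** Fermat's argument at t and - t gives the first-order condition. A negative d would make g1
    negative just to the right of 0, and the mean value theorem would put g below its minimum. *)
Lemma second_derivative_test (g g1 : R -> R) e d :
  0 < e -> (forall t, `|t| < e -> is_derive t 1 g (g1 t)) ->
  is_derive (0 : R) 1 g1 d -> (forall t, `|t| < e -> g 0 <= g t) ->
  g1 0 = 0 /\ 0 <= d.
Proof.
move=> e0 hg /is_deriveP hd hmin.
have g10 : g1 0 = 0.
  have z0 : `|0 : R| < e by rewrite normr0.
  have /is_deriveP hg0 := hg 0 z0.
  apply/eqP; rewrite -normr_le0; apply/ler_addgt0Pl => eps eps0; rewrite addr0.
  have [del del0 H] := hg0 _ eps0.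
  pose t := Num.min e del / 2.
  have m0 : 0 < Num.min e del by rewrite lt_min e0.
  have t0 : 0 < t by rewrite divr_gt0.
  have : t < Num.min e del by rewrite /t; lra.
  rewrite lt_min => /andP[te tdel].
  have tn : `|t| = t by rewrite gtr0_norm.
  have Nn : `|- t| = t by rewrite normrN.
  have := hmin t; rewrite tn => /(_ te) A1.
  have := hmin (- t); rewrite Nn => /(_ te) A2.
  have := H t; rewrite tn => /(_ tdel); rewrite add0r ler_norml => /andP[B1 B2].
  have := H (- t); rewrite Nn => /(_ tdel); rewrite add0r ler_norml => /andP[B3 B4].
  by rewrite ler_norml; apply/andP; split; rewrite -(ler_pM2r t0); lra.
split=> //; rewrite leNgt; apply/negP => dlt0.
(* With this error, g1 c <= (d / 2) * c < 0 for small c > 0. *)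
have hd2 : 0 < - d / 2 by lra.
have [del del0 H] := hd _ hd2.
pose t := Num.min e del / 2.
have m0 : 0 < Num.min e del by rewrite lt_min e0.
have t0 : 0 < t by rewrite divr_gt0.
have : t < Num.min e del by rewrite /t; lra.
rewrite lt_min => /andP[te tdel].
have tn : `|t| = t by rewrite gtr0_norm.
have [||c cI Ec] := @MVT R g g1 0 t t0.
- move=> x; rewrite in_itv/= => /andP[x0 xt]; apply: hg.
  by rewrite gtr0_norm// (lt_trans xt).
- apply: derivable_within_continuous => x.
  rewrite in_itv/= => /andP[ax xb].
  by apply: (@ex_derive _ _ _ _ _ _ _ (hg x _)); rewrite ger0_norm//; lra.
move: cI; rewrite in_itv/= => /andP[c0 ct].
have cn : `|c| = c by rewrite gtr0_norm.
have := H c; rewrite cn add0r g10 subr0 => /(_ (lt_trans ct tdel)).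
rewrite ler_norml => /andP[_ B].
have := hmin t; rewrite tn => /(_ te) A.
have g1c : g1 c < 0.
  have : d * c < 0 by rewrite pmulr_llt0.
  lra.
have : g1 c * t < 0 by rewrite pmulr_llt0.
lra.
Qed.

Lemma is_derive_ext (g h : R -> R) (a d : R) :
  g =1 h -> is_derive a 1 g d -> is_derive a 1 h d.
Proof. by move=> /funext ->. Qed.

Lemma is_derive_cstM (g : R -> R) (a c d : R) :
  is_derive a 1 g d -> is_derive a 1 (fun t => c * g t) (c * d).
Proof. by move=> gd; exact: is_deriveZ. Qed.

Lemma derivable_inv_sumsq (p q : R -> R) (a : R) : p a ^+ 2 + q a ^+ 2 != 0 ->
  derivable p a 1 -> derivable q a 1 ->
  derivable (fun t => (p t ^+ 2 + q t ^+ 2)^-1) a 1.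
Proof.
move=> n0 dp dq; apply: derivableV => //.
have -> : (fun t => p t ^+ 2 + q t ^+ 2) = p * p + q * q by [].
by apply: derivableD; exact: derivableM.
Qed.

End RealCalculus.

(** * Smooth functions of several complex variables *)

Section ComplexParts.
Variable R : realType.
Local Notation C := (Cplx R).
Implicit Types (x y : C) (b : bool) (t : R).

(** The boolean lets each real-variable argument be written once for both parts. *)
Definition part b x : R := if b then complex.Re x else complex.Im x.

Lemma partD b x y : part b (x + y) = part b x + part b y.
Proof. by case: b; rewrite /part (ReD, ImD). Qed.

Lemma partN b x : part b (- x) = - part b x.
Proof. by case: b x => -[]. Qed.

Lemma partZ b t x : part b (RtoC t * x) = t * part b x.
Proof. by case: b => /=; [rewrite Defs.ReM|rewrite Defs.ImM]; rewrite /= mul0r ?subr0 ?addr0. Qed.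

Lemma part_eq x y : (forall b, part b x = part b y) -> x = y.
Proof. by move=> h; apply: eq_ReIm; [exact: (h true)|exact: (h false)]. Qed.

Lemma cRe_conj x : complex.Re x^* = complex.Re x.
Proof. by case: x. Qed.

Lemma cIm_conj x : complex.Im x^* = - complex.Im x.
Proof. by case: x. Qed.

Lemma part_conj b x : part b x^* = (-1) ^+ (~~ b) * part b x.
Proof. by case: b; rewrite /part (cRe_conj, cIm_conj) ?expr0 ?mul1r ?expr1 ?mulN1r. Qed.

HB.instance Definition _ := GRing.RMorphism.copy (@RtoC R) (real_complex R).

Lemma Cparts x : x = RtoC (complex.Re x) + RtoC (complex.Im x) * 'i.
Proof.
by apply: eq_ReIm; rewrite (ReD, ImD) (Defs.ReM, Defs.ImM)/=; ring.
Qed.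

Lemma ler_RtoC s t : (RtoC s <= RtoC t) = (s <= t).
Proof. exact: lecR. Qed.

Lemma ltr_RtoC s t : (RtoC s < RtoC t) = (s < t).
Proof. exact: ltcR. Qed.

Lemma norm_RtoC t : `|RtoC t| = RtoC `|t|.
Proof. by rewrite normc_def/= expr0n/= addr0 sqrtr_sqr. Qed.

Lemma ge0_RtoC x : 0 <= x -> x = RtoC (complex.Re x).
Proof. by case: x => a b; rewrite lecE/= => /andP[/eqP-> _]. Qed.

Lemma gt0_Re x : 0 < x -> 0 < complex.Re x.
Proof. by case: x => a b; rewrite ltcE/= => /andP[_]. Qed.

Lemma ge0_Re x : 0 <= x -> 0 <= complex.Re x.
Proof. by case: x => a b; rewrite lecE/= => /andP[_]. Qed.

Lemma norm_part b x : RtoC `|part b x| <= `|x|.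
Proof.
case: x => u v; rewrite normc_def ler_RtoC/= -sqrtr_sqr.
by apply: ler_wsqrtr; case: b => /=; rewrite ?lerDl ?lerDr sqr_ge0.
Qed.

Lemma norm_le_parts x : `|x| <= RtoC (`|complex.Re x| + `|complex.Im x|).
Proof.
rewrite {1}[x]Cparts (le_trans (ler_normD _ _))// normrM rmorphD/= lerD//.
  by rewrite norm_RtoC.
by rewrite norm_RtoC normCi mulr1.
Qed.

Lemma part_continuous b : continuous (part b).
Proof.
move=> x; apply/(@cvgrPdist_lt _ _ _ (nbhs x)) => e e0.
have e0' : 0 < RtoC e by rewrite ltr_RtoC.
near=> y.
rewrite -ltr_RtoC -partN -partD; apply: le_lt_trans (norm_part _ _) _.
near: y; exact: nbhsx_ballx e0'.
Unshelve. all: by end_near. Qed.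

Lemma continuous_parts (T : topologicalType) (f : T -> C) (x : T) :
  (forall b, {for x, continuous (part b \o f)}) -> {for x, continuous f}.
Proof.
move=> h; rewrite /prop_for/continuous_at; apply/(@cvgrPdist_lt _ _ _ (nbhs x)) => e e0.
have h' b : \forall y \near x, `|part b (f x) - part b (f y)| < complex.Re e / 2.
  have e20 : 0 < complex.Re e / 2 by rewrite divr_gt0// gt0_Re.
  by have /(@cvgrPdist_lt _ _ _ (nbhs x))/(_ _ e20) := h b.
have eR : e = RtoC (complex.Re e) by apply/ge0_RtoC/ltW.
near=> y.
apply: (le_lt_trans (norm_le_parts _)); rewrite eR ltr_RtoC.
rewrite [ltRHS]splitr.
have -> : complex.Re (f x - f y) = part true (f x) - part true (f y).
  by rewrite ReD -/(part true (- f y)) partN.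
have -> : complex.Im (f x - f y) = part false (f x) - part false (f y).
  by rewrite ImD -/(part false (- f y)) partN.
apply: ltrD.
  by near: y; exact: (h' true).
by near: y; exact: (h' false).
Unshelve. all: by end_near. Qed.

Lemma conjC_continuous : continuous (@Num.conj C).
Proof.
move=> x; apply: continuous_parts => b; rewrite /prop_for/continuous_at.
have -> : part b \o Num.conj = fun y => (-1) ^+ (~~ b) * part b y.
  by apply/funext => y /=; rewrite part_conj.
by apply: (@continuousM _ _ (fun=> _) (part b) x);
  [exact: cst_continuous|exact: part_continuous].
Qed.

Lemma RtoC_continuous : continuous (@RtoC R).
Proof.
move=> t; apply: continuous_parts => -[]; first exact: cvg_id.
exact: cvg_cst.
Qed.

End ComplexParts.

(** * Derivatives along real directions *)

Section RealDirectional.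
Variables (R : realType) (n : nat).
Local Notation C := (Cplx R).
Implicit Types (f g : 'rV[C]_n -> C) (z v w : 'rV[C]_n) (U V : set 'rV[C]_n).

Definition part_line b f z v (t : R) : R := part b (f (z + RtoC t *: v)).

(** Existence and value of the derivative in a single relation, which passes through sums and
    rescalings without side conditions. *)
Definition is_rderive z v f (d : C) : Prop :=
  forall b, is_derive (0 : R) 1 (part_line b f z v) (part b d).

Lemma is_rderiveP z v f d :
  is_rderive z v f d <-> rderivable f z v /\ rderive v f z = d.
Proof.
split=> [h|[[h1 h2] <-] [|]]; last 2 first.
- by have := derivableP h1.
- by have := derivableP h2.
have [h1 e1] := h true; have [h2 e2] := h false.
rewrite /part_line/part/= in h1 h2 e1 e2.
split; first by split; [exact: h1|exact: h2].
by rewrite /rderive e1 e2; case: (d).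
Qed.

Lemma rderivableE z v f : rderivable f z v -> is_rderive z v f (rderive v f z).
Proof. by move=> h; apply/is_rderiveP. Qed.

Lemma part_line_shift b f z v s t :
  part_line b f z v (s + t) = part_line b f (z + RtoC s *: v) v t.
Proof. by rewrite /part_line rmorphD/= scalerDl addrA. Qed.

Lemma is_derive_part_line b f z v s d :
  is_rderive (z + RtoC s *: v) v f d -> is_derive s 1 (part_line b f z v) (part b d).
Proof.
move=> /(_ b)/is_deriveP h; apply/is_deriveP => e e0.
have [del del0 H] := h e e0; exists del; first exact: del0.
move=> t /H.
rewrite add0r part_line_shift.
by rewrite -[in part_line _ _ _ _ s](addr0 s) part_line_shift.
Qed.

Lemma RtoC0 : RtoC 0 = 0 :> C.
Proof. by []. Qed.

Lemma is_rderive_scale z v f d (c : R) :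
  is_rderive z v f d -> is_rderive z (RtoC c *: v) f (RtoC c * d).
Proof.
move=> h b; apply/is_deriveP => e e0.
have /is_deriveP H := h b.
(* The added 1 covers c = 0. *)
have c0 : 0 < `|c| + 1 by rewrite ltr_wpDl.
have e0' : 0 < e / (`|c| + 1) by rewrite divr_gt0.
have [del del0 {}H] := H _ e0'; exists (del / (`|c| + 1)); first by rewrite divr_gt0.
move=> t; rewrite ltr_pdivlMr// => tdel.
have Hct : `|c * t| <= `|t| * (`|c| + 1).
  by rewrite normrM mulrC ler_wpM2l// lerDl.
have E s : part_line b f z (RtoC c *: v) s = part_line b f z v (c * s).
  by rewrite /part_line scalerA -rmorphM mulrC.
have := H (c * t) (le_lt_trans Hct tdel).
rewrite !add0r !E mulr0 partZ (mulrC c (part b d)) -(mulrA (part b d) c) => /le_trans; apply.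
rewrite -mulrA ler_wpM2l ?(ltW e0)// ler_pdivrMl//.
by rewrite (mulrC (`|c| + 1)).
Qed.

Lemma near_plane U z v w : open U -> U z -> exists2 e : R, 0 < e &
  forall s t, `|s| < e -> `|t| < e -> U (z + RtoC s *: v + RtoC t *: w).
Proof.
move=> Uo Uz.
(* The summand 0 gives the second term the shape required by [line_continuous]. *)
have ctn : continuous (fun p : R * R => (z + RtoC p.1 *: v) + (0 + RtoC p.2 *: w)).
  move=> p; apply: cvgD.
    by apply: (@cvg_comp _ _ _ fst (fun t => z + RtoC t *: v) _ (nbhs p.1));
      [exact: cvg_fst|exact: line_continuous].
  by apply: (@cvg_comp _ _ _ snd (fun t => 0 + RtoC t *: w) _ (nbhs p.2));
    [exact: cvg_snd|exact: line_continuous].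
have /(_ U) := ctn (0, 0).
rewrite /= !RtoC0 !scale0r !addr0 => /(_ (open_nbhs_nbhs (conj Uo Uz))).
move=> /nbhs_ballP[e/= e0 He]; exists e => // s t se te.
have := He (s, t); rewrite /= add0r; apply.
by split; rewrite /ball/= sub0r normrN.
Qed.

Lemma near_plane_cont b g z v w : {for z, continuous g} ->
  forall eps : R, 0 < eps -> exists2 del : R, 0 < del & forall s t, `|s| < del ->
   `|t| < del -> `|part b (g (z + RtoC s *: v + RtoC t *: w)) - part b (g z)| <= eps.
Proof.
move=> gc eps eps0.
have pc : {for z, continuous (part b \o g)}.
  by apply: continuous_comp => //; exact: part_continuous.
have : nbhs z [set y | `|part b (g z) - part b (g y)| < eps].
  by move: pc; rewrite /prop_for/continuous_at => /(@cvgrPdist_lt _ _ _ (nbhs z))/(_ _ eps0).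
rewrite nbhsE => -[V [Vo Vz] VH].
have [e e0 He] := near_plane v w Vo Vz; exists e => // s t se te.
by rewrite distrC ltW// VH//; exact: He.
Qed.

(** Directional derivatives at a single point are not additive in the direction; here the derivative
    along w exists around z and is continuous at z, so [is_derive_diag] applies on the plane spanned
    by v and w. *)
Lemma is_rderive_add U z v w f g d : open U -> U z ->
  is_rderive z v f d -> (forall y, U y -> is_rderive y w f (g y)) ->
  {for z, continuous g} -> is_rderive z (v + w) f (d + g z).
Proof.
move=> Uo Uz hv hw gc b.
have [e e0 He] := near_plane v w Uo Uz.
pose F s t : R := part_line b f (z + RtoC s *: v) w t.
pose F2 s t : R := part b (g (z + RtoC s *: v + RtoC t *: w)).
have z00 : z + RtoC 0 *: v + RtoC 0 *: w = z by rewrite !RtoC0 !scale0r !addr0.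
have := @is_derive_diag R F F2 e (part b d) e0.
have F200 : F2 0 0 = part b (g z) by rewrite /F2 z00.
rewrite partD -F200 => H; apply: (is_derive_ext _ (H _ _ _)).
- by move=> t; rewrite /F /part_line scalerDr addrA.
- by move=> s t se te; apply: is_derive_part_line; apply: hw; exact: He.
- by rewrite F200 /F2; exact: near_plane_cont.
- apply: is_derive_ext (hv b).
  by move=> t; rewrite /F /part_line RtoC0 scale0r addr0.
Qed.

Lemma rderiveC U v w f z : open U -> U z ->
  (forall y, U y -> rderivable f y v) -> (forall y, U y -> rderivable f y w) ->
  (forall y, U y -> rderivable (rderive v f) y w) ->
  (forall y, U y -> rderivable (rderive w f) y v) ->
  {for z, continuous (rderive w (rderive v f))} ->
  {for z, continuous (rderive v (rderive w f))} ->
  rderive w (rderive v f) z = rderive v (rderive w f) z.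
Proof.
move=> Uo Uz dv dw dvw dwv c1 c2; apply: part_eq => b.
have [e e0 He] := near_plane v w Uo Uz.
pose L g s t : R := part b (g (z + RtoC s *: v + RtoC t *: w)).
have z00 : z + RtoC 0 *: v + RtoC 0 *: w = z by rewrite !RtoC0 !scale0r !addr0.
have hs g : (forall y, U y -> rderivable g y v) ->
    forall s t : R, `|s| < e -> `|t| < e -> is_derive s 1 (L g ^~ t) (L (rderive v g) s t).
  move=> hg s t se te.
  apply: (@is_derive_ext R (part_line b g (z + RtoC t *: w) v)).
    by move=> s'; rewrite /L /part_line addrAC.
  by rewrite /L addrAC; apply/is_derive_part_line/rderivableE/hg; rewrite addrAC; exact: He.
have ht g : (forall y, U y -> rderivable g y w) ->
    forall s t : R, `|s| < e -> `|t| < e -> is_derive t 1 (L g s) (L (rderive w g) s t).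
  by move=> hg s t se te; apply/is_derive_part_line/rderivableE/hg; exact: He.
have L00 g : L g 0 0 = part b (g z) by rewrite /L z00.
have Lc g : {for z, continuous g} -> forall eps : R, 0 < eps -> exists2 del : R, 0 < del &
    forall s t, `|s| < del -> `|t| < del -> `|L g s t - L g 0 0| <= eps.
  by move=> gc; rewrite L00; exact: near_plane_cont.
have H := schwarz2 e0 (hs f dv) (ht _ dvw) (ht f dw) (hs _ dwv) (Lc _ c1) (Lc _ c2).
exact: etrans (esym (L00 _)) (etrans H (L00 _)).
Qed.

Lemma is_rderive_conj f z v d :
  is_rderive z v f d -> is_rderive z v (fun y => (f y)^*) d^*.
Proof.
move=> h b; rewrite part_conj; apply: is_derive_ext (is_derive_cstM _ (h b)) => t.
by rewrite /part_line part_conj.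
Qed.

Lemma part_inv (x : C) : x^-1 =
  Complex (part true x * (part true x ^+ 2 + part false x ^+ 2)^-1)
          (- (part false x * (part true x ^+ 2 + part false x ^+ 2)^-1)).
Proof. by case: x => a b. Qed.

Lemma part_sumsq (x : C) : x != 0 -> part true x ^+ 2 + part false x ^+ 2 != 0.
Proof.
case: x => a b; rewrite eq_complex/= => ab.
have : 0 < a ^+ 2 + b ^+ 2; last by rewrite lt0r => /andP[].
by move: ab; rewrite negb_and => /orP[a0|b0];
  [rewrite ltr_pwDl|rewrite ltr_wpDl]; rewrite ?sqr_ge0// exprn_even_gt0.
Qed.

Lemma is_rderive_inv f z v d : f z != 0 ->
  is_rderive z v f d -> rderivable (fun y => (f y)^-1) z v.
Proof.
move=> fz0 h.
have [h1 _] := h true; have [h2 _] := h false.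
have n0 : part_line true f z v 0 ^+ 2 + part_line false f z v 0 ^+ 2 != 0.
  by rewrite /part_line RtoC0 scale0r addr0 part_sumsq.
have dV := derivable_inv_sumsq n0 h1 h2.
split.
- have -> : re_line (fun y => (f y)^-1) z v = fun t => part_line true f z v t *
    (part_line true f z v t ^+ 2 + part_line false f z v t ^+ 2)^-1.
    by apply/funext => t; rewrite /re_line part_inv.
  exact: derivableM h1 dV.
- have -> : im_line (fun y => (f y)^-1) z v = fun t => - (part_line false f z v t *
    (part_line true f z v t ^+ 2 + part_line false f z v t ^+ 2)^-1).
    by apply/funext => t; rewrite /im_line part_inv.
  exact: derivableN (derivableM h2 dV).
Qed.

End RealDirectional.

(** * Smooth functions and first-order operators on them *)

Section SmoothFunctions.
Variables (R : realType) (n : nat) (U : set 'rV[Cplx R]_n).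
Hypothesis Uo : open U.
Local Notation C := (Cplx R).
Implicit Types (f g : 'rV[C]_n -> C) (z v w : 'rV[C]_n).

Lemma Ck_dir k f (j : 'I_n) (c : C) : c = 1 \/ c = 'i -> Ck U k.+1 f ->
  (forall z, U z -> rderivable f z (c *: basis_vec R j)) /\
  Ck U k (rderive (c *: basis_vec R j) f).
Proof. by move=> hc [_ /(_ j c hc)]. Qed.

Lemma Ck_conj k f : Ck U k f -> Ck U k (fun z => (f z)^*).
Proof.
elim: k f => [|k IH] f Hf; (split; first by move=> z Uz;
  apply: continuous_comp (Ck_continuous Hf Uz) _; exact: conjC_continuous).
  exact: I.
move=> j c hc; have [f1 f2] := Ck_dir j hc Hf; split.
  by move=> z /f1/rderivableE/is_rderive_conj/is_rderiveP[].
apply: (Ck_ext Uo _ (IH _ f2)) => z Uz.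
by have /rderivableE/is_rderive_conj/is_rderiveP[_ ->] := f1 z Uz.
Qed.

(** Once differentiability is known, the value follows from differentiating f * f^-1 = 1. *)
Lemma rderive_inv f z v : U z -> (forall y, U y -> f y != 0) -> rderivable f z v ->
  rderive v (fun y => (f y)^-1) z = - ((f z)^-1 * (f z)^-1 * rderive v f z).
Proof.
move=> Uz f0 df; have dV := is_rderive_inv (f0 z Uz) (rderivableE df).
have : rderive v (fun y => f y * (f y)^-1) z = 0.
  rewrite (@rderive_ext _ _ _ (fun=> 1) U)// ?rderive_cst// => y Uy.
  by rewrite divff// f0.
rewrite rderive_mul// => /eqP; rewrite addr_eq0 => /eqP e.
by rewrite -[LHS](mulKf (f0 z Uz)) e; ring.
Qed.

(** By induction f^-1 is already C^k, and its derivative is - (f^-1)^2 times a derivative of f,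
    which is C^k. *)
Lemma Ck_inv k f : (forall y, U y -> f y != 0) -> Ck U k f ->
  Ck U k (fun z => (f z)^-1).
Proof.
move=> f0; elim: k => [|k IH] Hf; (split; first by move=> z Uz;
  apply: cvgV (f0 z Uz) (Ck_continuous Hf Uz)).
  exact: I.
move=> j c hc; have [f1 f2] := Ck_dir j hc Hf.
have fV := IH (Ck_pred Hf); split.
  by move=> z Uz; exact: is_rderive_inv (f0 z Uz) (rderivableE (f1 z Uz)).
apply: (@Ck_ext _ _ _ _
  (fun z => (- 1) * ((f z)^-1 * (f z)^-1 * rderive (c *: basis_vec R j) f z))) => //.
  by move=> z Uz; rewrite rderive_inv// ?mulN1r//; exact: f1.
by apply: Ck_mul => //; [exact: Ck_cst|apply: Ck_mul => //; exact: Ck_mul].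
Qed.

Lemma smooth_cst c : smooth_on U (fun=> c).
Proof. by move=> k; exact: Ck_cst. Qed.

Lemma smooth_add f g : smooth_on U f -> smooth_on U g ->
  smooth_on U (fun z => f z + g z).
Proof. by move=> hf hg k; exact: Ck_add. Qed.

Lemma smooth_mul f g : smooth_on U f -> smooth_on U g ->
  smooth_on U (fun z => f z * g z).
Proof. by move=> hf hg k; exact: Ck_mul. Qed.

Lemma smooth_opp f : smooth_on U f -> smooth_on U (fun z => - f z).
Proof.
move=> hf; rewrite (_ : (fun z => - f z) = fun z => -1 * f z).
  exact: smooth_mul (smooth_cst _) hf.
by apply/funext => z; rewrite mulN1r.
Qed.

Lemma smooth_conj f : smooth_on U f -> smooth_on U (fun z => (f z)^*).
Proof. by move=> hf k; exact: Ck_conj. Qed.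

Lemma smooth_inv f : (forall y, U y -> f y != 0) -> smooth_on U f ->
  smooth_on U (fun z => (f z)^-1).
Proof. by move=> f0 hf k; exact: Ck_inv. Qed.

Lemma smooth_sum (I : Type) (s : seq I) (P : pred I) (F : I -> 'rV[C]_n -> C) :
  (forall i, P i -> smooth_on U (F i)) -> smooth_on U (fun z => \sum_(i <- s | P i) F i z).
Proof.
move=> hF; elim: s => [|i s IH].
  by under eq_fun do rewrite big_nil; exact: smooth_cst.
have [Pi|NPi] := boolP (P i).
  under eq_fun do rewrite big_cons Pi; exact: smooth_add (hF i Pi) IH.
by under eq_fun do rewrite big_cons (negbTE NPi).
Qed.

Lemma smooth_prod (I : Type) (s : seq I) (P : pred I) (F : I -> 'rV[C]_n -> C) :
  (forall i, P i -> smooth_on U (F i)) -> smooth_on U (fun z => \prod_(i <- s | P i) F i z).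
Proof.
move=> hF; elim: s => [|i s IH].
  by under eq_fun do rewrite big_nil; exact: smooth_cst.
have [Pi|NPi] := boolP (P i).
  under eq_fun do rewrite big_cons Pi; exact: smooth_mul (hF i Pi) IH.
by under eq_fun do rewrite big_cons (negbTE NPi).
Qed.

Lemma smooth_exp f k : smooth_on U f -> smooth_on U (fun z => f z ^+ k).
Proof.
move=> hf; elim: k => [|k IH]; first exact: smooth_cst.
by under eq_fun do rewrite exprS; exact: smooth_mul.
Qed.

Lemma smooth_ext f g : (forall z, U z -> f z = g z) -> smooth_on U f -> smooth_on U g.
Proof. by move=> fg hf k; exact: Ck_ext (hf k). Qed.

Lemma smooth_continuous f z : U z -> smooth_on U f -> {for z, continuous f}.
Proof. by move=> Uz /(_ 0%N)/Ck_continuous; apply. Qed.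

Lemma dir_one : (1 : C) = 1 \/ (1 : C) = 'i. Proof. by left. Qed.
Lemma dir_i : ('i : C) = 1 \/ ('i : C) = 'i. Proof. by right. Qed.

Lemma smooth_rderivable f z j : smooth_on U f -> U z ->
  rderivable f z (basis_vec R j) /\ rderivable f z ('i *: basis_vec R j).
Proof.
move=> hf Uz; have [/(_ z Uz) + _] := Ck_dir j dir_one (hf 1%N).
by rewrite scale1r => ?; have [/(_ z Uz) ? _] := Ck_dir j dir_i (hf 1%N).
Qed.

Lemma smooth_rderive f j : smooth_on U f ->
  smooth_on U (rderive (basis_vec R j) f) /\ smooth_on U (rderive ('i *: basis_vec R j) f).
Proof.
move=> hf; split=> k.
  by have [_] := Ck_dir j dir_one (hf k.+1); rewrite scale1r.
by have [_] := Ck_dir j dir_i (hf k.+1).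
Qed.

(* First-order operators with constant coefficients in the 2n real coordinate
   directions: the directional, Wirtinger d and Wirtinger dbar derivatives are
   all of this form. *)
Definition wop (al be : 'rV[C]_n) f z : C :=
  \sum_j (al 0 j * rderive (basis_vec R j) f z +
          be 0 j * rderive ('i *: basis_vec R j) f z).

Lemma smooth_wop al be f : smooth_on U f -> smooth_on U (wop al be f).
Proof.
move=> hf; apply: smooth_sum => j _; have [h1 h2] := smooth_rderive j hf.
by apply: smooth_add; apply: smooth_mul => //; exact: smooth_cst.
Qed.

Lemma wop_ext al be f g z : U z -> (forall y, U y -> f y = g y) ->
  wop al be f z = wop al be g z.
Proof.
by move=> Uz fg; apply: eq_bigr => j _; congr (_ * _ + _ * _); exact: (rderive_ext _ Uo fg Uz).
Qed.

Lemma wop_cst al be c z : wop al be (fun=> c) z = 0.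
Proof. by rewrite /wop big1// => j _; rewrite !rderive_cst !mulr0 addr0. Qed.

Lemma wop_add al be f g z : U z -> smooth_on U f -> smooth_on U g ->
  wop al be (fun y => f y + g y) z = wop al be f z + wop al be g z.
Proof.
move=> Uz hf hg; rewrite /wop -big_split; apply: eq_bigr => j _ /=.
have [f1 f2] := smooth_rderivable j hf Uz; have [g1 g2] := smooth_rderivable j hg Uz.
rewrite (rderive_add f1 g1) (rderive_add f2 g2).
by rewrite !mulrDr addrACA.
Qed.

Lemma wop_mul al be f g z : U z -> smooth_on U f -> smooth_on U g ->
  wop al be (fun y => f y * g y) z = f z * wop al be g z + wop al be f z * g z.
Proof.
move=> Uz hf hg; rewrite /wop mulr_sumr mulr_suml -big_split; apply: eq_bigr => j _ /=.
have [f1 f2] := smooth_rderivable j hf Uz; have [g1 g2] := smooth_rderivable j hg Uz.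
rewrite (rderive_mul f1 g1) (rderive_mul f2 g2).
move: (rderive _ f z) (rderive _ g z) (rderive _ f z) (rderive _ g z) => a b c d.
by move: (f z) (g z) => u v; ring.
Qed.

Lemma wopZ al be c f z : U z -> smooth_on U f ->
  wop al be (fun y => c * f y) z = c * wop al be f z.
Proof.
by move=> Uz hf; rewrite wop_mul ?wop_cst ?mul0r ?addr0//; exact: smooth_cst.
Qed.

Lemma wop_sum al be (I : Type) (s : seq I) (F : I -> 'rV[C]_n -> C) z : U z ->
  (forall i, smooth_on U (F i)) ->
  wop al be (fun y => \sum_(i <- s) F i y) z = \sum_(i <- s) wop al be (F i) z.
Proof.
move=> Uz hF; elim: s => [|i s IH].
  by under eq_fun do rewrite big_nil; rewrite wop_cst big_nil.
under eq_fun do rewrite big_cons.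
by rewrite wop_add// ?big_cons ?IH//; exact: smooth_sum.
Qed.

Lemma rderive_sum (I : Type) (s : seq I) (F : I -> 'rV[C]_n -> C) z v :
  (forall i, rderivable (F i) z v) ->
  rderivable (fun y => \sum_(i <- s) F i y) z v /\
  rderive v (fun y => \sum_(i <- s) F i y) z = \sum_(i <- s) rderive v (F i) z.
Proof.
move=> hF; elim: s => [|i s [IH1 IH2]].
  under eq_fun do rewrite big_nil.
  by rewrite rderive_cst big_nil; split; first exact: rderivable_cst.
under eq_fun do rewrite big_cons.
rewrite big_cons; split; first exact: rderivable_add (hF i) IH1.
by apply: etrans (rderive_add (hF i) IH1) _; rewrite IH2.
Qed.

(** Symmetry of second derivatives term by term: v is one of the real coordinate directions in which
    [wop] differentiates. *)
Lemma wop_rderiveC al be f z v : U z -> smooth_on U f ->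
  (exists j, v = basis_vec R j \/ v = 'i *: basis_vec R j) ->
  wop al be (rderive v f) z = rderive v (wop al be f) z.
Proof.
move=> Uz hf [i hv].
have dv g y : smooth_on U g -> U y -> rderivable g y v.
  by move=> hg Uy; have [? ?] := smooth_rderivable i hg Uy; case: hv => ->.
have sv g : smooth_on U g -> smooth_on U (rderive v g).
  by move=> hg; have [? ?] := smooth_rderive i hg; case: hv => ->.
have comm u : (exists j, u = basis_vec R j \/ u = 'i *: basis_vec R j) ->
   rderive u (rderive v f) z = rderive v (rderive u f) z.
  move=> [j hu].
  have du g y : smooth_on U g -> U y -> rderivable g y u.
    by move=> hg Uy; have [? ?] := smooth_rderivable j hg Uy; case: hu => ->.
  have su g : smooth_on U g -> smooth_on U (rderive u g).
    by move=> hg; have [? ?] := smooth_rderive j hg; case: hu => ->.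
  apply: (rderiveC Uo Uz).
  - by move=> y; exact: dv.
  - by move=> y; exact: du.
  - by move=> y; apply: du; exact: sv.
  - by move=> y; apply: dv; exact: su.
  - by apply: smooth_continuous => //; apply: su; exact: sv.
  - by apply: smooth_continuous => //; apply: sv; exact: su.
have -> : rderive v (wop al be f) z =
    \sum_j rderive v (fun y => al 0 j * rderive (basis_vec R j) f y +
          be 0 j * rderive ('i *: basis_vec R j) f y) z.
  have hF j : rderivable (fun y => al 0 j * rderive (basis_vec R j) f y +
          be 0 j * rderive ('i *: basis_vec R j) f y) z v.
    have [h1 h2] := smooth_rderive j hf.
    by apply: dv => //; apply: smooth_add; apply: smooth_mul => //; exact: smooth_cst.
  exact: (rderive_sum _ hF).2.
apply: eq_bigr => j _.
have [h1 h2] := smooth_rderive j hf.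
have rZ c g : smooth_on U g -> rderivable (fun y => c * g y) z v /\
    rderive v (fun y => c * g y) z = c * rderive v g z.
  move=> hg; have dg := dv _ _ hg Uz; have dc := rderivable_cst c z v.
  by split; [exact: rderivable_mul dc dg|rewrite (rderive_mul dc dg) rderive_cst mul0r addr0].
have [r1 e1] := rZ (al 0 j) _ h1; have [r2 e2] := rZ (be 0 j) _ h2.
apply/esym/(etrans (rderive_add r1 r2)); congr (_ + _).
  refine (etrans e1 (congr1 (fun u => al 0 j * u) (esym (comm _ _)))).
  by exists j; left.
refine (etrans e2 (congr1 (fun u => be 0 j * u) (esym (comm _ _)))).
by exists j; right.
Qed.

Lemma wopC al be al' be' f z : U z -> smooth_on U f ->
  wop al be (wop al' be' f) z = wop al' be' (wop al be f) z.
Proof.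
move=> Uz hf.
have s1 j := (smooth_rderive j hf).1; have s2 j := (smooth_rderive j hf).2.
have sc c g : smooth_on U g -> smooth_on U (fun y => c * g y).
  by move=> hg; apply: smooth_mul => //; exact: smooth_cst.
refine (etrans (wop_sum al be _ Uz _) _).
  by move=> j; apply: smooth_add; exact: sc.
apply: eq_bigr => j _; refine (etrans (wop_add al be Uz (sc _ _ (s1 j)) (sc _ _ (s2 j))) _).
congr +%R.
  refine (etrans (wopZ al be _ Uz (s1 j)) (congr1 (fun u => al' 0 j * u) _)).
  by apply: wop_rderiveC => //; exists j; left.
refine (etrans (wopZ al be _ Uz (s2 j)) (congr1 (fun u => be' 0 j * u) _)).
by apply: wop_rderiveC => //; exists j; right.
Qed.

End SmoothFunctions.

(** * The second derivative test for d dbar log *)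

Section Wirtinger.
Variables (R : realType) (n : nat) (U : set 'rV[Cplx R]_n).
Hypothesis Uo : open U.
Local Notation C := (Cplx R).
Implicit Types (f g : 'rV[C]_n -> C) (z v w X : 'rV[C]_n).

Definition del X f : 'rV[C]_n -> C := wop (2^-1 *: X) (- ('i / 2) *: X) f.

(** The coordinates of X are conjugated: this differentiates along conj X, so [delbar X (del X f)]
    is the complex Hessian on (X, conj X). *)
Definition delbar X f : 'rV[C]_n -> C :=
  wop (2^-1 *: map_mx Num.conj X) ('i / 2 *: map_mx Num.conj X) f.

Lemma delE X f z : del X f z = \sum_j X 0 j * dz j f z.
Proof.
apply: eq_bigr => j _; rewrite /dz !mxE.
by move: (rderive _ f z) (rderive _ f z) => a b; ring.
Qed.

Lemma delbarE X f z : delbar X f z = \sum_j (X 0 j)^* * dzbar j f z.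
Proof.
apply: eq_bigr => j _; rewrite /dzbar !mxE.
by move: (rderive _ f z) (rderive _ f z) => a b; ring.
Qed.

Lemma is_rderive_sum (I : Type) (s : seq I) (v : I -> 'rV[C]_n) (g : I -> 'rV[C]_n -> C) f z :
  U z -> (forall i, smooth_on U (g i)) ->
  (forall i y, U y -> is_rderive y (v i) f (g i y)) ->
  is_rderive z (\sum_(i <- s) v i) f (\sum_(i <- s) g i z).
Proof.
move=> Uz hg hv; elim: s => [|i s IH].
  rewrite !big_nil => b; rewrite (_ : part b 0 = 0); last by case: (b).
  apply: is_derive_ext (is_derive_cst (part b (f z)) (0 : R) 1) => t.
  by rewrite /part_line scaler0 addr0.
rewrite !big_cons addrC [X in is_rderive _ _ _ X]addrC.
apply: (is_rderive_add Uo Uz IH); first exact: hv.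
exact: smooth_continuous (hg i).
Qed.

(** X is a real combination of the 2n coordinate directions, so additivity in the direction applies.
    This links the formal operators to genuine derivatives along the lines z + t X. *)
Lemma is_rderive_wop X f z : U z -> smooth_on U f ->
  is_rderive z X f (wop (map_mx (fun c => RtoC (complex.Re c)) X)
                        (map_mx (fun c => RtoC (complex.Im c)) X) f z).
Proof.
move=> Uz hf.
have XE : X = \sum_j (RtoC (complex.Re (X 0 j)) *: basis_vec R j +
                      RtoC (complex.Im (X 0 j)) *: ('i *: basis_vec R j)).
  rewrite {1}[X]row_sum_delta; apply: eq_bigr => j _.
  by rewrite scalerA -scalerDl -Cparts.
have s1 j := (smooth_rderive j hf).1; have s2 j := (smooth_rderive j hf).2.
have sc c g : smooth_on U g -> smooth_on U (fun y => c * g y).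
  by move=> hg; apply: smooth_mul => //; exact: smooth_cst.
rewrite [X in is_rderive _ X]XE.
rewrite (_ : wop _ _ f z = \sum_j (RtoC (complex.Re (X 0 j)) * rderive (basis_vec R j) f z +
   RtoC (complex.Im (X 0 j)) * rderive ('i *: basis_vec R j) f z)); last first.
  by apply: eq_bigr => j _; rewrite !mxE.
apply: (@is_rderive_sum _ _ _ (fun j y => RtoC (complex.Re (X 0 j)) * rderive (basis_vec R j) f y +
   RtoC (complex.Im (X 0 j)) * rderive ('i *: basis_vec R j) f y)) => //.
  by move=> j; apply: smooth_add => //; exact: sc.
move=> j y Uy; have [r1 r2] := smooth_rderivable j hf Uy.
apply: (@is_rderive_add _ _ U _ _ _ _ (fun y => RtoC (complex.Im (X 0 j)) * rderive ('i *: basis_vec R j) f y)) => //.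
- exact/is_rderive_scale/rderivableE.
- by move=> x Ux; have [_ r] := smooth_rderivable j hf Ux; exact/is_rderive_scale/rderivableE.
- exact: (smooth_continuous Uy (sc _ _ (s2 j))).
Qed.

Lemma i_mul_i : 'i * 'i = -1 :> C.
Proof. by rewrite -expr2 sqrCi. Qed.

Lemma RtoC_Re (c : C) : RtoC (complex.Re c) = 2^-1 * (c + c^*).
Proof.
have -> : c + c^* = 2 * RtoC (complex.Re c).
  by apply: eq_ReIm; rewrite (ReD, ImD) (cRe_conj, cIm_conj) (Defs.ReM, Defs.ImM)/=; ring.
by rewrite mulKf// pnatr_eq0.
Qed.

Lemma RtoC_Im (c : C) : RtoC (complex.Im c) = - ('i / 2) * (c - c^*).
Proof.
have -> : c - c^* = 2 * 'i * RtoC (complex.Im c).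
  apply: eq_ReIm; rewrite (ReD, ImD) -/(part true (- _)) -/(part false (- _)) partN
    /part (cRe_conj, cIm_conj) !(Defs.ReM, Defs.ImM)/=; ring.
transitivity (- ('i * 'i) * RtoC (complex.Im c)); first by rewrite i_mul_i opprK mul1r.
by field.
Qed.

Definition rdir X f : 'rV[C]_n -> C :=
  wop (map_mx (fun c => RtoC (complex.Re c)) X) (map_mx (fun c => RtoC (complex.Im c)) X) f.

Lemma rdirE X f z : rdir X f z = del X f z + delbar X f z.
Proof.
rewrite /rdir /del /delbar /wop -big_split; apply: eq_bigr => j _ /=.
rewrite !mxE RtoC_Re RtoC_Im.
by move: (rderive _ f z) (rderive _ f z) (X 0 j) ((X 0 j)^*) => a b x y; ring.
Qed.

Lemma del_i X f z : del ('i *: X) f z = 'i * del X f z.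
Proof.
rewrite /del /wop mulr_sumr; apply: eq_bigr => j _; rewrite !mxE.
by move: (rderive _ f z) (rderive _ f z) (X 0 j) => a b x; ring.
Qed.

Lemma delbar_i X f z : delbar ('i *: X) f z = - 'i * delbar X f z.
Proof.
rewrite /delbar /wop mulr_sumr; apply: eq_bigr => j _; rewrite !mxE.
by move: (rderive _ f z) (rderive _ f z) => a b; rewrite rmorphM/= conjCi; ring.
Qed.

Lemma smooth_del X f : smooth_on U f -> smooth_on U (del X f).
Proof. exact: smooth_wop. Qed.

Lemma smooth_delbar X f : smooth_on U f -> smooth_on U (delbar X f).
Proof. exact: smooth_wop. Qed.

Lemma wop_conj al be f z : U z -> smooth_on U f ->
  wop al be (fun y => (f y)^*) z = (wop (map_mx Num.conj al) (map_mx Num.conj be) f z)^*.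
Proof.
move=> Uz hf; rewrite /wop rmorph_sum; apply: eq_bigr => j _; rewrite !mxE.
have [/rderivableE/is_rderive_conj/is_rderiveP[_ e1]
      /rderivableE/is_rderive_conj/is_rderiveP[_ e2]] := smooth_rderivable j hf Uz.
refine (etrans (congr2 +%R (congr1 (fun c => al 0 j * c) e1) (congr1 (fun c => be 0 j * c) e2)) _).
move: (rderive _ f z) (rderive _ f z) => a b.
by rewrite rmorphD !rmorphM/= !conjCK.
Qed.

Lemma wop_opp al be f z : U z -> smooth_on U f ->
  wop al be (fun y => - f y) z = - wop al be f z.
Proof.
move=> Uz hf; refine (etrans (wop_ext Uo _ _ Uz (fun y _ => esym (mulN1r (f y)))) _).
by refine (etrans (wopZ _ _ _ Uz hf) _); rewrite mulN1r.
Qed.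

Lemma del_conj X f z : U z -> smooth_on U f ->
  del X (fun y => (f y)^*) z = (delbar X f z)^*.
Proof.
move=> Uz hf; refine (etrans (wop_conj _ _ Uz hf) _); congr (wop _ _ _ _)^*.
  by apply/rowP => j; rewrite !mxE rmorphM/= fmorphV/= conjC_nat.
by apply/rowP => j; rewrite !mxE !(rmorphM, rmorphN)/= fmorphV/= conjC_nat conjCi !mulNr opprK.
Qed.

Lemma delbar_conj X f z : U z -> smooth_on U f ->
  delbar X (fun y => (f y)^*) z = (del X f z)^*.
Proof.
move=> Uz hf; have hc := smooth_conj Uo hf.
rewrite -[LHS]conjCK -(del_conj X Uz hc); congr (_^*).
by apply: (wop_ext Uo) => // y _; rewrite conjCK.
Qed.

Lemma rdir_test X f z : U z -> smooth_on U f ->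
  (forall y, U y -> complex.Re (f z) <= complex.Re (f y)) ->
  complex.Re (rdir X f z) = 0 /\ 0 <= complex.Re (rdir X (rdir X f) z).
Proof.
move=> Uz hf hmin.
have [e e0 He] := near_plane X X Uo Uz.
have Ut (t : R) : `|t| < e -> U (z + RtoC t *: X).
  by move=> te; have := He t 0 te; rewrite normr0 scale0r addr0; exact.
have z0 : z + RtoC 0 *: X = z by rewrite RtoC0 scale0r addr0.
have h1 (t : R) : `|t| < e -> is_derive t 1 (part_line true f z X) (part_line true (rdir X f) z X t).
  by move=> te; apply: is_derive_part_line; exact: (is_rderive_wop X (Ut t te) hf).
have h2 : is_derive (0 : R) 1 (part_line true (rdir X f) z X) (part true (rdir X (rdir X f) z)).
  have sr : smooth_on U (rdir X f) by exact: smooth_wop.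
  exact: (is_rderive_wop X Uz sr true).
have := second_derivative_test e0 h1 h2.
rewrite /part_line z0 => H; apply: H => t te.
exact: hmin (Ut t te).
Qed.

(** The real test is run along X and along iX. To first order it kills the real and the imaginary
    part of [del X f z]; to second order the terms del del and delbar delbar cancel in the sum,
    which leaves four times delbar del. *)
Lemma del_test X f z : U z -> smooth_on U f ->
  (forall y, U y -> (f y)^* = f y) ->
  (forall y, U y -> complex.Re (f z) <= complex.Re (f y)) ->
  [/\ del X f z = 0, delbar X f z = 0 & 0 <= complex.Re (delbar X (del X f) z)].
Proof.
move=> Uz hf hre hmin.
have [a1 b1] := rdir_test X Uz hf hmin.
have [a2 b2] := rdir_test ('i *: X) Uz hf hmin.
have ebar : delbar X f z = (del X f z)^*.
  rewrite -(delbar_conj X Uz hf); apply: (wop_ext Uo) => // y Uy.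
  by rewrite hre.
have d0 : del X f z = 0.
  move: a1 a2; rewrite !rdirE del_i delbar_i ebar.
  move: (del X f z) => c.
  have -> : c + c^* = RtoC (2 * complex.Re c).
    by rewrite rmorphM/= RtoC_Re; field.
  have -> : 'i * c + - 'i * c^* = RtoC (- 2 * complex.Im c).
    rewrite rmorphM/= RtoC_Im (_ : RtoC (- 2) = - 2); first by field.
    by rewrite rmorphN rmorph_nat.
  move=> /= a1 a2; apply: eq_ReIm => /=.
    by apply/eqP; move/eqP: a1; rewrite mulf_eq0 pnatr_eq0.
  by apply/eqP; move/eqP: a2; rewrite mulf_eq0 oppr_eq0 pnatr_eq0.
split; [exact: d0|by rewrite ebar d0 conjC0|].
have hd := smooth_del X hf; have hdb := smooth_delbar X hf.
have sc c g : smooth_on U g -> smooth_on U (fun y => c * g y).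
  by move=> hg; apply: (smooth_mul Uo) => //; exact: smooth_cst.
have e1 : rdir X (rdir X f) z = del X (del X f) z + del X (delbar X f) z +
    (delbar X (del X f) z + delbar X (delbar X f) z).
  rewrite rdirE; congr (_ + _).
    refine (etrans (wop_ext Uo _ _ Uz (fun y _ => rdirE X f y)) _).
    exact: (wop_add _ _ Uz hd hdb).
  refine (etrans (wop_ext Uo _ _ Uz (fun y _ => rdirE X f y)) _).
  exact: (wop_add _ _ Uz hd hdb).
have e2 : rdir ('i *: X) (rdir ('i *: X) f) z = 'i * ('i * del X (del X f) z + (- 'i) * del X (delbar X f) z)
   + (- 'i) * ('i * delbar X (del X f) z + (- 'i) * delbar X (delbar X f) z).
  have E y : rdir ('i *: X) f y = 'i * del X f y + - 'i * delbar X f y.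
    by rewrite rdirE del_i delbar_i.
  have Ez al be : wop al be (rdir ('i *: X) f) z =
      'i * wop al be (del X f) z + - 'i * wop al be (delbar X f) z.
    refine (etrans (wop_ext Uo _ _ Uz (fun y _ => E y)) _).
    refine (etrans (wop_add _ _ Uz (sc _ _ hd) (sc _ _ hdb)) _).
    exact: (congr2 +%R (wopZ _ _ _ Uz hd) (wopZ _ _ _ Uz hdb)).
  rewrite rdirE del_i delbar_i; exact: (congr2 (fun a b => 'i * a + - 'i * b) (Ez _ _) (Ez _ _)).
have comm : del X (delbar X f) z = delbar X (del X f) z by exact: (wopC Uo _ _ _ _ Uz hf).
have : 0 <= complex.Re (rdir X (rdir X f) z + rdir ('i *: X) (rdir ('i *: X) f) z).
  by rewrite ReD; exact: (addr_ge0 b1 b2).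
rewrite e1 e2 comm.
move: (del X (del X f) z) (delbar X (del X f) z) (delbar X (delbar X f) z) => a b c.
have -> : a + b + (b + c) + ('i * ('i * a + - 'i * b) + - 'i * ('i * b + - 'i * c)) =
   RtoC 4 * b.
  transitivity (a + b + (b + c) + ('i * 'i) * (a - b - b + c)); first by ring.
  by rewrite i_mul_i (rmorph_nat (@RtoC R) 4); ring.
by rewrite -/(part true _) partZ pmulr_rge0.
Qed.

(* d dbar log f, evaluated on (X, conj X). *)
Definition loglap X f z : C :=
  (f z * delbar X (del X f) z - del X f z * delbar X f z) / (f z) ^+ 2.

Lemma delbar_del_mul X f g z : U z -> smooth_on U f -> smooth_on U g ->
  delbar X (del X (fun y => f y * g y)) z =
    f z * delbar X (del X g) z + delbar X f z * del X g z +
    (del X f z * delbar X g z + delbar X (del X f) z * g z).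
Proof.
move=> Uz hf hg.
refine (etrans (wop_ext Uo _ _ Uz (fun y Uy => wop_mul _ _ Uy hf hg)) _).
have hd := smooth_del X hf; have hd' := smooth_del X hg.
refine (etrans (wop_add _ _ Uz (smooth_mul Uo hf hd') (smooth_mul Uo hd hg)) _).
exact: (congr2 +%R (wop_mul _ _ Uz hf hd') (wop_mul _ _ Uz hd hg)).
Qed.

(** The quotient form of [loglap] avoids a complex logarithm: after the Leibniz rules, additivity is
    an identity between rational expressions. *)
Lemma loglap_mul X f g z : U z -> smooth_on U f -> smooth_on U g ->
  f z != 0 -> g z != 0 ->
  loglap X (fun y => f y * g y) z = loglap X f z + loglap X g z.
Proof.
move=> Uz hf hg f0 g0; rewrite /loglap delbar_del_mul//.
have -> : del X (fun y => f y * g y) z = f z * del X g z + del X f z * g z by exact: (wop_mul _ _ Uz hf hg).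
have -> : delbar X (fun y => f y * g y) z = f z * delbar X g z + delbar X f z * g z by exact: (wop_mul _ _ Uz hf hg).
move: (f z) (g z) f0 g0 (del X f z) (del X g z) (delbar X f z) (delbar X g z)
  (delbar X (del X f) z) (delbar X (del X g) z) => u v u0 v0 a b c d p q.
by field; rewrite u0 v0.
Qed.

Lemma loglap_cst X c z : loglap X (fun=> c) z = 0.
Proof.
rewrite /loglap; have -> : del X (fun=> c) = fun=> 0 by apply/funext => y; exact: wop_cst.
by rewrite [delbar X (fun=> 0) z]wop_cst mulr0 mul0r subrr mul0r.
Qed.

Lemma loglap_exp X f k z : U z -> smooth_on U f -> f z != 0 ->
  loglap X (fun y => f y ^+ k) z = k%:R * loglap X f z.
Proof.
move=> Uz hf f0; elim: k => [|k IH]; first by rewrite loglap_cst mul0r.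
under [X in loglap _ X]eq_fun do rewrite exprS.
rewrite loglap_mul ?IH ?expf_neq0//; last exact: smooth_exp.
by rewrite -natr1 mulrDl mul1r addrC.
Qed.

Lemma loglap_prod (I : Type) (s : seq I) X (F : I -> 'rV[C]_n -> C) z : U z ->
  (forall i, smooth_on U (F i)) -> (forall i, F i z != 0) ->
  loglap X (fun y => \prod_(i <- s) F i y) z = \sum_(i <- s) loglap X (F i) z.
Proof.
move=> Uz hF F0; elim: s => [|i s IH].
  by under [X in loglap _ X]eq_fun do rewrite big_nil; rewrite loglap_cst big_nil.
under [X in loglap _ X]eq_fun do rewrite big_cons.
rewrite loglap_mul ?IH ?big_cons//; first exact: smooth_prod.
by elim: s {IH} => [|j s IH]; rewrite ?big_nil ?oner_eq0// big_cons mulf_neq0.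
Qed.

Lemma holomorphic_delbar X f z : U z -> holomorphic_on U f -> delbar X f z = 0.
Proof. by move=> Uz [_ h]; rewrite delbarE big1// => j _; rewrite h// mulr0. Qed.

(** f is killed by delbar and its conjugate by del, so each factor has zero mixed derivative, the
    two operators commuting. *)
Lemma loglap_hol X f z : U z -> holomorphic_on U f -> f z != 0 ->
  loglap X (fun y => f y * (f y)^*) z = 0.
Proof.
move=> Uz fh f0; have hf := fh.1; have hc := smooth_conj Uo hf.
have dc y : U y -> del X (fun y => (f y)^*) y = 0.
  by move=> Uy; rewrite del_conj// holomorphic_delbar// conjC0.
have ddc : delbar X (del X (fun y => (f y)^*)) z = 0.
  by refine (etrans (wop_ext Uo _ _ Uz dc) _); exact: wop_cst.
have dd : delbar X (del X f) z = 0.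
  refine (etrans (wopC Uo _ _ _ _ Uz hf) _).
  refine (etrans (wop_ext Uo _ _ Uz (fun y Uy => holomorphic_delbar X Uy fh)) _).
  exact: wop_cst.
rewrite loglap_mul ?conjC_eq0// /loglap dd ddc dc// holomorphic_delbar//.
by rewrite !mulr0 mul0r subrr !mul0r addr0.
Qed.

(** P - |f|^2 has a minimum with value 0 at z, hence [del_test] applies to it, and log |f|^2 is
    pluriharmonic. *)
Lemma loglap_ge0 X f P z : U z -> holomorphic_on U f -> f z != 0 -> smooth_on U P ->
  (forall y, U y -> f y * (f y)^* <= P y) -> P z = f z * (f z)^* ->
  0 <= complex.Re (loglap X P z).
Proof.
move=> Uz fh f0 hP hle heq.
pose Q y := f y * (f y)^*.
have hQ : smooth_on U Q by apply: (smooth_mul Uo) fh.1 _; exact: (smooth_conj Uo fh.1).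
have hN : smooth_on U (fun y => - Q y) by exact: smooth_opp.
pose G y := P y + - Q y.
have hG : smooth_on U G by exact: smooth_add.
have Gge y : U y -> 0 <= G y by move=> Uy; rewrite subr_ge0 hle.
have Gre y : U y -> (G y)^* = G y by move=> Uy; apply/conj_Creal/ger0_real/Gge.
have Gz : G z = 0 by rewrite /G heq subrr.
have [|d0 db0 dd0] := del_test X Uz hG Gre.
  by move=> y Uy; rewrite Gz ge0_Re// Gge.
have wG al be g h y : U y -> smooth_on U g -> smooth_on U h ->
    wop al be (fun y => g y + - h y) y = wop al be g y - wop al be h y.
  move=> Uy sg sh; refine (etrans (wop_add _ _ Uy sg (smooth_opp Uo sh)) _).
  exact: (congr1 (fun c => wop al be g y + c) (wop_opp _ _ Uy sh)).
have e1 : del X P z = del X Q z.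
  by apply/eqP; rewrite -subr_eq0 -d0; apply/eqP/esym; exact: (wG _ _ _ _ _ Uz hP hQ).
have e2 : delbar X P z = delbar X Q z.
  by apply/eqP; rewrite -subr_eq0 -db0; apply/eqP/esym; exact: (wG _ _ _ _ _ Uz hP hQ).
have e3 : delbar X (del X G) z = delbar X (del X P) z - delbar X (del X Q) z.
  have dG y : U y -> del X G y = del X P y + - del X Q y.
    by move=> Uy; exact: (wG _ _ _ _ _ Uy hP hQ).
  refine (etrans (wop_ext Uo _ _ Uz dG) _).
  exact: (wG _ _ _ _ _ Uz (smooth_del X hP) (smooth_del X hQ)).
have Pz : P z = Q z by [].
have Q0 : 0 < Q z by rewrite /Q -normCK exprn_gt0// normr_gt0.
have lQ : loglap X Q z = 0 by exact: loglap_hol.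
(* P and Q agree to first order at z, so only the second derivatives distinguish the two terms. *)
have -> : loglap X P z = (P z)^-1 * delbar X (del X G) z + loglap X Q z.
  rewrite /loglap e1 e2 e3 Pz.
  move: (Q z) Q0 (delbar X (del X P) z) (delbar X (del X Q) z) => q q0 a b.
  by field; rewrite gt_eqF.
have V0 : 0 <= (P z)^-1 by rewrite invr_ge0 Pz ltW.
have r0 := ge0_Re V0.
rewrite lQ addr0 (ge0_RtoC V0); move: (complex.Re _) r0 => r r0.
have := partZ true r (delbar X (del X G) z); rewrite /part => ->; exact: mulr_ge0.
Qed.

End Wirtinger.

(** * Chern curvature in a local frame *)

Section MatrixCalculus.
Variables (R : realType) (n : nat) (U : set 'rV[Cplx R]_n).
Hypothesis Uo : open U.
Local Notation C := (Cplx R).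
Implicit Types (f g : 'rV[C]_n -> C) (z v w X : 'rV[C]_n).

Definition msmooth (p q : nat) (A : 'rV[C]_n -> 'M[C]_(p, q)) : Prop :=
  forall a b, smooth_on U (fun z => A z a b).

Definition mwop (p q : nat) al be (A : 'rV[C]_n -> 'M[C]_(p, q)) z : 'M[C]_(p, q) :=
  \matrix_(a, b) wop al be (fun w => A w a b) z.

Lemma msmooth_cst p q (A : 'M[C]_(p, q)) : msmooth (fun=> A).
Proof. by move=> a b; exact: smooth_cst. Qed.

Lemma msmooth_mul p q r (A : 'rV[C]_n -> 'M[C]_(p, q)) (B : 'rV[C]_n -> 'M[C]_(q, r)) :
  msmooth A -> msmooth B -> msmooth (fun z => A z *m B z).
Proof.
move=> hA hB a b; under eq_fun do rewrite mxE.
by apply: (smooth_sum Uo) => c _; exact: (smooth_mul Uo).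
Qed.

Lemma msmooth_conj_tr p q (A : 'rV[C]_n -> 'M[C]_(p, q)) :
  msmooth A -> msmooth (fun z => conj_tr (A z)).
Proof. by move=> hA a b; under eq_fun do rewrite !mxE; exact: (smooth_conj Uo). Qed.

Lemma msmooth_mwop p q al be (A : 'rV[C]_n -> 'M[C]_(p, q)) :
  msmooth A -> msmooth (mwop al be A).
Proof. by move=> hA a b; under eq_fun do rewrite !mxE; exact: (smooth_wop Uo). Qed.

Lemma mwop_cst p q al be (A : 'M[C]_(p, q)) z : mwop al be (fun=> A) z = 0.
Proof. by apply/matrixP => a b; rewrite !mxE wop_cst. Qed.

Lemma mwop_ext p q al be (A B : 'rV[C]_n -> 'M[C]_(p, q)) z : U z ->
  (forall y, U y -> A y = B y) -> mwop al be A z = mwop al be B z.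
Proof.
by move=> Uz AB; apply/matrixP => a b; rewrite !mxE; apply: (wop_ext Uo) => // y /AB ->.
Qed.

Lemma mwop_add p q al be (A B : 'rV[C]_n -> 'M[C]_(p, q)) z : U z ->
  msmooth A -> msmooth B ->
  mwop al be (fun y => A y + B y) z = mwop al be A z + mwop al be B z.
Proof.
move=> Uz hA hB; apply/matrixP => a b; rewrite !mxE.
refine (etrans (wop_ext Uo _ _ Uz (fun y _ => mxE _ _ _ _)) _).
exact: (wop_add _ _ Uz (hA a b) (hB a b)).
Qed.

Lemma mwop_mul p q r al be (A : 'rV[C]_n -> 'M[C]_(p, q)) (B : 'rV[C]_n -> 'M[C]_(q, r)) z :
  U z -> msmooth A -> msmooth B ->
  mwop al be (fun y => A y *m B y) z = A z *m mwop al be B z + mwop al be A z *m B z.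
Proof.
move=> Uz hA hB; apply/matrixP => a b; rewrite !mxE.
refine (etrans (wop_ext Uo _ _ Uz (fun y _ => mxE _ _ _ _)) _).
refine (etrans (wop_sum Uo _ _ _ Uz (fun c => smooth_mul Uo (hA a c) (hB c b))) _).
rewrite -big_split; apply: eq_bigr => c _ /=; rewrite !mxE.
exact: (wop_mul _ _ Uz (hA a c) (hB c b)).
Qed.

Definition mdel p q X (A : 'rV[C]_n -> 'M[C]_(p, q)) :=
  mwop (2^-1 *: X) (- ('i / 2) *: X) A.

Definition mdelbar p q X (A : 'rV[C]_n -> 'M[C]_(p, q)) :=
  mwop (2^-1 *: map_mx Num.conj X) ('i / 2 *: map_mx Num.conj X) A.

Lemma mdelE p q X (A : 'rV[C]_n -> 'M[C]_(p, q)) z a b :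
  mdel X A z a b = del X (fun w => A w a b) z.
Proof. by rewrite mxE. Qed.

Lemma mdelbarE p q X (A : 'rV[C]_n -> 'M[C]_(p, q)) z a b :
  mdelbar X A z a b = delbar X (fun w => A w a b) z.
Proof. by rewrite mxE. Qed.

Lemma mdel_conj_tr p q X (A : 'rV[C]_n -> 'M[C]_(p, q)) z : U z -> msmooth A ->
  mdel X (fun y => conj_tr (A y)) z = conj_tr (mdelbar X A z).
Proof.
move=> Uz hA; apply/matrixP => a b; rewrite mdelE !mxE.
have E y : conj_tr (A y) a b = (A y b a)^* by rewrite !mxE.
refine (etrans (wop_ext Uo _ _ Uz (fun y _ => E y)) _).
exact: (del_conj X Uz (hA b a)).
Qed.

Lemma smooth_det p (A : 'rV[C]_n -> 'M[C]_p) : msmooth A -> smooth_on U (fun z => \det (A z)).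
Proof.
move=> hA; apply: (smooth_sum Uo) => s _; apply: (smooth_mul Uo); first exact: smooth_cst.
by apply: (smooth_prod Uo) => i _; exact: hA.
Qed.

(** Cramer's rule: each entry is a polynomial in the entries of A over a nonvanishing
    determinant. *)
Lemma msmooth_inv p (A : 'rV[C]_n -> 'M[C]_p) : msmooth A ->
  (forall z, U z -> A z \in unitmx) -> msmooth (fun z => invmx (A z)).
Proof.
move=> hA uA a b.
have d0 z : U z -> \det (A z) != 0 by move=> /uA; rewrite unitmxE unitfE.
apply: (@smooth_ext _ _ _ Uo (fun z => (\det (A z))^-1 * (\adj (A z)) a b)).
  by move=> z /uA uz; rewrite /invmx uz !mxE.
apply: (smooth_mul Uo); first exact: (smooth_inv Uo d0 (smooth_det hA)).
under eq_fun do rewrite mxE.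
apply: (smooth_mul Uo); first exact: smooth_cst.
by apply: smooth_det => i j; under eq_fun do rewrite !mxE; exact: hA.
Qed.

Lemma dz_del (j : 'I_n) f : dz j f = del (basis_vec R j) f.
Proof.
apply/funext => z; rewrite delE (bigD1 j)//= big1 ?addr0 => [|i ij].
  by rewrite mxE !eqxx mul1r.
by rewrite mxE eqxx (negbTE ij) mul0r.
Qed.

Lemma dzbar_delbar (j : 'I_n) f : dzbar j f = delbar (basis_vec R j) f.
Proof.
apply/funext => z; rewrite delbarE (bigD1 j)//= big1 ?addr0 => [|i ij].
  by rewrite mxE !eqxx conjC1 mul1r.
by rewrite mxE eqxx (negbTE ij) conjC0 mul0r.
Qed.

Lemma mdel_sum p q X (A : 'rV[C]_n -> 'M[C]_(p, q)) z :
  mdel X A z = \sum_j X 0 j *: dz_mx j A z.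
Proof.
apply/matrixP => a b; rewrite mdelE delE summxE; apply: eq_bigr => j _.
by rewrite !mxE.
Qed.

(** * Curvature of a Gram matrix and flat extensions *)

Section Chern.
Variables (r : nat) (H : 'rV[C]_n -> 'M[C]_r).
Hypothesis Hs : msmooth H.
Hypothesis Hu : forall z, U z -> H z \in unitmx.

Lemma curvature_op_cst (j l : 'I_n) (u : 'rV[C]_r) z :
  curvature_op H j l (fun=> u) z =
  - dzbar_mx l (fun y => u *m (dz_mx j H y *m invmx (H y))) z.
Proof.
have z1 m p (A : 'M[C]_(m, p)) : dzbar_mx l (fun=> A) = fun=> 0.
  by apply/funext => y; apply/matrixP => a b; rewrite !mxE dzbar_delbar [LHS]wop_cst.
have z2 m p (A : 'M[C]_(m, p)) : dz_mx j (fun=> A) = fun=> 0.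
  by apply/funext => y; apply/matrixP => a b; rewrite !mxE dz_del [LHS]wop_cst.
rewrite /curvature_op /chern01 /chern10 z1 z2 mul0mx addr0 sub0r.
by congr (- dzbar_mx l _ z); apply/funext => y; rewrite z2 add0r.
Qed.

(** Minus the curvature on (X, conj X) with its last index lowered by H: the classical coordinate
    formula, visibly smooth. *)
Definition curv_mx X z : 'M[C]_r :=
  mdelbar X (mdel X H) z - mdel X H z *m invmx (H z) *m mdelbar X H z.

(** On constant components only delbar of the connection matrix (dH) H^-1 survives; multiplication
    by H on the right eliminates the derivative of H^-1. *)
Lemma chern_curvatureE z X (u : 'rV[C]_r) : U z ->
  chern_curvature H z X X u *m H z = - (u *m curv_mx X z).
Proof.
move=> Uz.
have Ki := msmooth_inv Hs Hu.
have Kd X' : msmooth (mdel X' H) by exact: msmooth_mwop.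
have dzs j : msmooth (dz_mx j H).
  move=> a b; under eq_fun do rewrite mxE dz_del.
  exact: (smooth_del Uo _ (Hs a b)).
have E1 : chern_curvature H z X X u =
    - mdelbar X (fun y => u *m (mdel X H y *m invmx (H y))) z.
  apply/rowP => b; rewrite /chern_curvature summxE [RHS]mxE mdelbarE.
  pose g (j : 'I_n) y := (u *m (dz_mx j H y *m invmx (H y))) 0 b.
  have gs j : smooth_on U (g j).
    by move: (0 : 'I_1) b @g => a b; apply: msmooth_mul; [exact: msmooth_cst|exact: msmooth_mul].
  have -> : delbar X (fun y => (u *m (mdel X H y *m invmx (H y))) 0 b) z =
      \sum_j X 0 j * delbar X (g j) z.
    have Eg y : (u *m (mdel X H y *m invmx (H y))) 0 b = \sum_j X 0 j * g j y.
      rewrite mdel_sum mulmx_suml mulmx_sumr summxE; apply: eq_bigr => j _.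
      by rewrite -scalemxAl -scalemxAr mxE.
    refine (etrans (wop_ext Uo _ _ Uz (fun y _ => Eg y)) _).
    refine (etrans (wop_sum Uo _ _ _ Uz (fun j => smooth_mul Uo (smooth_cst U (X 0 j)) (gs j))) _).
    by apply: eq_bigr => j _; exact: (wopZ _ _ _ Uz (gs j)).
  rewrite -sumrN; apply: eq_bigr => j _; rewrite summxE delbarE mulr_sumr -sumrN.
  apply: eq_bigr => l _; rewrite curvature_op_cst !mxE /g.
  by rewrite mulrN mulrA.
rewrite E1 /curv_mx.
have -> : mdelbar X (fun y => u *m (mdel X H y *m invmx (H y))) z =
    u *m (mdel X H z *m mdelbar X (fun y => invmx (H y)) z + mdelbar X (mdel X H) z *m invmx (H z)).
  refine (etrans (mwop_mul _ _ Uz (msmooth_cst u) (msmooth_mul (Kd X) Ki)) _).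
  rewrite [mwop _ _ (fun=> u) z]mwop_cst mul0mx addr0; congr (u *m _).
  exact: (mwop_mul _ _ Uz (Kd X) Ki).
(* Differentiate H^-1 H = 1. *)
have KH : mdelbar X (fun y => invmx (H y)) z *m H z = - (invmx (H z) *m mdelbar X H z).
  have := mwop_mul (2^-1 *: map_mx Num.conj X) ('i / 2 *: map_mx Num.conj X) Uz Ki Hs.
  rewrite (@mwop_ext _ _ _ _ _ (fun=> 1%:M) _ Uz); last by move=> y /Hu; exact: mulVmx.
  by rewrite mwop_cst => /esym/eqP; rewrite addrC addr_eq0 => /eqP.
move: KH (mulVmx (Hu Uz)); move: (mdel X H z) (mdelbar X (fun y => invmx (H y)) z)
  (mdelbar X (mdel X H) z) (mdelbar X H z) (invmx (H z)) (H z) => A B D F K G KH KG.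
by rewrite mulNmx -(mulmxA u) mulmxDl -!mulmxA KH KG mulmx1 mulmxN addrC.
Qed.

Variables (z0 : 'rV[C]_n) (u : 'rV[C]_r).
Hypothesis Uz0 : U z0.

(* The affine extension of u whose covariant derivative vanishes at z0. *)
Definition flat_ext z : 'rV[C]_r :=
  u - \sum_j (z 0 j - z0 0 j) *: (u *m dz_mx j H z0 *m invmx (H z0)).

Lemma flat_ext0 : flat_ext z0 = u.
Proof. by rewrite /flat_ext big1 ?subr0// => j _; rewrite subrr scale0r. Qed.

Lemma rderive_coord (j : 'I_n) z v : is_rderive z v (fun y => y 0 j) (v 0 j).
Proof.
move=> b.
have E : (fun t : R => part b (z 0 j) + part b (v 0 j) * t) =1 part_line b (fun y => y 0 j) z v.
  by move=> t; rewrite /part_line !mxE partD partZ mulrC.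
apply: is_derive_ext E _; apply/is_deriveP => e e0; exists 1 => // t _.
rewrite [X in `|X|](_ : _ = 0); last by ring.
by rewrite normr0 mulr_ge0// ltW.
Qed.

Lemma smooth_coord (j : 'I_n) : smooth_on U (fun y => y 0 j).
Proof.
case=> [|k]; (split; first by move=> z _; exact: coord_continuous).
  exact: I.
move=> i c _; split; first by move=> z _; have /is_rderiveP[] := rderive_coord j z (c *: basis_vec R i).
rewrite (_ : rderive _ _ = fun=> (c *: basis_vec R i) 0 j); first exact: Ck_cst.
by apply/funext => z; have /is_rderiveP[] := rderive_coord j z (c *: basis_vec R i).
Qed.

Lemma del_coord X (j : 'I_n) z : del X (fun y => y 0 j) z = X 0 j /\ delbar X (fun y => y 0 j) z = 0.
Proof.
have dc v y : rderive v (fun y => y 0 j) y = v 0 j.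
  by have /is_rderiveP[] := rderive_coord j y v.
rewrite delE delbarE; split.
  rewrite (bigD1 j)//= big1 ?addr0 => [|i ij].
    rewrite /dz !dc !mxE !eqxx mulr1 -expr2 sqrCi opprK.
    by rewrite (_ : 1 + 1 = 2)// mulVf ?mulr1// pnatr_eq0.
  by rewrite /dz !dc !mxE eqxx eq_sym (negbTE ij) !mulr0 subr0 !mulr0.
rewrite big1// => i _; rewrite /dzbar !dc !mxE eqxx; case: eqVneq => _.
  by rewrite mulr1 -expr2 sqrCi subrr !mulr0.
by rewrite !mulr0 addr0 !mulr0.
Qed.

Let uB j : 'rV[C]_r := u *m dz_mx j H z0 *m invmx (H z0).

Lemma flat_extE z a : flat_ext z 0 a = u 0 a + - \sum_j (z 0 j + - z0 0 j) * uB j 0 a.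
Proof. by rewrite !mxE summxE; congr (_ - _); apply: eq_bigr => j _; rewrite mxE. Qed.

Lemma msmooth_flat_ext : msmooth flat_ext.
Proof.
move=> i a; rewrite (ord1 i); under eq_fun do rewrite flat_extE.
apply: (smooth_add Uo); first exact: smooth_cst.
apply: (smooth_opp Uo); apply: (smooth_sum Uo) => j _; apply: (smooth_mul Uo); last exact: smooth_cst.
by apply: (smooth_add Uo); [exact: smooth_coord|exact: smooth_cst].
Qed.

Lemma wop_flat_ext al be z a : U z -> wop al be (fun y => flat_ext y 0 a) z =
  - \sum_j wop al be (fun y => y 0 j) z * uB j 0 a.
Proof.
move=> Uz.
have s1 j : smooth_on U (fun y => y 0 j + - z0 0 j).
  by apply: (smooth_add Uo); [exact: smooth_coord|exact: smooth_cst].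
have s2 j : smooth_on U (fun y => (y 0 j + - z0 0 j) * uB j 0 a).
  by apply: (smooth_mul Uo) => //; exact: smooth_cst.
have s3 : smooth_on U (fun y => \sum_j (y 0 j + - z0 0 j) * uB j 0 a).
  by apply: (smooth_sum Uo) => j _; exact: s2.
refine (etrans (wop_ext Uo _ _ Uz (fun y _ => flat_extE y a)) _).
refine (etrans (wop_add _ _ Uz (smooth_cst U _) (smooth_opp Uo s3)) _).
rewrite wop_cst add0r; refine (etrans (wop_opp Uo _ _ Uz s3) _).
congr (- _); refine (etrans (wop_sum Uo _ _ _ Uz s2) _); apply: eq_bigr => j _.
refine (etrans (wop_mul _ _ Uz (s1 j) (smooth_cst U _)) _).
rewrite wop_cst mulr0 add0r; refine (congr1 (fun c => c * uB j 0 a) _).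
refine (etrans (wop_add _ _ Uz (smooth_coord j) (smooth_cst U _)) _).
by rewrite wop_cst addr0.
Qed.

Lemma holomorphic_flat_ext a : holomorphic_on U (fun y => flat_ext y 0 a).
Proof.
split=> [|z Uz j]; first exact: msmooth_flat_ext.
rewrite dzbar_delbar; refine (etrans (wop_flat_ext _ _ _ Uz) _).
by rewrite big1 ?oppr0// => i _; rewrite [wop _ _ _ _](del_coord _ _ _).2 mul0r.
Qed.

Lemma mdel_flat_ext X z : U z ->
  mdel X flat_ext z = - (u *m mdel X H z0 *m invmx (H z0)) /\ mdelbar X flat_ext z = 0.
Proof.
move=> Uz; split; apply/rowP => a.
  rewrite mdelE; refine (etrans (wop_flat_ext _ _ _ Uz) _).
  rewrite [RHS]mxE mdel_sum mulmx_sumr mulmx_suml summxE; congr (- _); apply: eq_bigr => j _.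
  by rewrite [wop _ _ _ _](del_coord _ _ _).1 -scalemxAr -scalemxAl [RHS]mxE.
rewrite mdelbarE mxE; refine (etrans (wop_flat_ext _ _ _ Uz) _).
by rewrite big1 ?oppr0// => i _; rewrite [wop _ _ _ _](del_coord _ _ _).2 mul0r.
Qed.

(** The (1,0) derivative of the squared length vanishes at z0, so d dbar log reduces to the second
    derivative over the value. The linear part of the extension adds to the Hessian of H exactly the
    correction - (dH) H^-1 (dbar H) found in [curv_mx]. *)
Lemma loglap_flat_ext X : herm_pair (H z0) u u != 0 ->
  smooth_on U (fun z => herm_pair (H z) (flat_ext z) (flat_ext z)) /\
  loglap X (fun z => herm_pair (H z) (flat_ext z) (flat_ext z)) z0 =
  - herm_pair (H z0) (chern_curvature H z0 X X u) u / herm_pair (H z0) u u.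
Proof.
move=> N0.
pose b : 'rV[C]_r := - (u *m mdel X H z0 *m invmx (H z0)).
have sU := msmooth_flat_ext.
have sUc := msmooth_conj_tr sU.
have sUH := msmooth_mul sU Hs.
have sM := msmooth_mul sUH sUc.
pose M z := flat_ext z *m H z *m conj_tr (flat_ext z).
have sD : msmooth (mdel X H) by exact: msmooth_mwop.
have sUD := msmooth_mul sU sD.
have sbH := msmooth_mul (msmooth_cst b) Hs.
(* b is the derivative of the extension along X, and this says that its covariant derivative at z0
   is zero. *)
have bH : b *m H z0 = - (u *m mdel X H z0).
  by rewrite /b mulNmx -(mulmxA _ (invmx _)) mulVmx ?Hu// mulmx1.
(* The extension is holomorphic, so [mdel] does not see the conjugate factor. *)
have dM z : U z -> mdel X M z =
    (flat_ext z *m mdel X H z + b *m H z) *m conj_tr (flat_ext z).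
  move=> Uz; refine (etrans (mwop_mul _ _ Uz sUH sUc) _).
  rewrite -/(mdel X _) (mdel_conj_tr X Uz sU) (mdel_flat_ext X Uz).2.
  rewrite (_ : conj_tr 0 = 0) ?mulmx0 ?add0r; last first.
    by apply/matrixP => i j; rewrite !mxE conjC0.
  rewrite (mwop_mul _ _ Uz sU Hs) -/(mdel X flat_ext) (mdel_flat_ext X Uz).1.
  by [].
have dM0 : mdel X M z0 = 0 by rewrite dM// flat_ext0 bH subrr mul0mx.
have ddM : mdelbar X (mdel X M) z0 = u *m curv_mx X z0 *m conj_tr u.
  refine (etrans (mwop_ext _ _ Uz0 dM) _).
  have sS : msmooth (fun z => flat_ext z *m mdel X H z + b *m H z).
    move=> i j; under eq_fun do rewrite mxE.
    exact: (smooth_add Uo (sUD i j) (sbH i j)).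
  refine (etrans (mwop_mul _ _ Uz0 sS sUc) _).
  rewrite flat_ext0 bH subrr mul0mx add0r; congr (_ *m _).
  refine (etrans (mwop_add _ _ Uz0 sUD sbH) _).
  rewrite (mwop_mul _ _ Uz0 sU sD) (mwop_mul _ _ Uz0 (msmooth_cst b) Hs).
  rewrite -/(mdelbar X flat_ext) (mdel_flat_ext X Uz0).2 mul0mx addr0.
  rewrite -/(mdelbar X (fun=> b)) [mdelbar X (fun=> b) z0]mwop_cst mul0mx addr0 flat_ext0.
  by rewrite /curv_mx mulmxBr /b mulNmx !mulmxA.
split; first exact: sM.
have e1 : del X (fun z => herm_pair (H z) (flat_ext z) (flat_ext z)) z0 = 0.
  by have := mdelE X M z0 0 0; rewrite dM0 mxE => /esym.
have e2 : delbar X (del X (fun z => herm_pair (H z) (flat_ext z) (flat_ext z))) z0 =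
    - herm_pair (H z0) (chern_curvature H z0 X X u) u.
  rewrite /herm_pair chern_curvatureE// mulNmx mxE opprK -ddM mdelbarE.
  by apply: (wop_ext Uo) => // y Uy; rewrite mdelE.
rewrite /loglap e1 e2 mul0r subr0 flat_ext0.
move: N0; move: (herm_pair (H z0) u u) (herm_pair _ (chern_curvature _ _ _ _ _) _) => x y x0.
by field.
Qed.

End Chern.
End MatrixCalculus.

(** * Compactness *)

Section Continuity.
Variables (R : realType) (T : topologicalType).
Local Notation C := (Cplx R).
Implicit Types (f g : T -> C) (x : T).

Lemma cont_cst (c : C) x : {for x, continuous (fun _ : T => c)}.
Proof. exact: cst_continuous. Qed.

Lemma cont_add f g x : {for x, continuous f} -> {for x, continuous g} ->
  {for x, continuous (fun y => f y + g y)}.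
Proof. exact: continuousD. Qed.

Lemma cont_mul f g x : {for x, continuous f} -> {for x, continuous g} ->
  {for x, continuous (fun y => f y * g y)}.
Proof. exact: continuousM. Qed.

Lemma cont_opp f x : {for x, continuous f} -> {for x, continuous (fun y => - f y)}.
Proof. exact: continuousN. Qed.

Lemma cont_conj f x : {for x, continuous f} -> {for x, continuous (fun y => (f y)^*)}.
Proof. by move=> fc; apply: continuous_comp fc _; exact: conjC_continuous. Qed.

Lemma cont_norm f x : {for x, continuous f} -> {for x, continuous (fun y => `|f y| : C)}.
Proof. by move=> fc; apply: continuous_comp fc _; exact: (@norm_continuous C C). Qed.

Lemma Re_continuous : continuous (@complex.Re R : C -> R).
Proof. by have h := @part_continuous R true. Qed.

Lemma cont_Re f x : {for x, continuous f} ->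
  {for x, continuous (fun y => complex.Re (f y))}.
Proof. by move=> fc; apply: continuous_comp fc _; exact: Re_continuous. Qed.

Lemma cont_ext (V : topologicalType) (F G : T -> V) x : F =1 G -> {for x, continuous F} ->
  {for x, continuous G}.
Proof. by move=> /funext ->. Qed.

Lemma cont_sum (I : Type) (s : seq I) (F : I -> T -> C) x :
  (forall i, {for x, continuous (F i)}) ->
  {for x, continuous (fun y => \sum_(i <- s) F i y)}.
Proof.
move=> hF; elim: s => [|i s IH].
  apply: (@cont_ext C (fun=> 0)); last exact: cont_cst.
  by move=> y; rewrite big_nil.
by refine (cont_ext _ (cont_add (hF i) IH)) => y; rewrite big_cons.
Qed.

Lemma cont_prod (I : Type) (s : seq I) (F : I -> T -> C) x :
  (forall i, {for x, continuous (F i)}) ->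
  {for x, continuous (fun y => \prod_(i <- s) F i y)}.
Proof.
move=> hF; elim: s => [|i s IH].
  apply: (@cont_ext C (fun=> 1)); last exact: cont_cst.
  by move=> y; rewrite big_nil.
by refine (cont_ext _ (cont_mul (hF i) IH)) => y; rewrite big_cons.
Qed.

Lemma cont_exp f k x : {for x, continuous f} -> {for x, continuous (fun y => f y ^+ k)}.
Proof.
move=> hf; elim: k => [|k IH]; first exact: cont_cst.
by refine (cont_ext _ (cont_mul hf IH)) => y; rewrite exprS.
Qed.

Lemma near_eq_cont (V : topologicalType) (f g : T -> V) x : (\forall y \near x, f y = g y) -> {for x, continuous f} ->
  {for x, continuous g}.
Proof.
move=> fg; have fgx : f x = g x by exact: nbhs_singleton fg.
rewrite /prop_for/continuous_at fgx => fc.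
exact: cvg_trans (near_eq_cvg fg) fc.
Qed.

Lemma cont_within (V : topologicalType) (A : set T) (F : T -> V) :
  (forall x, A x -> {for x, continuous F}) -> {within A, continuous F}.
Proof. by move=> h; apply: continuous_in_subspaceT => x; rewrite inE => /h. Qed.

Lemma closed_preimage (V : topologicalType) (F : T -> V) (D : set V) :
  continuous F -> closed D -> closed (F @^-1` D).
Proof.
move=> Fc Dc; rewrite -[F @^-1` D]setCK; apply: open_closedC.
rewrite preimage_setC; apply: open_comp; last exact: closed_openC.
by move=> x _; exact: Fc.
Qed.

(** The finite union of the images is a compact set of reals; the extreme value theorem is applied
    to the identity on it. *)
Lemma compact_max (I : finType) (A : I -> set T) (F : I -> T -> R) :
  (forall i, compact (A i)) -> (forall i x, A i x -> {for x, continuous (F i)}) ->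
  (exists i x, A i x) ->
  exists i x, A i x /\ forall j y, A j y -> F j y <= F i x.
Proof.
move=> cA cF [i0 [x0 Ax0]].
have cV : compact (\big[setU/set0]_(i <- enum I) (F i @` A i)).
  apply: bigsetU_compact => i _; apply: continuous_compact (cA i).
  by apply: cont_within => x; exact: cF.
rewrite -bigcup_seq in cV.
have [||v] := compact_EVT_max (f := id) _ cV.
- by exists (F i0 x0), i0; [rewrite /= mem_enum|exists x0].
- by apply: continuous_subspaceT => y; exact: cvg_id.
rewrite inE => -[i _ [x Ax <-]] h; exists i, x; split => // j y Ay.
by apply: h; rewrite inE; exists j; [rewrite /= mem_enum|exists y].
Qed.

End Continuity.

(** * Squared norms and compact subsets of C^r *)

Section Compactness.
Variable R : realType.
Local Notation C := (Cplx R).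

(** The squared modulus as an element of R, whereas the norm of [C] takes its values in [C]. *)
Definition nsq (c : C) : R := complex.Re (c * c^*).

Lemma nsqE c : c * c^* = RtoC (nsq c).
Proof. by apply: ge0_RtoC; rewrite -normCK exprn_ge0. Qed.

Lemma nsq_ge0 c : 0 <= nsq c.
Proof. by rewrite -ler_RtoC -nsqE -normCK exprn_ge0. Qed.

Lemma nsq_parts c : nsq c = complex.Re c ^+ 2 + complex.Im c ^+ 2.
Proof. by rewrite /nsq Defs.ReM cRe_conj cIm_conj; ring. Qed.

Lemma nsqM c d : nsq (c * d) = nsq c * nsq d.
Proof. by rewrite !nsq_parts Defs.ReM Defs.ImM; ring. Qed.

Lemma nsq_eq0 c : (nsq c == 0) = (c == 0).
Proof.
apply/eqP/eqP => [h|->]; last by rewrite /nsq mul0r.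
by apply/eqP; rewrite -normr_eq0 -sqrf_eq0 normCK nsqE h.
Qed.

Lemma nsq_RtoC (t : R) : nsq (RtoC t) = t ^+ 2.
Proof. by rewrite nsq_parts/= expr0n addr0. Qed.

Lemma nsq_lt c (e : R) : 0 < e -> (nsq c < e ^+ 2) = (`|c| < RtoC e).
Proof.
move=> e0; rewrite -ltr_RtoC -nsqE -normCK rmorphXn/=.
have re0 : 0 <= RtoC e by have := ltW e0; rewrite -ler_RtoC.
by rewrite ltr_pXn2r// nnegrE ?normr_ge0.
Qed.

Lemma nsq_le c (e : R) : 0 <= e -> (nsq c <= e ^+ 2) = (`|c| <= RtoC e).
Proof.
move=> e0; rewrite -ler_RtoC -nsqE -normCK rmorphXn/=.
have re0 : 0 <= RtoC e by have := e0; rewrite -ler_RtoC.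
by rewrite ler_pXn2r// nnegrE ?normr_ge0.
Qed.

Lemma cont_nsq (T : topologicalType) (f : T -> C) (x : T) : {for x, continuous f} ->
  {for x, continuous (fun y => nsq (f y))}.
Proof. by move=> fc; exact: (cont_Re (cont_mul fc (cont_conj fc))). Qed.

(** The square of the Euclidean norm: unlike the maximum norm of the library it is smooth, as the
    weights require. *)
Definition snorm r (v : 'rV[C]_r) : R := \sum_j nsq (v 0 j).

Lemma snorm_ge0 r (v : 'rV[C]_r) : 0 <= snorm v.
Proof. by apply: sumr_ge0 => j _; exact: nsq_ge0. Qed.

Lemma le_snorm r (v : 'rV[C]_r) j : nsq (v 0 j) <= snorm v.
Proof.
by rewrite /snorm (bigD1 j)//= lerDl; apply: sumr_ge0 => i _; exact: nsq_ge0.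
Qed.

Lemma snorm_eq0 r (v : 'rV[C]_r) : snorm v = 0 -> v = 0.
Proof.
move=> h; apply/rowP => j; rewrite mxE; apply/eqP; rewrite -nsq_eq0.
by rewrite eq_le nsq_ge0 andbT -h le_snorm.
Qed.

Lemma snormZ r c (v : 'rV[C]_r) : snorm (c *: v) = nsq c * snorm v.
Proof. by rewrite /snorm mulr_sumr; apply: eq_bigr => j _; rewrite mxE nsqM. Qed.

Lemma sumR_cont (T : topologicalType) (I : Type) (s : seq I) (F : I -> T -> R) x :
  (forall i, {for x, continuous (F i)}) ->
  {for x, continuous (fun y => \sum_(i <- s) F i y)}.
Proof.
move=> hF; elim: s => [|i s IH].
  apply: (@cont_ext _ R (fun=> 0)); last exact: cst_continuous.
  by move=> y; rewrite big_nil.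
by refine (cont_ext _ (continuousD (hF i) IH)) => y; rewrite big_cons.
Qed.

Lemma snorm_continuous r (c : 'rV[C]_r) : continuous (fun v : 'rV[C]_r => snorm (v - c)).
Proof.
move=> v; apply: sumR_cont => j; apply: cont_nsq.
have h : {for v, continuous (fun w : 'rV[C]_r => w 0 j + - c 0 j)}.
  by apply: cont_add; [exact: coord_continuous|exact: cont_cst].
by refine (cont_ext _ h) => y; rewrite !mxE.
Qed.

Lemma square_compact (B : R) : compact [set c : C | `|complex.Re c| <= B /\ `|complex.Im c| <= B].
Proof.
pose F (p : R * R) : C := RtoC p.1 + RtoC p.2 * 'i.
have c1 (p : R * R) : {for p, continuous (fun q : R * R => RtoC q.1)}.
  by apply: continuous_comp; [exact: cvg_fst|exact: RtoC_continuous].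
have c2 (p : R * R) : {for p, continuous (fun q : R * R => RtoC q.2)}.
  by apply: continuous_comp; [exact: cvg_snd|exact: RtoC_continuous].
have Fc : continuous F.
  move=> p.
  have h1 := @cont_cst R _ 'i p.
  have h2 := cont_mul (c2 p) h1.
  have h3 := cont_add (c1 p) h2.
  exact: h3.
have -> : [set c : C | `|complex.Re c| <= B /\ `|complex.Im c| <= B] =
    F @` (`[- B, B] `*` `[- B, B]).
  apply/seteqP; split => [c [h1 h2]|_ [[a b] [/= h1 h2] <-]].
    exists (complex.Re c, complex.Im c); last by rewrite /F -Cparts.
    by split; rewrite /= in_itv/= -ler_norml.
  have e : F (a, b) = Complex a b by rewrite [RHS]Cparts.
  by rewrite e; move: h1 h2; rewrite /= !in_itv/= -!ler_norml.
apply: continuous_compact; first by apply: cont_within => p _; exact: Fc.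
by apply: compact_setX; exact: segment_compact.
Qed.

Lemma closed_bounded_compact r (A : set 'rV[C]_r) (B : R) : closed A ->
  (forall v, A v -> forall j, nsq (v 0 j) <= B) -> compact A.
Proof.
move=> Acl hA.
have := @rV_compact _ r (fun=> [set c : C | `|complex.Re c| <= B + 1 /\ `|complex.Im c| <= B + 1])
  (fun=> @square_compact (B + 1)).
move=> /(subclosed_compact Acl); apply => v Av j /=.
have := hA v Av j; rewrite nsq_parts; move: (complex.Re _) (complex.Im _) => a b h.
(* The bound B + 1 replaces a square root of B. *)
have sq (t : R) : t ^+ 2 <= B -> `|t| <= B + 1.
  move=> tB; rewrite ler_norml; apply/andP; split; nra.
by split; apply: sq; apply: le_trans h; rewrite ?lerDl ?lerDr sqr_ge0.
Qed.

Lemma ball_compact r (c : 'rV[C]_r) (B : R) : compact [set v | snorm (v - c) <= B].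
Proof.
have : compact ((fun v : 'rV[C]_r => snorm (v - 0)) @^-1` [set t | t <= B]).
  apply: (@closed_bounded_compact _ _ B).
    by apply: closed_preimage; [exact: snorm_continuous|exact: closed_le].
  by move=> v /=; rewrite subr0 => h j; apply: le_trans h; exact: le_snorm.
have sc : continuous (fun v : 'rV[C]_r => v + c).
  by move=> v; apply: continuousD; [exact: cvg_id|exact: cst_continuous].
move=> /(continuous_compact (cont_within (fun x _ => sc x))).
congr compact; apply/seteqP; split => [_ [v /= h <-]|v /= h] /=.
  by rewrite addrK -(subr0 v).
by exists (v - c); rewrite /= ?subr0// subrK.
Qed.

Definition sphere r : set 'rV[C]_r := [set v | snorm v = 1].

Lemma sphere_compact r : compact (@sphere r).
Proof.
have : compact ((fun v : 'rV[C]_r => snorm (v - 0)) @^-1` [set t | t = 1]).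
  apply: (@closed_bounded_compact _ _ 1).
    by apply: closed_preimage; [exact: snorm_continuous|exact: closed_eq].
  by move=> v /=; rewrite subr0 => h j; rewrite -h; exact: le_snorm.
by congr compact; apply/seteqP; split => v; rewrite /sphere/= subr0.
Qed.

Lemma sphereP r (v : 'rV[C]_r) : v != 0 ->
  exists c v', [/\ c != 0, sphere v' & v = c *: v'].
Proof.
move=> v0.
have s0 : 0 < snorm v.
  by rewrite lt0r snorm_ge0 andbT; apply: contra v0 => /eqP/snorm_eq0/eqP.
pose t := Num.sqrt (snorm v).
have t0 : 0 < t by rewrite sqrtr_gt0.
have t2 : t ^+ 2 = snorm v by rewrite sqr_sqrtr// ltW.
have tC : RtoC t != 0 by rewrite -(rmorph0 (@RtoC R)) (inj_eq (fmorph_inj _)) gt_eqF.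
exists (RtoC t), (RtoC t^-1 *: v); split=> //.
  by rewrite /sphere/= snormZ nsq_RtoC -t2 exprVn mulVf// sqrf_eq0 gt_eqF.
by rewrite scalerA -rmorphM/= divff ?gt_eqF// rmorph1 scale1r.
Qed.

Lemma sphere_neq0 r (v : 'rV[C]_r) : sphere v -> v != 0.
Proof.
rewrite /sphere/= => h; apply/eqP => v0; move: h; rewrite v0 /snorm big1.
  by move=> /esym/eqP; rewrite oner_eq0.
by move=> j _; rewrite mxE /nsq mul0r.
Qed.

End Compactness.

(** * Weighted frame covers *)

Section WeightedCovers.
Variables (R : realType) (n : nat) (M : complex_manifold R n).
Local Notation C := (Cplx R).
Implicit Types (x y : M) (W K : set M).

Lemma smooth_fun_continuous W (f : M -> C) x : open W -> W x -> smooth_fun W f ->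
  {for x, continuous f}.
Proof.
move=> Wo Wx fs; have [a ax] := chart_cover x.
have Ux : in_chart a W (Defs.coord (chart_at a) x).
  by split; [exact: coord_target|rewrite coordK].
have c1 : {for Defs.coord (chart_at a) x, continuous (f \o param (chart_at a))}.
  exact: (smooth_continuous Ux (fs a)).
have c2 := continuous_comp (Defs.coord_continuous ax) c1.
apply: near_eq_cont c2.
have := open_nbhs_nbhs (conj (source_open (chart_at a)) ax).
by apply: filterS => y ay /=; rewrite coordK.
Qed.

(** The closed ball of radius 2 rho has to fit. Taking rho = e / 4 makes its squared radius e^2 / 4,
    and the Euclidean norm dominates the maximum norm that defines the topology; e lives in [C] and
    is read through its real part. *)
Lemma ball_in_open (U : set 'rV[C]_n) c : open U -> U c ->
  exists2 rho : R, 0 < rho & forall z, snorm (z - c) <= 4 * rho ^+ 2 -> U z.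
Proof.
move=> Uo Uc; have /nbhs_ballP[e /= e0 He] := open_nbhs_nbhs (conj Uo Uc).
have er0 := gt0_Re e0; exists (complex.Re e / 4); first by rewrite divr_gt0.
move=> z hz; apply: He; split => // i j.
rewrite (ord1 i) /ball/= distrC (ge0_RtoC (ltW e0)) -nsq_lt//.
have := le_trans (le_snorm (z - c) j) hz; rewrite !mxE => /le_lt_trans; apply.
by move: er0; move: (complex.Re e) => t t0; nra.
Qed.

(** The near-covering form of compactness is applied to the filter of properties of lists that hold
    for every list containing some fixed one. *)
Lemma compact_finite_cover (T : topologicalType) (V : T -> set T) :
  compact [set: T] -> (forall t, open (V t)) -> (forall t, V t t) ->
  exists D : seq T, forall t, exists2 s, s \in D & V s t.
Proof.
move=> /compact_near_coveringP cT Vo Vx.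
pose F (A : set (seq T)) := exists D0 : seq T, forall D, {subset D0 <= D} -> A D.
have FF : Filter F.
  split.
  - by exists [::].
  - move=> A B [D1 h1] [D2 h2]; exists (D1 ++ D2) => D hD.
    by split; [apply: h1|apply: h2] => t tD; apply: hD; rewrite mem_cat tD ?orbT.
  - by move=> A B AB [D0 h0]; exists D0 => D /h0/AB.
have [|D0 hD] := cT _ F (fun D t => exists2 s, s \in D & V s t) FF.
  move=> t _; exists (V t, [set D : seq T | t \in D]) => /=.
    split; first exact: open_nbhs_nbhs (conj (Vo t) (Vx t)).
    by exists [:: t] => D; apply; rewrite inE.
  by move=> [s D] [/= Vs tD]; exists t.
by exists D0 => t; exact: (hD D0 (fun _ h => h) t I).
Qed.

(** Sections are rows acted on from the right, so column sums control the maximum norm of the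
    components. Such bounds multiply under tensor products. *)
Definition colbd p q (k : R) (A : 'M[C]_(p, q)) : Prop :=
  forall b, \sum_a `|A a b| <= RtoC k.

Lemma compact_bound (T : topologicalType) (K : set T) (f : T -> R) :
  compact K ->
  (forall x : T, K x -> {for x, continuous f}) ->
  exists2 b : R, 0 <= b & forall x : T, K x -> f x <= b.
Proof.
move=> cK cf; have [[x0 Kx0]|noK] := pselect (exists x : T, K x); last first.
  by exists 0 => // x Kx; exfalso; apply: noK; exists x.
have [||c _ h] := compact_EVT_max (A := K) (f := f) _ cK.
- by exists x0.
- exact: cont_within.
exists (Num.max 0 (f c)); first by rewrite le_max lexx.
by move=> x Kx; rewrite le_max h ?orbT// inE.
Qed.

(** The sum of the moduli of all entries is continuous in x and dominates every column sum. *)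
Lemma transition_bound (G : hol_bundle M) (i j : triv_ix G) K : compact K ->
  K `<=` trivial i `&` trivial j ->
  exists2 k : R, 0 <= k & forall x, K x -> colbd k (transition i j x).
Proof.
move=> cK Kij.
pose f x : R := complex.Re (\sum_a \sum_b `|transition i j x a b|).
have fc x : K x -> {for x, continuous f}.
  move=> Kx; apply: cont_Re; apply: cont_sum => a; apply: cont_sum => b; apply: cont_norm.
  have To : open (trivial i `&` trivial j) by apply: openI; exact: trivial_open.
  exact: (smooth_fun_continuous To (Kij x Kx) (fun c => (transition_hol i j a b c).1)).
have [k k0 hk] := compact_bound cK fc; exists k => // x Kx b.
have S0 : 0 <= \sum_a \sum_b `|transition i j x a b|.
  by apply: sumr_ge0 => a _; exact: sumr_ge0.
apply: (@le_trans _ _ (\sum_a \sum_b `|transition i j x a b|)).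
  by apply: ler_sum => a _; rewrite (bigD1 b)//= lerDl; exact: sumr_ge0.
by rewrite (ge0_RtoC S0) ler_RtoC; exact: hk.
Qed.

Lemma colbd1 p : colbd 1 (1%:M : 'M[C]_p).
Proof.
move=> b; rewrite (bigD1 b)//= big1 ?addr0 => [|a ab].
  by rewrite mxE eqxx normr1.
by rewrite mxE (negbTE ab) normr0.
Qed.

(* The weights om replace a metric on G: if s is a section and x lies in K t,
   then the bound |s| <= om t for its components in the frame iG t follows from
   the same bound in a frame t' such that x is interior to K t'. *)
Record wcover (G : hol_bundle M) (T : finType) (iG : T -> triv_ix G)
    (W K O : T -> set M) (om : T -> M -> C) : Prop := WCover {
  wc_W_open : forall t, open (W t);
  wc_W_trivial : forall t, W t `<=` trivial (iG t);
  wc_K_compact : forall t, compact (K t);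
  wc_KW : forall t, K t `<=` W t;
  wc_O_open : forall t, open (O t);
  wc_OK : forall t, O t `<=` K t;
  wc_cover : forall x, exists t, O t x;
  wc_om_ge1 : forall t x, W t x -> 1 <= om t x;
  wc_om_smooth : forall t, smooth_fun (W t) (om t);
  wc_exchange : forall t x, K t x -> exists t' (k : R),
    [/\ O t' x, 0 <= k, colbd k (transition (iG t') (iG t) x) &
        RtoC k ^+ 2 * om t' x <= om t x] }.

(* In wcover_exists, K t is where the gauge is at most 5 and the sets where it
   is below 2 cover M; passing from a boundary point of K t to such a set gains a
   factor (5/2)^L, which beats the transition matrices for L large. *)
Lemma exp_unbounded (b : R) : exists L, b <= (5 / 2) ^+ L.
Proof.
have h L : L%:R <= (5 / 2 : R) ^+ L.
  elim: L => [|L IH]; first by rewrite expr0 ler01.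
  rewrite exprS -natr1.
  have : 1 <= (5 / 2 : R) ^+ L by apply: exprn_ege1; lra.
  by move: IH; move: (_ ^+ L) => t; lra.
exists (Num.bound `|b|); apply: le_trans (h _).
by apply: le_trans (ler_norm b) _; apply/ltW; exact: archi_boundP.
Qed.

(** * The quadratic gauge around the center of a chart *)

Section Gauge.
Variables (a : chart_ix M) (c : 'rV[C]_n) (rho : R).
Hypothesis rho0 : 0 < rho.

Definition gauge x : R := 1 + (rho ^+ 2)^-1 * snorm (Defs.coord (chart_at a) x - c).

(** The gauge as a function into [C] built from sums, products and conjugates, to which the
    smoothness rules apply. *)
Definition gaugeC x : C := 1 + RtoC (rho ^+ 2)^-1 *
  \sum_l (Defs.coord (chart_at a) x 0 l + - c 0 l) * (Defs.coord (chart_at a) x 0 l + - c 0 l)^*.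

Lemma gaugeCE x : gaugeC x = RtoC (gauge x).
Proof.
rewrite /gauge rmorphD rmorph1 rmorphM/= /snorm rmorph_sum/=; congr (1 + _ * _).
by apply: eq_bigr => l _; rewrite nsqE !mxE.
Qed.

Lemma gauge_ge1 x : 1 <= gauge x.
Proof. by rewrite lerDl mulr_ge0 ?snorm_ge0// invr_ge0 sqr_ge0. Qed.

Lemma gauge_le x (b : R) : (gauge x <= 1 + b) = (snorm (Defs.coord (chart_at a) x - c) <= b * rho ^+ 2).
Proof. by rewrite /gauge lerD2l mulrC ler_pdivrMr// exprn_gt0. Qed.

Lemma gauge_smooth : smooth_fun (source (chart_at a)) gaugeC.
Proof.
move=> b; have Uo := @in_chart_open _ _ M b _ (source_open (chart_at a)).
have hl l : smooth_on (in_chart b (source (chart_at a)))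
    (fun z => Defs.coord (chart_at a) (param (chart_at b) z) 0 l + - c 0 l).
  by apply: (smooth_add Uo); [exact: (chart_compat b a l).1|exact: smooth_cst].
apply: (smooth_add Uo); first exact: smooth_cst.
apply: (smooth_mul Uo); first exact: smooth_cst.
apply: (smooth_sum Uo) => l _; apply: (smooth_mul Uo) => //.
exact: (smooth_conj Uo).
Qed.

Lemma gauge_continuous x : source (chart_at a) x -> {for x, continuous gauge}.
Proof.
move=> ax; have h := smooth_fun_continuous (source_open _) ax gauge_smooth.
by refine (cont_ext _ (cont_Re h)) => y; rewrite gaugeCE.
Qed.

Lemma gauge_open b : open [set x | source (chart_at a) x /\ gauge x < b].
Proof.
rewrite openE => x [ax xb]; apply: filterI.
  by apply: open_nbhs_nbhs; split => //; exact: source_open.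
have gc := gauge_continuous ax.
exact: (gc [set t | t < b] (open_nbhs_nbhs (conj (@open_lt _ b) xb))).
Qed.

End Gauge.

(** The sets Q x carry the local data that the pieces must respect: for E a chart and directions of
    positivity, for F just the domain of the frame. *)
Lemma wcover_exists (G : hol_bundle M) (i : M -> triv_ix G) (Q : M -> set M) :
  compact [set: M] -> (forall x, open (Q x)) -> (forall x, Q x x) ->
  (forall x, Q x `<=` trivial (i x)) ->
  exists (T : finType) (pt : T -> M) (W K O : T -> set M) (om : T -> M -> C),
    wcover (fun t => i (pt t)) W K O om /\ forall t, W t `<=` Q (pt t).
Proof.
move=> Mc Qo Qx Qi.
have [a ha] := choice (@chart_cover _ _ M).
pose c x := Defs.coord (chart_at (a x)) x.
pose W x := Q x `&` source (chart_at (a x)).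
have Wo x : open (W x) by apply: openI => //; exact: source_open.
have hU x : in_chart (a x) (W x) (c x).
  by split; [exact: coord_target|rewrite coordK; [split|]].
have hrho x : exists rho : R, 0 < rho /\
    forall z, snorm (z - c x) <= 4 * rho ^+ 2 -> in_chart (a x) (W x) z.
  have [rho r0 h] := ball_in_open (@in_chart_open _ _ M (a x) _ (Wo x)) (hU x).
  by exists rho.
have [rho /all_and2[rho0 rhoU]] := choice hrho.
pose g x := gauge (a x) (c x) (rho x).
(* As the image of a ball under [param] this is compact; [Kg] and [gK] relate it to the gauge. *)
pose K x := param (chart_at (a x)) @` [set z | snorm (z - c x) <= 4 * rho x ^+ 2].
pose O x := [set y | source (chart_at (a x)) y /\ g x y < 5].
pose V x := [set y | source (chart_at (a x)) y /\ g x y < 2].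
have KW x : K x `<=` W x by move=> _ [z /= hz <-]; have [] := rhoU x z hz.
have cK x : compact (K x).
  apply: continuous_compact (@ball_compact _ _ _ _).
  by apply: cont_within => z /= /rhoU[tz _]; exact: param_continuous.
have Kg x y : source (chart_at (a x)) y -> g x y <= 5 -> K x y.
  move=> ay; rewrite [5](_ : _ = 1 + 4); last by ring.
  by rewrite gauge_le// => h; exists (Defs.coord (chart_at (a x)) y) => //; exact: coordK.
have gK x y : K x y -> g x y <= 5.
  move=> [z /= hz <-]; rewrite [5](_ : _ = 1 + 4); last by ring.
  rewrite gauge_le// paramK//.
  by have [] := rhoU x z hz.
have OK x : O x `<=` K x by move=> y [ay /ltW]; exact: Kg.
have VO x : V x `<=` O x by move=> y [ay h]; split => //; apply: lt_trans h _; lra.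
have Vx x : V x x.
  by split => //; rewrite /g /gauge subrr /snorm big1 ?mulr0; [lra|move=> j _; rewrite mxE /nsq mul0r].
have Vo x : open (V x) by exact: gauge_open.
have [D Dcov] := compact_finite_cover Mc Vo Vx.
pose pt (t : seq_sub D) : M := val t.
have hk (t : seq_sub D * seq_sub D) : exists k : R, 0 <= k /\ forall x, K (pt t.1) x -> K (pt t.2) x ->
    colbd k (transition (i (pt t.2)) (i (pt t.1)) x).
  have [||k k0 h] := @transition_bound G (i (pt t.2)) (i (pt t.1)) (K (pt t.1) `&` K (pt t.2)).
  - apply: compact_closedI => //; apply: compact_closed => //; exact: carrier_hausdorff.
  - by move=> x [/KW[/Qi h1 _] /KW[/Qi h2 _]].
  by exists k; split => // x h1 h2; apply: h.
have [k /all_and2[k0 kb]] := choice hk.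
(* A single constant for all pairs of frames, so that one exponent L serves everywhere. *)
pose kk := \sum_t k t.
have kle t : k t <= kk by rewrite /kk (bigD1 t)//= lerDl; exact: sumr_ge0.
have kk0 : 0 <= kk by exact: sumr_ge0.
(* The square is the one carried by k in [wc_exchange]. *)
have [L hL] := exp_unbounded (kk ^+ 2).
exists (seq_sub D), pt, (fun t => W (pt t)), (fun t => K (pt t)), (fun t => O (pt t)),
  (fun t x => gaugeC (a (pt t)) (c (pt t)) (rho (pt t)) x ^+ L).
split; last by move=> t x [].
split => //.
- by move=> t x [/Qi].
- by move=> t; exact: gauge_open.
- move=> x; have [y yD Vy] := Dcov x.
  by exists (SeqSub yD); exact: VO.
- move=> t x _; rewrite gaugeCE -rmorphXn -(rmorph1 (@RtoC R)) ler_RtoC/=.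
  by apply: exprn_ege1; exact: gauge_ge1.
- move=> t b; apply: (smooth_exp (@in_chart_open _ _ M b _ (Wo _))) => l.
  have gs := @gauge_smooth (a (pt t)) (c (pt t)) (rho (pt t)).
  apply: Ck_sub (gs b l) => z [tz []].
  by move=> _ sz; split.
(* Below 5 the point is already interior and the frame is exchanged with itself, at cost 1. *)
move=> t x Kx; have [g5|g5] := ltP (g (pt t) x) 5.
  exists t, 1; rewrite rmorph1 expr1n mul1r; split => //.
    by split => //; have [] := KW _ _ Kx.
  rewrite transition_id; first exact: colbd1.
  by have [/Qi] := KW _ _ Kx.
have [y yD Vy] := Dcov x.
pose t' : seq_sub D := SeqSub yD.
exists t', kk; split => //.
- exact: VO.
- move=> b; have := kb (t, t') x Kx (OK _ _ (VO _ _ Vy)) b => /le_trans; apply.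
  by rewrite ler_RtoC.
rewrite !gaugeCE -!rmorphXn/= -rmorphM ler_RtoC/=.
have [_ g2] := Vy.
(* With g' < 2 the gauge of the new frame and g >= 5 that of the old one, kk^2 g'^L <= (5/2)^L 2^L =
   5^L <= g^L. *)
apply: (@le_trans _ _ (5 ^+ L)); last first.
  by rewrite lerXn2r// nnegrE ?(le_trans _ (gauge_ge1 _ _ _ _)) ?ler0n ?ler01.
apply: (@le_trans _ _ ((5 / 2) ^+ L * 2 ^+ L)); last by rewrite -exprMn divfK.
apply: ler_pM => //; first exact: sqr_ge0.
  by apply: exprn_ge0; apply: le_trans (gauge_ge1 _ _ _ _).
by rewrite lerXn2r// ?nnegrE ?(le_trans _ (gauge_ge1 _ _ _ _))// ltW.
Qed.

End WeightedCovers.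

(** * Uniform curvature bounds *)

Section CurvaturePositivity.
Variables (R : realType) (n : nat) (M : complex_manifold R n) (E : hol_bundle M).
Variable h : triv_ix E -> M -> 'M[Cplx R]_(rank E).
Hypothesis hm : bundle_metric h.
Local Notation C := (Cplx R).
Local Notation r := (rank E).
Implicit Types (x y : M) (u v : 'rV[C]_r).

Lemma herm_pairZ p (A : 'M[C]_p) c (u : 'rV[C]_p) :
  herm_pair A (c *: u) (c *: u) = RtoC (nsq c) * herm_pair A u u.
Proof.
rewrite /herm_pair (_ : conj_tr (c *: u) = c^* *: conj_tr u); last first.
  by apply/matrixP => a b; rewrite !mxE rmorphM.
by rewrite -!scalemxAl -scalemxAr scalerA mxE nsqE.
Qed.

Lemma herm_pairE p (A : 'M[C]_p) (u v : 'rV[C]_p) :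
  herm_pair A u v = \sum_b \sum_a u 0 a * A a b * (v 0 b)^*.
Proof.
rewrite /herm_pair mxE; apply: eq_bigr => b _; rewrite !mxE mulr_suml.
by apply: eq_bigr => a _.
Qed.

(** A nonzero row killed by the Gram matrix would have length zero. *)
Lemma metric_unit i x : trivial i x -> h i x \in unitmx.
Proof.
move=> ix; rewrite -row_free_unit -kermx_eq0; apply/rowV0P => v /sub_kermxP vk.
apply: contraTeq isT => v0; have := metric_pos hm ix v0.
by rewrite /herm_pair vk mul0mx mxE ltxx.
Qed.

Section Local.
Variables (a : chart_ix M) (i : triv_ix E).

Let U := in_chart a (trivial i).
Let Uo : open U. Proof. by apply: in_chart_open; exact: trivial_open. Qed.
Let H := h i \o param (chart_at a).

Lemma local_metric_smooth : msmooth U H.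
Proof. by move=> b c; exact: (metric_smooth hm i b c a). Qed.

Lemma local_metric_unit z : U z -> H z \in unitmx.
Proof. by move=> [_ /metric_unit]. Qed.

Lemma in_chart_coord x : source (chart_at a) x -> trivial i x -> U (Defs.coord (chart_at a) x).
Proof. by move=> ax ix; split; [exact: coord_target|rewrite coordK]. Qed.

Lemma curvature_formE x X u : source (chart_at a) x -> trivial i x ->
  curvature_form h a i x X X u u = - herm_pair (curv_mx H X (Defs.coord (chart_at a) x)) u u.
Proof.
move=> ax ix; have Uz := in_chart_coord ax ix.
rewrite /curvature_form {1}/herm_pair.
have -> : h i x = H (Defs.coord (chart_at a) x) by rewrite /H /= coordK.
by rewrite (chern_curvatureE Uo local_metric_smooth local_metric_unit X u Uz) mulNmx mxE.
Qed.

Lemma curv_mx_smooth X : msmooth U (curv_mx H X).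
Proof.
have s1 : msmooth U (mdel X H) by apply: msmooth_mwop => //; exact: local_metric_smooth.
have s2 : msmooth U (mdelbar X (mdel X H)) by exact: msmooth_mwop.
have s3 : msmooth U (mdelbar X H) by apply: msmooth_mwop => //; exact: local_metric_smooth.
have s4 := msmooth_inv Uo local_metric_smooth local_metric_unit.
have s5 := msmooth_mul Uo (msmooth_mul Uo s1 s4) s3.
move=> b c; apply: (smooth_ext Uo _ (smooth_add Uo (s2 b c) (smooth_opp Uo (s5 b c)))).
by move=> z _; rewrite /curv_mx !mxE.
Qed.

Lemma cont_form (A : M -> 'M[C]_r) x u :
  (forall b c, {for x, continuous (fun y => A y b c)}) ->
  {for (x, u), continuous (fun p : M * 'rV[C]_r => herm_pair (A p.1) p.2 p.2)}.
Proof.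
move=> hA.
have cu b : {for (x, u), continuous (fun p : M * 'rV[C]_r => p.2 0 b)}.
  have c2 : {for (x, u), continuous (snd : M * 'rV[C]_r -> 'rV[C]_r)} by exact: cvg_snd.
  have c3 : {for u, continuous (fun v : 'rV[C]_r => v 0 b)} by exact: coord_continuous.
  exact: (continuous_comp c2 c3).
have cA b c : {for (x, u), continuous (fun p : M * 'rV[C]_r => A p.1 b c)}.
  have c1 : {for (x, u), continuous (fst : M * 'rV[C]_r -> M)} by exact: cvg_fst.
  exact: (continuous_comp c1 (hA b c)).
have h2 : {for (x, u), continuous (fun p : M * 'rV[C]_r =>
    \sum_b \sum_a p.2 0 a * A p.1 a b * (p.2 0 b)^*)}.
  apply: cont_sum => c; apply: cont_sum => b.
  exact: (cont_mul (cont_mul (cu b) (cA b c)) (cont_conj (cu c))).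
by refine (cont_ext _ h2) => p; rewrite herm_pairE.
Qed.

Lemma metric_continuous x u : trivial i x ->
  {for (x, u), continuous (fun p : M * 'rV[C]_r => complex.Re (herm_pair (h i p.1) p.2 p.2))}.
Proof.
move=> ix; apply: cont_Re; apply: (@cont_form (h i)) => b c.
exact: (smooth_fun_continuous (trivial_open i) ix (metric_smooth hm i b c)).
Qed.

(** The curvature traced over e, as a real quadratic form in u. The coordinates of e are fixed while
    x moves, so unitarity of e is tied to the point where it was chosen. *)
Definition ricci (k : nat) (e : k.-tuple 'rV[C]_n) x u : R :=
  complex.Re (\sum_(t < k) curvature_form h a i x (tnth e t) (tnth e t) u u).

Lemma ricci_continuous k (e : k.-tuple 'rV[C]_n) x u :
  source (chart_at a) x -> trivial i x ->
  {for (x, u), continuous (fun p : M * 'rV[C]_r => ricci e p.1 p.2)}.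
Proof.
move=> ax ix.
have cA t b c : {for x, continuous
    (fun y => curv_mx H (tnth e t) (Defs.coord (chart_at a) y) b c)}.
  have c1 := smooth_continuous (in_chart_coord ax ix) (@curv_mx_smooth (tnth e t) b c).
  exact: (continuous_comp (Defs.coord_continuous ax) c1).
have cF t := @cont_form (fun y => curv_mx H (tnth e t) (Defs.coord (chart_at a) y)) x u (cA t).
have cS : {for (x, u), continuous (fun p : M * 'rV[C]_r =>
    complex.Re (\sum_(t < k) - herm_pair (curv_mx H (tnth e t) (Defs.coord (chart_at a) p.1)) p.2 p.2))}.
  by apply: cont_Re; apply: cont_sum => t; exact: (cont_opp (cF t)).
(* The closed formula holds over the chart and frame domains only, so the two functions agree just
   near x. *)
apply: near_eq_cont cS.
have Wo : nbhs x (source (chart_at a) `&` trivial i).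
  apply: open_nbhs_nbhs; split; last by [].
  by apply: openI; [exact: source_open|exact: trivial_open].
have c1 : {for (x, u), continuous (fst : M * 'rV[C]_r -> M)} by exact: cvg_fst.
have cW : nbhs (x, u) (fst @^-1` (source (chart_at a) `&` trivial i)) by exact: (c1 _ Wo).
apply: (filterS _ cW) => -[y v] [/= ay iy]; rewrite /ricci.
by congr (complex.Re _); apply: eq_bigr => t _; rewrite curvature_formE.
Qed.

Lemma ricciZ k (e : k.-tuple 'rV[C]_n) x c u : source (chart_at a) x -> trivial i x ->
  ricci e x (c *: u) = nsq c * ricci e x u.
Proof.
move=> ax ix; rewrite /ricci.
have -> : \sum_(t < k) curvature_form h a i x (tnth e t) (tnth e t) (c *: u) (c *: u) =
    RtoC (nsq c) * \sum_(t < k) curvature_form h a i x (tnth e t) (tnth e t) u u.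
  rewrite mulr_sumr; apply: eq_bigr => t _.
  by rewrite !curvature_formE// herm_pairZ mulrN.
exact: (partZ true).
Qed.

(** Both sides are quadratic in u, so unit vectors suffice; on the compact product of K with the
    sphere the quotient of the metric by [ricci] is continuous, hence bounded by some b. The
    constant is 1 / (b + 1), positive also for b = 0. *)
Lemma ricci_lower_bound k (e : k.-tuple 'rV[C]_n) (K : set M) : compact K ->
  K `<=` source (chart_at a) -> K `<=` trivial i ->
  (forall x u, K x -> sphere u -> 0 < ricci e x u) ->
  exists2 lam : R, 0 < lam & forall x u, K x ->
    lam * complex.Re (herm_pair (h i x) u u) <= ricci e x u.
Proof.
move=> cK Ka Ki pos.
have [b b0 hb] : exists2 b : R, 0 <= b & forall p : M * 'rV[C]_r, (K `*` @sphere R r) p ->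
    complex.Re (herm_pair (h i p.1) p.2 p.2) * (ricci e p.1 p.2)^-1 <= b.
  apply: compact_bound; first by apply: compact_setX => //; exact: sphere_compact.
  move=> [x u] [/= Kx su].
  have c1 := @metric_continuous x u (Ki x Kx).
  have c2 := @ricci_continuous k e x u (Ka x Kx) (Ki x Kx).
  have r0 : ricci e (x, u).1 (x, u).2 != 0 by rewrite gt_eqF// pos.
  exact: continuousM c1 (cvgV r0 c2).
exists (b + 1)^-1; first by rewrite invr_gt0 ltr_wpDl.
move=> x u Kx; rewrite ler_pdivrMl ?ltr_wpDl//.
have [->|u0] := eqVneq u 0.
  have := ricciZ e 0 0 (Ka x Kx) (Ki x Kx).
  rewrite scale0r {1}/nsq mul0r mul0r => ->.
  by rewrite /herm_pair !mul0mx mxE mulr0.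
have [c [v [c0 sv ->]]] := sphereP u0.
rewrite ricciZ; [|exact: Ka|exact: Ki].
rewrite herm_pairZ -/(part true _) partZ /part mulrCA ler_wpM2l ?nsq_ge0//.
have rp := pos x v Kx sv.
have := hb (x, v) (conj Kx sv); rewrite /= ler_pdivrMr// => /le_trans; apply.
by rewrite ler_wpM2r ?(ltW rp)// lerDl.
Qed.

End Local.

(** A tube argument: [ricci] is jointly continuous and positive on x times the compact unit sphere,
    hence on a neighborhood of x times the sphere, with the same e. *)
Lemma RC_positive_nbhd (k : nat) (w : chart_ix M -> M -> 'M[C]_n) :
  uniformly_RC_positive h w k ->
  forall x, exists (a : chart_ix M) (i : triv_ix E) (e : k.-tuple 'rV[C]_n) (Q : set M),
    [/\ open Q, Q x, Q `<=` source (chart_at a), Q `<=` trivial i &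
        forall y u, Q y -> sphere u -> 0 < ricci a i e y u].
Proof.
move=> hRC x; have [a [i [ax ix [_ [e [_ _ pos]]]]]] := hRC x.
exists a, i, e.
pose G : set M := [set y | forall u, sphere u -> 0 < ricci a i e y u].
have Gx : nbhs x G.
  have /compact_near_coveringP H := @sphere_compact R r.
  apply: (H M (nbhs x) (fun y u => 0 < ricci a i e y u)) => u su.
  have c := @ricci_continuous a i k e x u ax ix.
  have p0 : 0 < ricci a i e x u by apply/gt0_Re/pos/sphere_neq0.
  have := c [set t | 0 < t] (open_nbhs_nbhs (conj (@open_gt _ 0) p0)).
  move=> [[A B] [/= hA hB] AB]; exists (B, A) => // -[u' y] [/= Bu Ay].
  exact: (AB (y, u')).
exists (G^° `&` (source (chart_at a) `&` trivial i)); split.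
- apply: openI; first exact: open_interior.
  by apply: openI; [exact: source_open|exact: trivial_open].
- by [].
- by move=> y [_ []].
- by move=> y [_ []].
- by move=> y u [/nbhs_singleton Gy _]; exact: Gy.
Qed.

End CurvaturePositivity.

(** * Frames of tensor powers *)

Section TensorFrames.
Variables (R : realType) (n : nat) (M : complex_manifold R n).
Local Notation C := (Cplx R).
Implicit Types (x : M) (G : hol_bundle M).

Lemma sum_tens (m p : nat) (F : 'I_(m * p) -> C) :
  \sum_I F I = \sum_i \sum_j F (mxtens_index (i, j)).
Proof.
rewrite pair_big (reindex (fun ij : 'I_m * 'I_p => mxtens_index ij))/=.
  by apply: eq_bigr => -[i j] _.
by exists (@mxtens_unindex m p) => I _; [exact: mxtens_indexK|exact: mxtens_unindexK].
Qed.

Lemma colbd_tens m1 m2 p1 p2 (k l : R) (A : 'M[C]_(m1, m2)) (B : 'M[C]_(p1, p2)) :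
  0 <= k -> colbd k A -> colbd l B -> colbd (k * l) (tensmx A B).
Proof.
move=> k0 hA hB b; case: (mxtens_indexP b) => b1 b2; rewrite sum_tens.
under eq_bigr => i _ do under eq_bigr => j _ do rewrite tensmxE normrM.
under eq_bigr => i _ do rewrite -mulr_sumr.
rewrite -mulr_suml rmorphM/=; apply: ler_pM => //; exact: sumr_ge0.
Qed.

Lemma tens_col_entry m p (A : 'cV[C]_m) (B : 'cV[C]_p) i j :
  (tensmx A B : 'M[C]_(m * p, 1)) (mxtens_index (i, j)) 0 = A i 0 * B j 0.
Proof. by rewrite -tensmxE; congr (tensmx A B _ _); exact: val_inj. Qed.

Fixpoint tpi G (i : triv_ix G) (p : nat) : triv_ix (tensor_power G p) :=
  match p return triv_ix (tensor_power G p) with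
  | 0 => tt
  | p'.+1 => (i, tpi i p')
  end.

Lemma tpi_trivial G (i : triv_ix G) p x : trivial i x -> trivial (tpi i p) x.
Proof. by move=> ix; elim: p => [|p IH]; [exact: I|split]. Qed.

Lemma colbd_tpi G (i j : triv_ix G) p x (k : R) : 0 <= k ->
  colbd k (transition i j x) -> colbd (k ^+ p) (transition (tpi i p) (tpi j p) x).
Proof.
move=> k0 hk; elim: p => [|p IH]; first exact: colbd1.
by rewrite exprS; exact: colbd_tens.
Qed.

(** Components of a decomposable tensor, as a column so that the row of a section can be paired with
    it. *)
Fixpoint tvec G (p : nat) : ('I_p -> 'cV[C]_(rank G)) -> 'cV[C]_(rank (tensor_power G p)) :=
  match p return ('I_p -> 'cV[C]_(rank G)) -> 'cV[C]_(rank (tensor_power G p)) with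
  | 0 => fun=> 1%:M
  | p'.+1 => fun u => tensmx (u ord0) (tvec (fun k => u (lift ord0 k)))
  end.

Lemma transition_tvec G (i j : triv_ix G) p x (u : 'I_p -> 'cV[C]_(rank G)) :
  transition (tpi i p) (tpi j p) x *m tvec u = tvec (fun k => transition i j x *m u k).
Proof.
elim: p u => [|p IH] u; first exact: mul1mx.
refine (etrans (tensmx_mul (transition i j x) (transition (tpi i p) (tpi j p) x)
  (u ord0) (tvec (fun k => u (lift ord0 k)))) _).
by rewrite IH.
Qed.

(** The multi-index b is found before the vectors: each entry is one fixed monomial, from which
    homogeneity, continuity and holomorphy follow. *)
Lemma tvec_entry G p (u : 'I_p -> 'cV[C]_(rank G)) I :
  exists b : 'I_p -> 'I_(rank G), forall u : 'I_p -> 'cV[C]_(rank G),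
    tvec u I 0 = \prod_k u k (b k) 0.
Proof.
move: u => _; elim: p I => [|p IH] I.
  have b : 'I_0 -> 'I_(rank G) by case.
  by exists b => u; rewrite big_ord0 (ord1 I) /= mxE.
case: (mxtens_indexP I) => i J; have [b hb] := IH J.
exists (fun k => if unlift ord0 k is Some k' then b k' else i) => u.
rewrite big_ord_recl unlift_none /=.
refine (etrans (tens_col_entry _ _ _ _) _); rewrite hb; congr (_ * _).
by apply: eq_bigr => k _; rewrite liftK.
Qed.

Lemma tvecZ G p (c : 'I_p -> C) (u : 'I_p -> 'cV[C]_(rank G)) :
  tvec (fun k => c k *: u k) = (\prod_k c k) *: tvec u.
Proof.
apply/colP => I; have [b hb] := tvec_entry u I.
by rewrite mxE !hb -big_split; apply: eq_bigr => k _; rewrite mxE.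
Qed.

(** Basis tensors are decomposable; hence a nonzero section has a nonzero contraction with
    vectors. *)
Lemma tvec_delta G p (I : 'I_(rank (tensor_power G p))) :
  exists b : 'I_p -> 'I_(rank G),
    tvec (fun k => delta_mx (b k) 0) = delta_mx I 0 :> 'cV[C]_(rank (tensor_power G p)).
Proof.
elim: p I => [|p IH] I.
  have b : 'I_0 -> 'I_(rank G) by case.
  exists b => /=.
  by apply/matrixP => a c; rewrite !mxE (ord1 a) (ord1 c) (ord1 I).
case: (mxtens_indexP I) => i J; have [b hb] := IH J.
exists (fun k => if unlift ord0 k is Some k' then b k' else i).
rewrite /= unlift_none; under [X in tvec X]eq_fun do rewrite liftK.
rewrite hb; apply/colP => a; case: (mxtens_indexP a) => a1 a2.
refine (etrans (tens_col_entry _ _ _ _) _); rewrite !mxE eqxx !andbT.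
by rewrite (inj_eq (can_inj (@mxtens_indexK _ _))) xpair_eqE -natrM mulnb.
Qed.

(** Evaluation of the middle tensor factor on U. The middle factor is the one with the dual slots;
    the outer ones are kept in components. *)
Definition evc (A B D : nat) (s : 'rV[C]_(A * B * D)) (a : 'I_A) (U : 'cV[C]_B) (c : 'I_D) : C :=
  \sum_b s 0 (mxtens_index (mxtens_index (a, b), c)) * U b 0.

(** The change of frame in the middle factor is moved onto the argument U, so only the outer factors
    will cost a constant. *)
Lemma evc_change (A B D A' B' D' : nat) (s' : 'rV[C]_(A' * B' * D')) (P : 'M[C]_(A', A))
    (Q : 'M[C]_(B', B)) (S : 'M[C]_(D', D)) a (U : 'cV[C]_B) c :
  evc (s' *m tensmx (tensmx P Q) S) a U c =
  \sum_a' \sum_c' P a' a * S c' c * evc s' a' (Q *m U) c'.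
Proof.
rewrite /evc.
have E b : (s' *m tensmx (tensmx P Q) S) 0 (mxtens_index (mxtens_index (a, b), c)) * U b 0 =
    \sum_a' \sum_c' \sum_b' P a' a * S c' c *
      (s' 0 (mxtens_index (mxtens_index (a', b'), c')) * (Q b' b * U b 0)).
  rewrite mxE sum_tens sum_tens mulr_suml; apply: eq_bigr => a' _.
  rewrite exchange_big mulr_suml; apply: eq_bigr => b' _ /=.
  rewrite mulr_suml; apply: eq_bigr => c' _.
  by rewrite !tensmxE; ring.
rewrite (eq_bigr _ (fun b _ => E b)) exchange_big; apply: eq_bigr => a' _ /=.
rewrite exchange_big; apply: eq_bigr => c' _ /=.
rewrite exchange_big mulr_sumr; apply: eq_bigr => b' _ /=.
by rewrite mxE !mulr_sumr; apply: eq_bigr => b _.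
Qed.

Lemma evc_change_bound (A B D A' B' D' : nat) (s' : 'rV[C]_(A' * B' * D')) (P : 'M[C]_(A', A))
    (Q : 'M[C]_(B', B)) (S : 'M[C]_(D', D)) a (U : 'cV[C]_B) c (k l t : R) :
  0 <= t -> colbd k P -> colbd l S ->
  (forall a' c', `|evc s' a' (Q *m U) c'| <= RtoC t) ->
  `|evc (s' *m tensmx (tensmx P Q) S) a U c| <= RtoC (k * l * t).
Proof.
move=> t0 hP hS ht; rewrite evc_change; apply: le_trans (ler_norm_sum _ _ _) _.
apply: (@le_trans _ _ (\sum_a' `|P a' a| * (\sum_c' `|S c' c| * RtoC t))).
  apply: ler_sum => a' _; apply: le_trans (ler_norm_sum _ _ _) _.
  rewrite mulr_sumr; apply: ler_sum => c' _.
  by rewrite !normrM -mulrA ler_wpM2l// ler_wpM2l.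
rewrite -mulr_suml -mulr_suml -mulrA !rmorphM/=.
have tC : 0 <= RtoC t by rewrite (ler_RtoC 0).
apply: ler_pM => //; first exact: sumr_ge0.
  by apply: mulr_ge0 => //; exact: sumr_ge0.
by rewrite ler_wpM2r.
Qed.

Lemma evcZ (A B D : nat) (s : 'rV[C]_(A * B * D)) a k (U : 'cV[C]_B) c :
  evc s a (k *: U) c = k * evc s a U c.
Proof. by rewrite /evc mulr_sumr; apply: eq_bigr => b _; rewrite mxE mulrCA. Qed.

Lemma evc_neq0 (A B D : nat) (s : 'rV[C]_(A * B * D)) : s != 0 ->
  exists a b c, evc s a (delta_mx b 0) c != 0.
Proof.
move=> s0; apply: contrapT => hn; move/eqP: s0; apply; apply/rowP => I.
case: (mxtens_indexP I) => J c; case: (mxtens_indexP J) => a b; rewrite mxE.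
apply/eqP; apply: contraT => sn; exfalso; apply: hn; exists a, b, c.
rewrite /evc (bigD1 b)//= big1 ?addr0 => [|b' bb].
  by rewrite mxE !eqxx mulr1.
by rewrite mxE (negbTE bb) mulr0.
Qed.

End TensorFrames.

(** * Finite sums and products of holomorphic functions *)

Section HolomorphicSums.
Variables (R : realType) (n : nat) (U : set 'rV[Cplx R]_n).
Hypothesis Uo : open U.
Local Notation C := (Cplx R).

Lemma holomorphic_add (f g : 'rV[C]_n -> C) : holomorphic_on U f -> holomorphic_on U g ->
  holomorphic_on U (fun z => f z + g z).
Proof.
move=> [fs fh] [gs gh]; split=> [|z Uz j]; first exact: (smooth_add Uo).
rewrite dzbar_delbar; refine (etrans (wop_add _ _ Uz fs gs) _).
have e1 := fh z Uz j; have e2 := gh z Uz j; rewrite dzbar_delbar in e1; rewrite dzbar_delbar in e2.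
refine (etrans (_ : _ = delbar (basis_vec R j) f z + delbar (basis_vec R j) g z) _) => //.
by rewrite e1 e2 addr0.
Qed.

Lemma holomorphic_sum (I : Type) (s : seq I) (F : I -> 'rV[C]_n -> C) :
  (forall i, holomorphic_on U (F i)) -> holomorphic_on U (fun z => \sum_(i <- s) F i z).
Proof.
move=> hF; elim: s => [|i s IH].
  by under eq_fun do rewrite big_nil; exact: holomorphic_cst.
by under eq_fun do rewrite big_cons; exact: holomorphic_add.
Qed.

Lemma holomorphic_prod (I : Type) (s : seq I) (F : I -> 'rV[C]_n -> C) :
  (forall i, holomorphic_on U (F i)) -> holomorphic_on U (fun z => \prod_(i <- s) F i z).
Proof.
move=> hF; elim: s => [|i s IH].
  by under eq_fun do rewrite big_nil; exact: holomorphic_cst.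
by under eq_fun do rewrite big_cons; exact: holomorphic_mul.
Qed.

End HolomorphicSums.

(** * The maximum principle *)

(** General entries are needed because a tuple of vectors will be a row whose entries are rows. *)
Lemma mx_entry_continuous (T : topologicalType) (m n : nat) (i : 'I_m) (j : 'I_n) :
  continuous (fun A : 'M[T]_(m, n) => A i j).
Proof.
move=> A B hB; exists (fun i' j' => if (i' == i) && (j' == j) then B else setT).
  move=> i' j'; case: ifPn => [/andP[/eqP-> /eqP->]//|_]; exact: filterT.
by move=> N /(_ i j); rewrite !eqxx.
Qed.

Lemma cRe_sum (R : realType) (I : Type) (s : seq I) (G : I -> Cplx R) :
  complex.Re (\sum_(i <- s) G i) = \sum_(i <- s) complex.Re (G i).
Proof.
by elim: s => [|i s IH]; rewrite ?big_nil// !big_cons ReD IH.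
Qed.

Section MaximumPrinciple.
Variables (R : realType) (n : nat) (M : complex_manifold R n) (E F : hol_bundle M).
Variable h : triv_ix E -> M -> 'M[Cplx R]_(rank E).
Hypothesis hm : bundle_metric h.
Local Notation C := (Cplx R).
Local Notation r := (rank E).
Implicit Types (x y : M).

Variables (TE : finType) (iE : TE -> triv_ix E) (WE KE OE : TE -> set M) (omE : TE -> M -> C).
Hypothesis wE : wcover iE WE KE OE omE.
Variables (TF : finType) (iF : TF -> triv_ix F) (WF KF OF : TF -> set M) (omF : TF -> M -> C).
Hypothesis wF : wcover iF WF KF OF omF.
Variables (k : nat) (ch : TE -> chart_ix M) (e : TE -> k.-tuple 'rV[C]_n).
Hypothesis WEch : forall t, WE t `<=` source (chart_at (ch t)).

(** The trace of d dbar log om over the test directions, that is, the loss to be bounded by c1 or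
    c2. *)
Definition weight_laplacian (om : M -> C) (t : TE) x : R :=
  complex.Re (\sum_(j < k) loglap (tnth (e t) j) (om \o param (chart_at (ch t)))
                                  (Defs.coord (chart_at (ch t)) x)).

Lemma weight_laplacian_bound (om : M -> C) (t : TE) (W K : set M) :
  open W -> compact K -> K `<=` W -> K `<=` source (chart_at (ch t)) ->
  (forall x, W x -> 1 <= om x) -> smooth_fun W om ->
  exists2 b : R, 0 <= b & forall x, K x -> weight_laplacian om t x <= b.
Proof.
move=> Wo cK KW Ks om1 oms; apply: compact_bound => // x Kx.
pose U := in_chart (ch t) W; have Uo : open U by exact: in_chart_open.
have Ux : U (Defs.coord (chart_at (ch t)) x).
  by split; [exact/coord_target/Ks|rewrite coordK; [exact: KW|exact: Ks]].
pose f := om \o param (chart_at (ch t)).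
have fs : smooth_on U f by exact: oms.
have f0 z : U z -> f z ^+ 2 != 0.
  by move=> [_ /om1 h1]; rewrite expf_neq0// gt_eqF// (lt_le_trans _ h1).
have ls X : smooth_on U (loglap X f).
  apply: (smooth_mul Uo); last exact: (smooth_inv Uo f0 (smooth_exp Uo 2 fs)).
  have d1 := smooth_del Uo X fs; have d2 := smooth_delbar Uo X fs.
  have d3 := smooth_delbar Uo X d1.
  apply: (smooth_add Uo); first exact: (smooth_mul Uo fs d3).
  exact: (smooth_opp Uo (smooth_mul Uo d1 d2)).
have cc := Defs.coord_continuous (Ks x Kx).
apply: cont_Re; apply: cont_sum => j.
exact: (continuous_comp cc (smooth_continuous Ux (ls (tnth (e t) j)))).
Qed.

Variable lam : R.
Hypothesis ricci_ge : forall t x u, KE t x ->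
  lam * complex.Re (herm_pair (h (iE t) x) u u) <= ricci h (ch t) (iE t) (e t) x u.

Lemma herm_pair_ge0 i x (u : 'rV[C]_r) : trivial i x -> 0 <= herm_pair (h i x) u u.
Proof.
move=> ix; have [->|u0] := eqVneq u 0; first by rewrite /herm_pair !mul0mx mxE.
exact/ltW/(metric_pos hm).
Qed.

Variables (p q m : nat).
Local Notation EEF := (tensor_bundle
  (tensor_bundle (tensor_power E p) (tensor_power (dual_bundle E) q)) (tensor_power F m)).
Variable s : triv_ix EEF -> M -> 'rV[C]_(rank EEF).
Hypothesis hs : hol_section s.

Definition frame (t : TE) (b : TF) : triv_ix EEF :=
  ((tpi (iE t) p, @tpi _ _ _ (dual_bundle E) (iE t) q), tpi (iF b) m).

Local Notation IE := 'I_(rank (tensor_power E p)).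
Local Notation IF := 'I_(rank (tensor_power F m)).

(* The components with indices a in E^p and c in F^m, in the frames t and b, of
   s evaluated on v_1 (x) ... (x) v_q. *)
Definition contract (t : TE) (b : TF) (a : IE) (c : IF) x (v : 'I_q -> 'rV[C]_r) : C :=
  evc (s (frame t b) x) a (@tvec _ _ _ (dual_bundle E) q (fun j => (v j)^T)) c.

(** The quantity that |[contract]|^2 is compared with: the weights play the part of squared norms on
    E^p and F^m, and h measures the vectors put in the dual slots. *)
Definition bigweight (t : TE) (b : TF) x (v : 'I_q -> 'rV[C]_r) : C :=
  omE t x ^+ p * omF b x ^+ m * \prod_j herm_pair (h (iE t) x) (v j) (v j).

Lemma frame_trivial t b x : trivial (iE t) x -> trivial (iF b) x -> trivial (frame t b) x.
Proof.
move=> tx bx; split; last exact: tpi_trivial.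
by split; [exact: tpi_trivial|exact: (@tpi_trivial _ _ _ (dual_bundle E))].
Qed.

Lemma contractZ t b a c x (d : 'I_q -> C) v :
  contract t b a c x (fun j => d j *: v j) = (\prod_j d j) * contract t b a c x v.
Proof.
rewrite /contract -evcZ -tvecZ; congr (evc _ _ (tvec _) _).
by apply/funext => j; rewrite linearZ.
Qed.

Lemma bigweightZ t b x (d : 'I_q -> C) v :
  bigweight t b x (fun j => d j *: v j) = RtoC (nsq (\prod_j d j)) * bigweight t b x v.
Proof.
rewrite /bigweight mulrCA; congr (_ * _).
rewrite -nsqE rmorph_prod -big_split -big_split; apply: eq_bigr => j _ /=.
by rewrite herm_pairZ nsqE.
Qed.

Lemma bigweight_ge0 t b x v : WE t x -> WF b x -> 0 <= bigweight t b x v.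
Proof.
move=> tx bx; rewrite /bigweight; apply: mulr_ge0; last first.
  by apply: prodr_ge0 => j _; apply/herm_pair_ge0/(wc_W_trivial wE).
by apply: mulr_ge0; apply: exprn_ge0; apply: (le_trans ler01);
  [exact: (wc_om_ge1 wE)|exact: (wc_om_ge1 wF)].
Qed.

Lemma bigweight_gt0 t b x v : WE t x -> WF b x -> (forall j, v j != 0) ->
  0 < bigweight t b x v.
Proof.
move=> tx bx v0; rewrite /bigweight; apply: mulr_gt0; last first.
  by apply: prodr_gt0 => j _; apply: (metric_pos hm) => //; exact: (wc_W_trivial wE).
by apply: mulr_gt0; apply: exprn_gt0; apply: (lt_le_trans ltr01);
  [exact: (wc_om_ge1 wE)|exact: (wc_om_ge1 wF)].
Qed.

(** * The second derivative test at an interior maximum *)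

Section MaxPoint.
Variables (t : TE) (b : TF) (a : IE) (c : IF) (mx : R) (x0 : M) (u : 'I_q -> 'rV[C]_r).
Hypothesis mx0 : 0 < mx.
Hypothesis tx0 : OE t x0.
Hypothesis bx0 : OF b x0.
Hypothesis u0 : forall j, u j != 0.
Hypothesis le_mx : forall x v, OE t x -> OF b x ->
  contract t b a c x v * (contract t b a c x v)^* <= RtoC mx * bigweight t b x v.
Hypothesis eq_mx : contract t b a c x0 u * (contract t b a c x0 u)^* =
  RtoC mx * bigweight t b x0 u.

(** The comparison function P dominates the squared modulus of a holomorphic f and touches it at x0,
    so [loglap_ge0] holds in each direction. Expanding log P gives the weights, and each of the q
    slots contributes at most - lam. *)
Lemma max_point_bound :
  q%:R * lam <= p%:R * weight_laplacian (omE t) t x0 + m%:R * weight_laplacian (omF b) t x0.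
Proof.
have OW y : OE t y -> WE t y by move=> /(wc_OK wE)/(wc_KW wE).
have OWF y : OF b y -> WF b y by move=> /(wc_OK wF)/(wc_KW wF).
have Oo : open (OE t `&` OF b) by apply: openI; [exact: (wc_O_open wE)|exact: (wc_O_open wF)].
pose U := in_chart (ch t) (OE t `&` OF b).
have Uo : open U by exact: in_chart_open.
pose z0 := Defs.coord (chart_at (ch t)) x0.
have sx0 : source (chart_at (ch t)) x0 by exact/WEch/OW.
have pz0 : param (chart_at (ch t)) z0 = x0 by exact: coordK.
have Uz0 : U z0 by split; [exact: coord_target|rewrite pz0].
have tix0 : trivial (iE t) x0 by exact/(wc_W_trivial wE)/OW.
pose H := h (iE t) \o param (chart_at (ch t)).
have Hs : msmooth U H.
  have Hs' : msmooth (in_chart (ch t) (trivial (iE t))) H by exact: local_metric_smooth.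
  move=> i j l; apply: Ck_sub (Hs' i j l) => z [tz [Oz _]].
  by split => //; exact/(wc_W_trivial wE)/OW.
have Hu z : U z -> H z \in unitmx.
  by move=> [_ [Oz _]]; apply: (metric_unit hm); exact/(wc_W_trivial wE)/OW.
pose ut j := flat_ext H z0 (u j).
pose N j z := herm_pair (H z) (ut j z) (ut j z).
have N0 j : N j z0 = herm_pair (h (iE t) x0) (u j) (u j).
  by rewrite /N /ut flat_ext0 /H /= pz0.
have Npos j : 0 < N j z0 by rewrite N0; exact: (metric_pos hm).
have Nnz j : herm_pair (H z0) (u j) (u j) != 0.
  by rewrite /H /= pz0 -N0 gt_eqF.
have NS j X := loglap_flat_ext Uo Hs Hu Uz0 X (Nnz j).
have Ns j : smooth_on U (N j) := (NS j 0).1.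
pose oE := omE t \o param (chart_at (ch t)); pose oF := omF b \o param (chart_at (ch t)).
have oEs : smooth_on U oE.
  move=> l; apply: Ck_sub (wc_om_smooth wE t (ch t) l) => z [tz [Oz _]].
  by split => //; exact: OW.
have oFs : smooth_on U oF.
  move=> l; apply: Ck_sub (wc_om_smooth wF b (ch t) l) => z [tz [_ Oz]].
  by split => //; exact: OWF.
have oE0 : oE z0 != 0.
  by rewrite gt_eqF// (lt_le_trans ltr01)// /oE /= pz0 (wc_om_ge1 wE)//; exact: OW.
have oF0 : oF z0 != 0.
  by rewrite gt_eqF// (lt_le_trans ltr01)// /oF /= pz0 (wc_om_ge1 wF)//; exact: OWF.
pose P z : C := RtoC mx * (oE z ^+ p * oF z ^+ m * \prod_j N j z).
(* Holomorphic, because both the section and the flat extensions of the u j are. *)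
pose f z := contract t b a c (param (chart_at (ch t)) z) (fun j => ut j z).
have fh : holomorphic_on U f.
  apply: (holomorphic_sum Uo) => I; apply: (holomorphic_mul Uo).
    apply: holomorphic_sub (hs.2 (frame t b) _ (ch t)) => z [tz [Oz OFz]].
    split => //; apply: frame_trivial; first exact/(wc_W_trivial wE)/OW.
    exact/(wc_W_trivial wF)/OWF.
  have [B hB] := @tvec_entry _ _ _ (dual_bundle E) q (fun=> 0) I.
  under eq_fun do rewrite hB.
  apply: (holomorphic_prod Uo) => j; under eq_fun do rewrite mxE.
  exact: holomorphic_flat_ext.
have E1s := smooth_exp Uo p oEs; have E2s := smooth_exp Uo m oFs.
have E3s : smooth_on U (fun z => \prod_j N j z) by apply: (smooth_prod Uo) => j _; exact: Ns.
have E12s := smooth_mul Uo E1s E2s; have E123s := smooth_mul Uo E12s E3s.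
have Ps : smooth_on U P := smooth_mul Uo (smooth_cst U _) E123s.
have Pz0 : P z0 = RtoC mx * bigweight t b x0 u.
  rewrite /P /bigweight /oE /oF /= pz0; congr (_ * (_ * _)).
  by apply: eq_bigr => j _; exact: N0.
have fz0 : f z0 = contract t b a c x0 u.
  rewrite /f pz0; congr (contract _ _ _ _ _ _); apply/funext => j.
  exact: flat_ext0.
have mxC : 0 < RtoC mx by rewrite (ltr_RtoC 0).
have f0 : f z0 != 0.
  apply/eqP => f0; have := bigweight_gt0 (OW _ tx0) (OWF _ bx0) u0.
  have : 0 < RtoC mx * bigweight t b x0 u.
    by apply: mulr_gt0 => //; exact: bigweight_gt0 (OW _ tx0) (OWF _ bx0) u0.
  by rewrite -eq_mx -fz0 f0 mul0r ltxx.
have lap X : 0 <= complex.Re (loglap X P z0).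
  apply: (loglap_ge0 Uo X Uz0 fh f0 Ps).
    move=> z [tz [Oz OFz]]; apply: (le_trans (le_mx _ Oz OFz)); exact: lexx.
  by rewrite Pz0 fz0 eq_mx.
have e1 : oE z0 ^+ p != 0 by exact: expf_neq0.
have e2 : oF z0 ^+ m != 0 by exact: expf_neq0.
have e3 : \prod_j N j z0 != 0 by apply/prodf_neq0 => j _; rewrite gt_eqF.
have lapE X : loglap X P z0 =
    p%:R * loglap X oE z0 + m%:R * loglap X oF z0 + \sum_j loglap X (N j) z0.
  rewrite (loglap_mul Uo X Uz0 (smooth_cst U _) E123s) ?loglap_cst ?add0r; first last.
  - by apply: mulf_neq0 => //; exact: mulf_neq0.
  - by rewrite gt_eqF.
  rewrite (loglap_mul Uo X Uz0 E12s E3s)//; last exact: mulf_neq0.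
  rewrite (loglap_mul Uo X Uz0 E1s E2s)// !(loglap_exp Uo)//.
  by rewrite (loglap_prod Uo)// => j; rewrite gt_eqF.
(* By flatness the sum is minus [ricci] at u j over its squared length, which [ricci_ge] bounds. *)
have Nlap j : complex.Re (\sum_(i < k) loglap (tnth (e t) i) (N j) z0) <= - lam.
  have -> : \sum_(i < k) loglap (tnth (e t) i) (N j) z0 =
      - (RtoC ((complex.Re (N j z0))^-1) *
         \sum_(i < k) curvature_form h (ch t) (iE t) x0 (tnth (e t) i) (tnth (e t) i) (u j) (u j)).
    rewrite fmorphV/= -(ge0_RtoC (ltW (Npos j))) mulr_sumr -sumrN; apply: eq_bigr => i _.
    rewrite (NS j _).2 /curvature_form N0 /H /= pz0 mulrC mulrN.
    by [].
  rewrite -/(part true _) partN partZ lerN2 ler_pdivlMl; last exact: gt0_Re.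
  by rewrite mulrC N0; exact: (ricci_ge _ ((wc_OK wE) _ _ tx0)).
have total : 0 <= complex.Re (\sum_(i < k) loglap (tnth (e t) i) P z0).
  by rewrite cRe_sum; apply: sumr_ge0 => i _.
have total2 : \sum_(i < k) loglap (tnth (e t) i) P z0 =
    RtoC p%:R * \sum_(i < k) loglap (tnth (e t) i) oE z0 +
    RtoC m%:R * \sum_(i < k) loglap (tnth (e t) i) oF z0 +
    \sum_j \sum_(i < k) loglap (tnth (e t) i) (N j) z0.
  rewrite !rmorph_nat exchange_big !mulr_sumr -!big_split.
  by apply: eq_bigr => i _; exact: lapE.
have sumN : complex.Re (\sum_j \sum_(i < k) loglap (tnth (e t) i) (N j) z0) <= q%:R * - lam.
  rewrite (_ : q%:R * - lam = \sum_(j < q) - lam); last first.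
    by rewrite sumr_const card_ord mulr_natl.
  by rewrite cRe_sum; apply: ler_sum => j _.
move: total; rewrite total2 !ReD.
have := partZ true p%:R (\sum_(i < k) loglap (tnth (e t) i) oE z0).
have := partZ true m%:R (\sum_(i < k) loglap (tnth (e t) i) oF z0).
rewrite /part => -> ->.
rewrite -[X in p%:R * X]/(weight_laplacian (omE t) t x0).
rewrite -[X in m%:R * X]/(weight_laplacian (omF b) t x0).
move: sumN; rewrite mulrN.
move: (complex.Re _) (weight_laplacian _ _ _) (weight_laplacian _ _ _) => S A B.
lra.
Qed.

End MaxPoint.
Lemma herm_pair_change i j x (u : 'rV[C]_r) : trivial i x -> trivial j x ->
  herm_pair (h i x) u u =
  herm_pair (h j x) (u *m transition i j x) (u *m transition i j x).
Proof.
move=> ix jx; rewrite /herm_pair {1}(metric_compat hm ix jx).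
have -> : conj_tr (u *m transition i j x) = conj_tr (transition i j x) *m conj_tr u.
  by rewrite /conj_tr trmx_mul map_mxM.
by rewrite !mulmxA.
Qed.

(** Passing to other frames only rewrites the components of the vectors in the dual slots, so the
    cost comes from E^p and F^m alone, squared because [nsq] is. *)
Lemma contract_change t b t' b' a c x v (kE kF T : R) :
  trivial (iE t) x -> trivial (iE t') x -> trivial (iF b) x -> trivial (iF b') x ->
  0 <= kE -> 0 <= kF -> 0 <= T ->
  colbd kE (transition (iE t') (iE t) x) -> colbd kF (transition (iF b') (iF b) x) ->
  (forall a' c', nsq (contract t' b' a' c' x (fun j => v j *m transition (iE t) (iE t') x)) <= T) ->
  nsq (contract t b a c x v) <= (kE ^+ p * kF ^+ m) ^+ 2 * T.
Proof.
move=> tx tx' bx bx' kE0 kF0 T0 hE hF hT.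
pose w := Num.sqrt T; have w0 : 0 <= w by exact: sqrtr_ge0.
have w2 : w ^+ 2 = T by rewrite sqr_sqrtr.
rewrite -w2 -exprMn nsq_le; last by rewrite !mulr_ge0// exprn_ge0.
rewrite /contract (hs.1 _ _ _ (frame_trivial tx' bx') (frame_trivial tx bx)).
pose Q := transition (@tpi _ _ _ (dual_bundle E) (iE t') q) (@tpi _ _ _ (dual_bundle E) (iE t) q) x.
apply: (@evc_change_bound _ _ _ _ _ _ _ _ (transition (tpi (iE t') p) (tpi (iE t) p) x) Q
  (transition (tpi (iF b') m) (tpi (iF b) m) x)) => //.
- exact: colbd_tpi.
- exact: colbd_tpi.
move=> a' c'; rewrite -nsq_le// w2; apply: le_trans (hT a' c').
(* Dual transitions are transposed with their indices swapped, so they send the transpose of v j to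
   that of v j read in the frame of t'. *)
rewrite /contract /Q transition_tvec.
rewrite (_ : (fun j => _) = fun j => (v j *m transition (iE t) (iE t') x)^T)//.
by apply/funext => j; rewrite trmx_mul.
Qed.

(** With T the largest squared contraction in the new frames, BW and BW' the old and new weights,
    and kap the squared cost, mx BW <= kap T <= kap mx BW' <= mx BW. All are equalities, so the
    maximum is also attained in the frames for which x is interior. *)
Lemma max_exchange (mx : R) t b a c x u : 0 < mx ->
  (forall t b a c x v, KE t x -> KF b x ->
     nsq (contract t b a c x v) <= mx * complex.Re (bigweight t b x v)) ->
  KE t x -> KF b x -> (forall j, u j != 0) ->
  nsq (contract t b a c x u) = mx * complex.Re (bigweight t b x u) ->
  exists t' b' a' c' u', [/\ OE t' x, OF b' x, forall j, u' j != 0 &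
    nsq (contract t' b' a' c' x u') = mx * complex.Re (bigweight t' b' x u')].
Proof.
move=> mx0 glob tx bx u0 eqm.
have [t' [kE [tx' kE0 hE leE]]] := wc_exchange wE tx.
have [b' [kF [bx' kF0 hF leF]]] := wc_exchange wF bx.
have Wt := wc_KW wE tx; have Wb := wc_KW wF bx.
have Kt' := wc_OK wE tx'; have Kb' := wc_OK wF bx'.
have Wt' := wc_KW wE Kt'; have Wb' := wc_KW wF Kb'.
have it := wc_W_trivial wE Wt; have it' := wc_W_trivial wE Wt'.
have ib := wc_W_trivial wF Wb; have ib' := wc_W_trivial wF Wb'.
pose u' j := u j *m transition (iE t) (iE t') x.
have u'0 j : u' j != 0.
  apply: contra (u0 j) => /eqP e0; rewrite -(mulmx1 (u j)) -(transition_id it).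
  by rewrite -(transition_comp it it' it) mulmxA -/(u' j) e0 mul0mx.
(* A change of frame mixes the outer components, so the indices are chosen afresh as the largest. *)
pose G (ac : IE * IF) := nsq (contract t' b' ac.1 ac.2 x u').
have [[a' c'] _ hmax] : extremum_spec (fun s1 s2 : R => s2 <= s1) predT G
    [arg max_(ac > (a, c)) G ac]%O by exact: arg_maxP.
exists t', b', a', c', u'; split => //.
set BW := complex.Re (bigweight t b x u) in eqm.
set BW' := complex.Re (bigweight t' b' x u').
set T := nsq _.
have BW0 : 0 < BW by apply/gt0_Re/bigweight_gt0.
have T0 : 0 <= T by exact: nsq_ge0.
pose kap : R := (kE ^+ p * kF ^+ m) ^+ 2.
have h1 : mx * BW <= kap * T.
  rewrite -eqm; apply: contract_change hE hF _ => // a2 c2.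
  exact: (hmax (a2, c2)).
have h2 : kap * BW' <= BW.
  have C1 : RtoC kap * bigweight t' b' x u' <= bigweight t b x u.
    have -> : bigweight t b x u = omE t x ^+ p * omF b x ^+ m *
        \prod_j herm_pair (h (iE t') x) (u' j) (u' j).
      by congr (_ * _); apply: eq_bigr => j _; exact: herm_pair_change.
    rewrite /bigweight mulrA; apply: ler_wpM2r.
      by apply: prodr_ge0 => j _; exact: herm_pair_ge0.
    have -> : RtoC kap * (omE t' x ^+ p * omF b' x ^+ m) =
        (RtoC kE ^+ 2 * omE t' x) ^+ p * (RtoC kF ^+ 2 * omF b' x) ^+ m.
      by rewrite /kap rmorphXn/= rmorphM/= !rmorphXn/= !exprMn; ring.
    have o1 := le_trans ler01 (wc_om_ge1 wE Wt'); have o2 := le_trans ler01 (wc_om_ge1 wF Wb').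
    have kEC : 0 <= RtoC kE by rewrite (ler_RtoC 0).
    have kFC : 0 <= RtoC kF by rewrite (ler_RtoC 0).
    have q1 : 0 <= RtoC kE ^+ 2 * omE t' x by rewrite mulr_ge0// exprn_ge0.
    have q2 : 0 <= RtoC kF ^+ 2 * omF b' x by rewrite mulr_ge0// exprn_ge0.
    apply: ler_pM; rewrite ?exprn_ge0//.
      by rewrite lerXn2r// nnegrE (le_trans q1).
    by rewrite lerXn2r// nnegrE (le_trans q2).
  move: C1; rewrite (ge0_RtoC (bigweight_ge0 u' Wt' Wb')) (ge0_RtoC (bigweight_ge0 u Wt Wb)).
  by rewrite -rmorphM ler_RtoC.
have h3 : T <= mx * BW' by exact: glob.
apply/eqP; rewrite eq_le h3 leNgt /=; apply/negP => lt.
(* Positivity of kap is what allows it to be cancelled; kap = 0 would contradict 0 < mx * BW. *)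
have kap0 : 0 < kap.
  rewrite lt0r sqr_ge0 andbT; apply/eqP => k0.
  by move: h1; rewrite k0 mul0r leNgt mulr_gt0.
have : kap * T < kap * (mx * BW') by rewrite ltr_pM2l.
rewrite mulrCA => /lt_le_trans/(_ (ler_wpM2l (ltW mx0) h2)).
by rewrite ltNge h1.
Qed.

(** The quotient of |[contract]|^2 by [bigweight] is invariant under rescaling each vector, so it is
    maximized over unit vectors, the compact sets K and finitely many frames and indices. The
    maximum is positive since basis vectors detect a nonzero component of s. *)
Lemma global_max : (exists i x, trivial i x /\ s i x != 0) ->
  exists (mx : R) t b a c x u, [/\ 0 < mx,
  (forall t b a c x v, KE t x -> KF b x ->
     nsq (contract t b a c x v) <= mx * complex.Re (bigweight t b x v)),
  [/\ KE t x, KF b x & forall j, u j != 0] &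
  nsq (contract t b a c x u) = mx * complex.Re (bigweight t b x u)].
Proof.
move=> [i1 [x1 [ix1 s1]]].
have [t1 tx1] := wc_cover wE x1; have [b1 bx1] := wc_cover wF x1.
have Kt1 := wc_OK wE tx1; have Kb1 := wc_OK wF bx1.
have fx1 : trivial (frame t1 b1) x1.
  by apply: frame_trivial; [exact/(wc_W_trivial wE)/(wc_KW wE)|exact/(wc_W_trivial wF)/(wc_KW wF)].
have sf : s (frame t1 b1) x1 != 0.
  apply: contra s1 => /eqP e0.
  by rewrite (hs.1 _ _ _ fx1 ix1) e0 mul0mx.
have [a1 [B [c1 ev0]]] := evc_neq0 sf.
have [bf hbf] := @tvec_delta _ _ _ (dual_bundle E) q B.
pose v1 (j : 'I_q) : 'rV[C]_r := delta_mx 0 (bf j).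
have v10 j : v1 j != 0.
  apply/eqP => /matrixP/(_ 0 (bf j)); rewrite !mxE !eqxx => /eqP.
  by rewrite oner_eq0.
have cv1 : contract t1 b1 a1 c1 x1 v1 != 0.
  rewrite /contract (_ : tvec _ = delta_mx B 0)// -hbf; congr (tvec _).
  by apply/funext => j; exact: trmx_delta.
pose I := (TE * TF * (IE * IF))%type.
(* The q vectors form one row, so that a product of spheres is compact by [rV_compact]. *)
pose A (i : I) : set (M * 'rV['rV[C]_r]_q) :=
  (KE i.1.1 `&` KF i.1.2) `*` [set v : 'rV['rV[C]_r]_q | forall j, sphere (v ord0 j)].
pose G (i : I) (y : M * 'rV['rV[C]_r]_q) : R :=
  nsq (contract i.1.1 i.1.2 i.2.1 i.2.2 y.1 (fun j => y.2 0 j)) *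
  (complex.Re (bigweight i.1.1 i.1.2 y.1 (fun j => y.2 0 j)))^-1.
have cA i : compact (A i).
  apply: compact_setX; last exact: (@rV_compact _ q (fun=> @sphere R r) (fun=> @sphere_compact R r)).
  apply: compact_closedI; first exact: (wc_K_compact wE).
  by apply: compact_closed; [exact: carrier_hausdorff|exact: (wc_K_compact wF)].
have cG i (y : M * 'rV['rV[C]_r]_q) : A i y -> {for y, continuous (G i)}.
  case: i y => [[t b] [a c]] [x v] [/= [tx bx] sv].
  have Wt := wc_KW wE tx; have Wb := wc_KW wF bx.
  have it := wc_W_trivial wE Wt; have ib := wc_W_trivial wF Wb.
  have k1 : {for (x, v), continuous (fst : M * 'rV['rV[C]_r]_q -> M)} by exact: cvg_fst.
  have k2 : {for (x, v), continuous (snd : M * 'rV['rV[C]_r]_q -> 'rV['rV[C]_r]_q)} by exact: cvg_snd.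
  have cfst (g : M -> C) : {for x, continuous g} ->
      {for (x, v), continuous (fun y : M * 'rV['rV[C]_r]_q => g y.1)}.
    by move=> cg; exact: (continuous_comp k1 cg).
  have cv j : {for (x, v), continuous (fun y : M * 'rV['rV[C]_r]_q => y.2 0 j)}.
    have c3 : {for v, continuous (fun w : 'rV['rV[C]_r]_q => w 0 j)} by exact: mx_entry_continuous.
    exact: (continuous_comp k2 c3).
  have cvl j l : {for (x, v), continuous (fun y : M * 'rV['rV[C]_r]_q => y.2 0 j 0 l)}.
    have c3 : {for v 0 j, continuous (fun w : 'rV[C]_r => w 0 l)} by exact: mx_entry_continuous.
    exact: (continuous_comp (cv j) c3).
  have cN : {for (x, v), continuous (fun y : M * 'rV['rV[C]_r]_q =>
      contract t b a c y.1 (fun j => y.2 0 j))}.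
    apply: cont_sum => J; apply: cont_mul.
      have To : open (trivial (frame t b)) by exact: trivial_open.
      exact: (cfst _ (smooth_fun_continuous To (frame_trivial it ib)
                        (fun d => (hs.2 (frame t b) _ d).1))).
    have [Bf hBf] := @tvec_entry _ _ _ (dual_bundle E) q (fun=> 0) J.
    have cp : {for (x, v), continuous (fun y : M * 'rV['rV[C]_r]_q => \prod_j y.2 0 j 0 (Bf j))}.
      by apply: cont_prod => j; exact: cvl.
    by refine (cont_ext _ cp) => y; rewrite hBf; apply: eq_bigr => j _; rewrite mxE.
  have cW : {for (x, v), continuous (fun y : M * 'rV['rV[C]_r]_q =>
      bigweight t b y.1 (fun j => y.2 0 j))}.
    apply: cont_mul; first apply: cont_mul.
    - apply: cont_exp; apply: cfst.
      exact: (smooth_fun_continuous (wc_W_open wE t) Wt (wc_om_smooth wE t)).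
    - apply: cont_exp; apply: cfst.
      exact: (smooth_fun_continuous (wc_W_open wF b) Wb (wc_om_smooth wF b)).
    apply: cont_prod => j.
    have cS : {for (x, v), continuous (fun y : M * 'rV['rV[C]_r]_q =>
        \sum_d \sum_l y.2 0 j 0 l * h (iE t) y.1 l d * (y.2 0 j 0 d)^*)}.
      apply: cont_sum => d; apply: cont_sum => l.
      have ck := smooth_fun_continuous (trivial_open (iE t)) it (metric_smooth hm (iE t) l d).
      exact: (cont_mul (cont_mul (cvl j l) (cfst _ ck)) (cont_conj (cvl j d))).
    by refine (cont_ext _ cS) => y; rewrite herm_pairE.
  have W0 : complex.Re (bigweight t b (x, v).1 (fun j => (x, v).2 0 j)) != 0.
    by rewrite gt_eqF//; apply/gt0_Re/bigweight_gt0 => // j; exact/sphere_neq0/sv.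
  exact: continuousM (cont_nsq cN) (cvgV W0 (cont_Re cW)).
have normalize (v : 'I_q -> 'rV[C]_r) : (forall j, v j != 0) ->
    exists (d : 'I_q -> C) (v' : 'rV['rV[C]_r]_q),
      (forall j, sphere (v' 0 j)) /\ v = fun j => d j *: v' 0 j.
  move=> v0; have [d hd] := choice (fun j => sphereP (v0 j)).
  have [v' hv'] := choice hd.
  exists d, (\row_j v' j); split; first by move=> j; rewrite mxE; have [_ sv _] := hv' j.
  by apply/funext => j; rewrite mxE; have [_ _ ev] := hv' j.
have [|[[t b] [a c]] [[x v] [[/= [tx bx] sv] hmax]]] := compact_max cA cG.
  have [d [v' [sv' _]]] := normalize v1 v10.
  by exists ((t1, b1), (a1, c1)), (x1, v').
pose mx := G ((t, b), (a, c)) (x, v).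
have glob t' b' a' c' x' v' : KE t' x' -> KF b' x' ->
     nsq (contract t' b' a' c' x' v') <= mx * complex.Re (bigweight t' b' x' v').
  move=> tx' bx'; have Wt := wc_KW wE tx'; have Wb := wc_KW wF bx'.
  have ReZ (z : R) (w : C) : complex.Re (RtoC z * w) = z * complex.Re w by exact: (partZ true).
  (* If one vector is zero it may be multiplied by 0, and homogeneity makes both sides vanish. *)
  have [[j0 vj0]|nz] := pselect (exists j, v' j = 0).
    have -> : v' = fun j => (j != j0)%:R *: v' j.
      by apply/funext => j; case: eqVneq => [->|_]; rewrite ?scale1r// scale0r.
    have z0 : \prod_j ((j != j0)%:R : C) = 0 by rewrite (bigD1 j0)//= eqxx mul0r.
    by rewrite contractZ bigweightZ z0 mul0r ReZ /nsq mul0r/= mul0r mulr0.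
  have [|d [v2 [sv2 ->]]] := normalize v'.
    by move=> j; apply/eqP => vj; apply: nz; exists j.
  rewrite contractZ bigweightZ ReZ nsqM mulrCA; apply: ler_wpM2l; first exact: nsq_ge0.
  have := hmax ((t', b'), (a', c')) (x', v2) (conj (conj tx' bx') sv2).
  rewrite {1}/G /= ler_pdivrMr//.
  by apply/gt0_Re/bigweight_gt0 => // j; exact: sphere_neq0.
have Wt := wc_KW wE tx; have Wb := wc_KW wF bx.
have v0 j : v 0 j != 0 by exact/sphere_neq0/sv.
exists mx, t, b, a, c, x, (fun j => v 0 j); split => //.
- have g1 := glob t1 b1 a1 c1 x1 v1 Kt1 Kb1.
  have n0 : 0 < nsq (contract t1 b1 a1 c1 x1 v1) by rewrite lt0r nsq_ge0 nsq_eq0 cv1.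
  have w0 : 0 < complex.Re (bigweight t1 b1 x1 v1).
    by apply/gt0_Re/bigweight_gt0 => //; [exact: (wc_KW wE)|exact: (wc_KW wF)].
  by have := lt_le_trans n0 g1; rewrite pmulr_lgt0.
- rewrite /mx /G /= divfK// gt_eqF//.
  by apply/gt0_Re/bigweight_gt0.
Qed.

Lemma section_bound : (exists i x, trivial i x /\ s i x != 0) ->
  exists t b x, [/\ KE t x, KF b x & q%:R * lam <=
    p%:R * weight_laplacian (omE t) t x + m%:R * weight_laplacian (omF b) t x].
Proof.
move=> /global_max[mx [t [b [a [c [x [u [mx0 glob [tx bx u0] eqm]]]]]]]].
have [t' [b' [a' [c' [u' [tx' bx' u'0 eqm']]]]]] := max_exchange mx0 glob tx bx u0 eqm.
have Kt := wc_OK wE tx'; have Kb := wc_OK wF bx'.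
exists t', b', x; split => //.
have RtoCbw t2 b2 x2 v : KE t2 x2 -> KF b2 x2 ->
    RtoC mx * bigweight t2 b2 x2 v = RtoC (mx * complex.Re (bigweight t2 b2 x2 v)).
  move=> h1 h2; rewrite rmorphM/= -ge0_RtoC//; apply: bigweight_ge0.
    exact: (wc_KW wE).
  exact: (wc_KW wF).
apply: (@max_point_bound t' b' a' c' mx x u') => //.
  move=> x2 v h1 h2; rewrite RtoCbw; [|exact: (wc_OK wE)|exact: (wc_OK wF)].
  by rewrite nsqE ler_RtoC; apply: glob; [exact: (wc_OK wE)|exact: (wc_OK wF)].
by rewrite RtoCbw// nsqE eqm'.
Qed.

End MaximumPrinciple.

(** * Choice of the constants and contradiction with a nonzero section *)

Theorem theorem2p3 (R : realType) (n k : nat) (M : complex_manifold R n)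
  (w : chart_ix M -> M -> 'M[Cplx R]_n)
  (E : hol_bundle M) (h : triv_ix E -> M -> 'M[Cplx R]_(rank E)) :
  compact [set: M] ->
  manifold_metric w ->
  (1 <= k <= n)%N ->
  bundle_metric h ->
  uniformly_RC_positive h w k ->
  exists2 C1 : R, 0 < C1 &
  forall F : hol_bundle M,
  exists2 C2 : R, 0 < C2 &
  forall p q m : nat, C1 * p%:R + C2 * m%:R < q%:R ->
  H0_eq0 (tensor_bundle
            (tensor_bundle (tensor_power E p) (tensor_power (dual_bundle E) q))
            (tensor_power F m)).
Proof.
move=> Mc _ _ hm hRC.
have hdata x : exists d : chart_ix M * triv_ix E * k.-tuple 'rV[Cplx R]_n * set M,
    [/\ open d.2, d.2 x, d.2 `<=` source (chart_at d.1.1.1), d.2 `<=` trivial d.1.1.2 &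
        forall y u, d.2 y -> sphere u -> 0 < ricci h d.1.1.1 d.1.1.2 d.1.2 y u].
  by have [a [i [e [Q HQ]]]] := RC_positive_nbhd hm hRC x; exists (a, i, e, Q).
have [d hd] := choice hdata.
have Qo x : open (d x).2 by have [] := hd x.
have Qx x : (d x).2 x by have [] := hd x.
have Qs x : (d x).2 `<=` source (chart_at (d x).1.1.1) by have [] := hd x.
have Qi x : (d x).2 `<=` trivial (d x).1.1.2 by have [] := hd x.
have Qpos x := let: And5 _ _ _ _ H := hd x in H.
(* Each piece lies in a set where one chart, one frame and one tuple of directions give positive
   curvature. *)
have [TE [pt [WE [KE [OE [omE [wE WQ]]]]]]] := wcover_exists Mc Qo Qx Qi.
pose ch t := (d (pt t)).1.1.1; pose e t := (d (pt t)).1.2.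
have KEc t : compact (KE t) by exact: (wc_K_compact wE).
have KEW t : KE t `<=` WE t by exact: (wc_KW wE).
have WEo t : open (WE t) by exact: (wc_W_open wE).
have omE1 t x : WE t x -> 1 <= omE t x by exact: (wc_om_ge1 wE).
have WEch t : WE t `<=` source (chart_at (ch t)) by move=> x /WQ/Qs.
have hlam t : exists l : R, 0 < l /\ forall x u, KE t x ->
    l * complex.Re (herm_pair (h (d (pt t)).1.1.2 x) u u) <= ricci h (ch t) (d (pt t)).1.1.2 (e t) x u.
  have [|||l l0 hl] := @ricci_lower_bound _ _ _ _ _ hm (ch t) (d (pt t)).1.1.2 k (e t) (KE t)
      (KEc t).
  - by move=> x /(wc_KW wE)/WEch.
  - by move=> x /(wc_KW wE)/(wc_W_trivial wE).
  - by move=> x u Kx; apply: Qpos; exact/WQ/(wc_KW wE).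
  by exists l.
have [l /all_and2[l0 hl]] := choice hlam.
(* A common lower bound of the l t; the added 1 keeps it positive for an empty index set. *)
pose lam : R := (1 + \sum_t (l t)^-1)^-1.
have sl0 : 0 <= \sum_t (l t)^-1 by apply: sumr_ge0 => t _; rewrite invr_ge0 ltW.
have lam0 : 0 < lam by rewrite invr_gt0 ltr_pwDl.
have lam_le t : lam <= l t.
  rewrite /lam -[l t]invrK lef_pV2 ?posrE ?invr_gt0 ?ltr_pwDl// (bigD1 t)//= addrCA lerDl.
  by rewrite addr_ge0// sumr_ge0// => i _; rewrite invr_ge0 ltW.
have ricci_ge t x u : KE t x ->
    lam * complex.Re (herm_pair (h (d (pt t)).1.1.2 x) u u) <= ricci h (ch t) (d (pt t)).1.1.2 (e t) x u.
  move=> Kx; apply: le_trans (hl t x u Kx); apply: ler_wpM2r => //.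
  by apply/ge0_Re/(herm_pair_ge0 hm)/(wc_W_trivial wE)/(wc_KW wE).
have hc1 t : exists c : R, 0 <= c /\ forall x, KE t x -> weight_laplacian ch e (omE t) t x <= c.
  have [|c c0 hc] := @weight_laplacian_bound _ _ _ _ k ch e (omE t) t (WE t) (KE t) (WEo t)
    (KEc t) (KEW t) _ (omE1 t) (wc_om_smooth wE t).
    by move=> x /(wc_KW wE)/WEch.
  by exists c.
have [c /all_and2[c0 hc]] := choice hc1.
pose c1 := \sum_t c t.
have c1ge t : c t <= c1 by rewrite /c1 (bigD1 t)//= lerDl; exact: sumr_ge0.
have c10 : 0 <= c1 by exact: sumr_ge0.
(* Fixed before F is introduced; c1 may be 0, so 1 is added to make the constant positive. *)
exists ((c1 + 1) / lam); first by rewrite divr_gt0// ltr_wpDl.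
move=> F.
have [iF hiF] := choice (@trivial_cover _ _ _ F).
have [TF [ptF [WF [KF [OF [omF [wF _]]]]]]] :=
  wcover_exists Mc (fun x => trivial_open (iF x)) hiF (fun x y h => h).
have WFo t : open (WF t) by exact: (wc_W_open wF).
have omF1 t x : WF t x -> 1 <= omF t x by exact: (wc_om_ge1 wF).
(* The weights of F are differentiated in the charts and directions of E, whence a bound for each
   pair of pieces on their compact intersection. *)
have hc2 (tb : TE * TF) : exists c : R, 0 <= c /\ forall x, KE tb.1 x -> KF tb.2 x ->
    weight_laplacian ch e (omF tb.2) tb.1 x <= c.
  have [||| g g0 hg] := @weight_laplacian_bound _ _ _ _ k ch e (omF tb.2) tb.1 (WF tb.2)
    (KE tb.1 `&` KF tb.2) (WFo tb.2) _ _ _ (omF1 tb.2) (wc_om_smooth wF tb.2).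
  - apply: compact_closedI; first exact: KEc.
    by apply: compact_closed; [exact: carrier_hausdorff|exact: (wc_K_compact wF)].
  - by move=> x [_ /(wc_KW wF)].
  - by move=> x [/(wc_KW wE)/WEch].
  by exists g; split => // x h1 h2; apply: hg.
have [g /all_and2[g0 hg]] := choice hc2.
pose c2 := \sum_tb g tb.
have c2ge tb : g tb <= c2 by rewrite /c2 (bigD1 tb)//= lerDl; exact: sumr_ge0.
have c20 : 0 <= c2 by exact: sumr_ge0.
exists ((c2 + 1) / lam); first by rewrite divr_gt0// ltr_wpDl.
move=> p q m hq s hs i x ix; apply: contrapT => /eqP sn0.
have [|t [b [y [ty byy le]]]] := section_bound hm wE wF WEch ricci_ge hs.
  by exists i, x.
have h1 : p%:R * weight_laplacian ch e (omE t) t y <= p%:R * c1.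
  by apply: ler_wpM2l => //; exact: le_trans (hc t y ty) (c1ge t).
have h2 : m%:R * weight_laplacian ch e (omF b) t y <= m%:R * c2.
  by apply: ler_wpM2l => //; exact: le_trans (hg (t, b) y ty byy) (c2ge (t, b)).
(* The assumed inequality multiplied by lam; it contradicts q lam <= p c1 + m c2. *)
have h3 : (c1 + 1) * p%:R + (c2 + 1) * m%:R < q%:R * lam.
  by rewrite -ltr_pdivrMr// mulrDl !(mulrAC _ _ lam^-1).
have p0 : 0 <= p%:R :> R by []; have m0 : 0 <= m%:R :> R by [].
move: le h1 h2 h3 p0 m0; move: (q%:R * lam) (p%:R : R) (m%:R : R) => Q P S.
move: (weight_laplacian _ _ _ _ _) (weight_laplacian _ _ _ _ _) => A B.
move=> *; nra.
Qed.
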